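(* There is a universal constant $c_{\mathrm{bdg}}>0$ such that the following holds. Assume the localized Slater condition (LSCQ) with constants $\eta_*>0$ and $\vartheta_*$, and that $x\mapsto F_i(x,\xi)$ is convex on $Y$ for all $i\in\mathcal I_0$, $\xi\in\Xi$. Assume $(\sigma_*^2,\sigma^2(\vartheta,\delta),\alpha,\rho)$-goodness over $Z=X_\delta^{*,\vartheta}$ for every $(\vartheta,\delta)\in[0,\vartheta_*]\times[0,\eta_*]$, where $\sigma^2(\vartheta,\delta)$ depends continuously on $(\vartheta,\delta)$ and the other parameters are fixed. Fix $t\ge0$. For $0<\epsilon\le\vartheta_*$ and $0\le\delta<\eta_*$ with $\epsilon+\mathrm{gap}(-\delta)\le\vartheta_*$ set $$\widehat w_N(t;\delta;\epsilon):=\sigma(\epsilon+\mathrm{gap}(-\delta);\delta)\left\{4\sqrt3\,\frac{\gamma_2^{(\alpha)}(X^{*,\epsilon+\mathrm{gap}(-\delta)})}{\sqrt N}+6\sqrt3\,\frac{\mathrm{diam}^\alpha(X^{*,\epsilon+\mathrm{gap}(-\delta)})\sqrt{1+\log(2|\mathcal I|+2)+t}}{\sqrt N}\right\}.$$ If $\mathcal I=\emptyset$, set $\check\delta(t;\epsilon):=0$ and $\check w(t;\epsilon):=\widehat w_N(t;0;\epsilon)$. If $\mathcal I\neq\emptyset$, let $$S_{N,\eta_*}(t;\epsilon):=\left\{\delta\in(0,\eta_* ):\ \epsilon+\mathrm{gap}(-\delta)\le\vartheta_*,\ \ \widehat w_N(t;\delta;\epsilon)+\sigma_*\sqrt{\tfrac{6(1+\log(2|\mathcal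 I|+2)+t)}{N}}<\delta\right\}$$ and, for those $\epsilon$ for which this set is nonempty, $\check\delta(t;\epsilon):=\inf S_{N,\eta_*}(t;\epsilon)$ and $\check w(t;\epsilon):=\widehat w_N(t;\check\delta(t;\epsilon);\epsilon)$. Fix $\epsilon_0\in[0,\vartheta_* )$ and assume that $$R_{N,\eta_*}(t;\epsilon_0):=\{\epsilon\in(\epsilon_0,\vartheta_*]:\ \epsilon>\epsilon_0+\mathrm{gap}(-\check\delta(t;\epsilon))+2\check w(t;\epsilon)\}$$ ($\epsilon$ ranging over values for which $\check\delta(t;\epsilon)$ is defined) is nonempty. Let $\check r(t;\epsilon_0):=\inf R_{N,\eta_*}(t;\epsilon_0)$ and $\check\delta(t):=\lim_{\epsilon\searrow\check r(t;\epsilon_0)}\check\delta(t;\epsilon)$. Let $\mathrm{Good}(t,\epsilon_0)$ be the event where all of the following hold: (a) $\widehat X^{*,\epsilon_0}\subset X_{\check\delta(t)}^{*,\check r(t;\epsilon_0)}$, i.e. all $x\in\widehat X$ with $\widehat F(x)\le\widehat F^*+\epsilon_0$ satisfy $f(x)\le f^*+\check r(t;\epsilon_0)$ and $\max_{i\in\mathcal I}f_i(x)\le\check\delta(t)$; (b) $$|\widehat F^*-f^*|\le\sigma_*\sqrt{\tfrac{6(1+\log(2|\mathcal I|+2)+t)}{N}}+\frac{\check r(t;\epsilon_0)}2+\max\{\check r(t;\epsilon_0),\mathrm{gap}(\check\delta(t))\};$$ (c) for all $x\in\widehat X^{*,\epsilon_0}$, $$\mathrm{dist}(x,X)\le\min\left\{\frac{\mathrm{diam}(X^{*,\vartheta_*})\,\check\delta(t)}{\eta_*},\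 2\,\mathrm{diam}(X^{*,\check r(t;\epsilon_0)})\right\}.$$ Then $\mathbb P(\mathrm{Good}(t,\epsilon_0))\ge1-e^{-t}-2(|\mathcal I|+1)\rho$. If one assumes $(\sigma_*^2,\sigma^2(\vartheta,\delta),\alpha,p,\kappa_p)$-greatness instead of $(\sigma_*^2,\sigma^2(\vartheta,\delta),\alpha,\rho)$-goodness (over the same sets), then one may take $\rho=(c_{\mathrm{bdg}}\,\kappa_p\sqrt{p/N})^p$.
   Context: Setting. $\|\cdot\|$ is a norm on $\mathbb R^d$; $\mathrm{diam}$ and $\mathrm{dist}(x,A)=\inf_{a\in A}\|x-a\|$ are taken in this norm. $\mathcal I$ is a finite (possibly empty) index set, $0\notin\mathcal I$, $\mathcal I_0=\mathcal I\cup\{0\}$. $(\Xi,\sigma(\Xi),\mathbf P)$ is a probability space and $\xi_1,\dots,\xi_N$ are i.i.d. with law $\mathbf P$, defined on $(\Omega,\mathcal A,\mathbb P)$. For a function $H$ on $\Xi$, $\mathbf E H=\int H\,d\mathbf P$ and $\widehat{\mathbf E}H=\frac1N\sum_{k=1}^N H(\xi_k)$. $Y\subset\mathbb R^d$, and for $i\in\mathcal I_0$, $F_i:Y\times\Xi\to\mathbb R$ is Carathéodory (measurable in $\xi$, continuous in $x$) with $\mathbf E|F_i(x,\cdot)|<\infty$ for all $x\in Y$; $f_i(x):=\mathbf E F_i(x,\cdot)$, $\widehat F_i(x):=\widehat{\mathbf E}F_i(x,\cdot)$, $f:=f_0$, $\widehat F:=\widehat F_0$. Ideal problem: for $\delta\in\mathbb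 R$, $X_\delta:=\{x\in Y: f_i(x)\le\delta\ \forall i\in\mathcal I\}$, $X:=X_0\neq\emptyset$ (so $X_\delta=Y$ if $\mathcal I=\emptyset$). $f^*:=\min_X f$ is assumed attained, and $x^*\in X$ is a fixed minimizer. $f^*_\delta:=\inf_{X_\delta}f$, $\mathrm{gap}(\delta):=|f^*_\delta-f^*|$ (when $X_\delta\ne\emptyset$). $X_\delta^{*,\vartheta}:=\{x\in X_\delta: f(x)\le f^*+\vartheta\}$ and $X^{*,\vartheta}:=X_0^{*,\vartheta}$. Sample average approximation (SAA): $\widehat X:=\{x\in Y:\widehat F_i(x)\le0\ \forall i\in\mathcal I\}$, $\widehat F^*:=\min_{\widehat X}\widehat F$ (the SAA is assumed always to have a solution), $\widehat X^{*,\vartheta}:=\{x\in\widehat X:\widehat F(x)\le\widehat F^*+\vartheta\}$. Localized Slater condition (LSCQ) with constants $\eta_*,\vartheta_*$: $Y$ is convex and closed, the $f_i$ ($i\in\mathcal I_0$) are continuous and convex, $\eta_*>0$, $X^{*,\vartheta_*}$ is bounded and $X_{-\eta_*}^{*,\vartheta_*}\ne\emptyset$, i.e. there is $x\in Y$ with $f(x)\le f^*+\vartheta_*$ and $f_i(x)\le-\eta_*$ for all $i\in\mathcal I$. Good and great functions. $h:\Xi\to\mathbb R_+$ is $(\sigma^2,\rho)$-good if $\mathbf E h\le\sigma^2$ and $\mathbb P\{\widehat{\mathbf E}h>2\sigma^2\}\le\rho$. For $p\ge2$, it is $(\sigma^2,p,\kappa_p)$-great if $\mathbf E h\le\sigma^2$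 and $\|h(\xi)-\mathbf E h\|_{L^p}\le\kappa_p\sigma^2$ for $\xi\sim\mathbf P$. $(\sigma_*^2,\sigma^2,\alpha,\rho)$-goodness over a set $Z\subset Y$ with $x^*\in Z$ (where $\sigma^2,\sigma_*^2,\rho>0$, $\alpha\in(0,1]$) means: the $f_i$ and $F_i(\cdot,\xi)$, $i\in\mathcal I_0$, are continuous on $Y$; for each $i\in\mathcal I_0$ the function $\xi\mapsto(F_i(x^*,\xi)-f_i(x^* ))^2$ is $(\sigma_*^2,\rho)$-good; and for each $i\in\mathcal I_0$ there is $\mathsf L_i:\Xi\to\mathbb R$ such that $\mathsf L_i^2$ is $(\sigma^2,\rho)$-good and $|F_i(x,\xi)-F_i(x',\xi)|\le\mathsf L_i(\xi)\|x-x'\|^\alpha$ for all $x,x'\in Z$, $\xi\in\Xi$. $(\sigma_*^2,\sigma^2,\alpha,p,\kappa_p)$-greatness over $Z$ (with $p\ge2$, $\kappa_p\ge1$) is the same with ''$(\sigma_*^2,\rho)$-good'', ''$(\sigma^2,\rho)$-good'' replaced by ''$(\sigma_*^2,p,\kappa_p)$-great'', ''$(\sigma^2,p,\kappa_p)$-great''. $\sigma(\vartheta;\delta)$ denotes the positive square root of $\sigma^2(\vartheta,\delta)$. Generic chaining functional. For a metric space $(\mathcal M,\mathrm d)$, a sequence $\{\mathcal A_j\}_{j\ge0}$ of partitions of $\mathcal M$ is admissible if $|\mathcal A_0|=1$ and $|\mathcal A_j|\le2^{2^j}$ for $j\ge1$; $\mathrm{diam}(\mathcal A_j)$ is the largest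 diameter of a cell of $\mathcal A_j$; $\gamma_2^{(\alpha)}(\mathcal M):=\inf_{\{\mathcal A_j\}\text{ admissible}}\sum_{j\ge0}2^{j/2}\mathrm{diam}(\mathcal A_j)^\alpha$. Subsets of $\mathbb R^d$ carry the metric of $\|\cdot\|$. *)

(* Defs.v *)
From HB Require Import structures.
From mathcomp Require Import all_boot all_order all_algebra.
From mathcomp Require Import all_classical all_reals all_analysis.

Set Implicit Arguments.
Unset Strict Implicit.
Unset Printing Implicit Defensive.

Import Order.TTheory GRing.Theory Num.Theory.
Import numFieldNormedType.Exports.

Local Open Scope classical_set_scope.
Local Open Scope card_scope.
Local Open Scope ring_scope.

(* An arbitrary norm on R^d.  Topological notions on 'rV[R]_d (closed,
   continuous, bounded_set) are the library's; they agree with those of any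
   norm since the dimension is finite. *)
Record is_norm (R : realType) (d : nat) (nrm : 'rV[R]_d -> R) : Prop := IsNorm {
  norm_triangle : forall x y, nrm (x + y) <= nrm x + nrm y;
  norm_homogeneous : forall a x, nrm (a *: x) = `|a| * nrm x;
  norm_definite : forall x, nrm x = 0 -> x = 0
}.

Section generic_chaining.
Context {R : realType} {T : Type}.
Variables (dst : T -> T -> R) (alpha : R).

Definition ediam (A : set T) : \bar R :=
  ereal_sup [set (dst p.1 p.2)%:E | p in A `*` A].

Definition mesh (C : set (set T)) : \bar R := ereal_sup [set ediam c | c in C].

Definition admissible (M : set T) (A : nat -> set (set T)) : Prop :=
  [/\ forall j, partition (A j) id M,
      A 0%N #= `I_1
    & forall j, (1 <= j)%N -> A j #<= `I_(2 ^ (2 ^ j))].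

Definition gamma2 (M : set T) : \bar R :=
  ereal_inf [set (\sum_(0 <= j <oo)
                    (powR 2 (j%:R / 2))%:E * poweR (mesh (A j)) alpha)%E
            | A in admissible M].

End generic_chaining.

Section norm_geometry.
Context {R : realType} {d : nat}.
Variable nrm : 'rV[R]_d -> R.

Definition ndist (x y : 'rV[R]_d) : R := nrm (x - y).

(* fine is harmless on nonempty bounded sets *)
Definition diam (A : set 'rV[R]_d) : R := fine (ediam ndist A).

Definition dist_to (x : 'rV[R]_d) (A : set 'rV[R]_d) : R :=
  inf [set ndist x a | a in A].

End norm_geometry.

Section sampling.
Context {R : realType} {dX dO : measure_display}.
Context {Xi : measurableType dX} {Omega : measurableType dO}.
Variables (P : probability Xi R) (Pr : probability Omega R).
Variables (N : nat) (xi : 'I_N -> {RV Pr >-> Xi}).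

Definition iid_with_law : Prop :=
  (forall k (B : set Xi), measurable B -> distribution Pr (xi k) B = P B) /\
  (forall B : 'I_N -> set Xi, (forall k, measurable (B k)) ->
     Pr (\bigcap_(k in [set: 'I_N]) (xi k @^-1` B k)) =
     (\prod_(k < N) Pr (xi k @^-1` B k))%E).

Definition emp_mean (h : Xi -> R) (w : Omega) : R :=
  N%:R^-1 * \sum_(k < N) h (xi k w).

Definition good (rho s2 : R) (h : Xi -> R) : Prop :=
  [/\ forall z, 0 <= h z,
      measurable_fun setT h,
      (\int[P]_z (h z)%:E <= s2%:E)%E
    & (Pr [set w | (2 * s2 < emp_mean h w)%R] <= rho%:E)%E].

Definition great (p kappa s2 : R) (h : Xi -> R) : Prop :=
  [/\ forall z, 0 <= h z,
      measurable_fun setT h,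
      (\int[P]_z (h z)%:E <= s2%:E)%E
    & (Lnorm P p%:E (EFin \o (fun z => h z - \int[P]_u h u)%R)
         <= (kappa * s2)%:E)%E].

End sampling.

(* The constraints are indexed by I, and the index set with the objective
   adjoined is option I: None is the objective, Some i the i-th constraint.
   F is total, but only its values on Y matter. *)
Section problem.
Context {R : realType} {d : nat} {dX dO : measure_display} {I : finType}.
Context {Xi : measurableType dX} {Omega : measurableType dO}.
Variables (nrm : 'rV[R]_d -> R).
Variables (P : probability Xi R) (Pr : probability Omega R).
Variables (N : nat) (xi : 'I_N -> {RV Pr >-> Xi}).
Variables (Y : set 'rV[R]_d) (F : option I -> 'rV[R]_d -> Xi -> R).

Record caratheodory_integrable : Prop := CaratheodoryIntegrable {
  cara_measurable : forall i x, Y x -> measurable_fun setT (F i x);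
  cara_continuous : forall i z, {within Y, continuous (F i ^~ z)};
  cara_integrable : forall i x, Y x -> P.-integrable setT (EFin \o F i x)
}.

Definition fmean (i : option I) (x : 'rV[R]_d) : R := \int[P]_z F i x z.

Definition feasible (delta : R) : set 'rV[R]_d :=
  [set x | Y x /\ forall i : I, fmean (Some i) x <= delta].

Definition fopt (delta : R) : R := inf [set fmean None x | x in feasible delta].

Definition gap (delta : R) : R := `|fopt delta - fopt 0|.

Definition minimizer (x : 'rV[R]_d) : Prop :=
  feasible 0 x /\ forall y, feasible 0 y -> fmean None x <= fmean None y.

Definition near_opt (delta theta : R) : set 'rV[R]_d :=
  [set x | feasible delta x /\ fmean None x <= fopt 0 + theta].

Definition Fhat (i : option I) (x : 'rV[R]_d) (w : Omega) : R :=
  emp_mean xi (F i x) w.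

Definition saa_feasible (w : Omega) : set 'rV[R]_d :=
  [set x | Y x /\ forall i : I, Fhat (Some i) x w <= 0].

Definition saa_opt (w : Omega) : R :=
  inf [set Fhat None x w | x in saa_feasible w].

Definition saa_solvable (w : Omega) : Prop :=
  exists2 x, saa_feasible w x
    & forall y, saa_feasible w y -> Fhat None x w <= Fhat None y w.

Definition saa_near_opt (theta : R) (w : Omega) : set 'rV[R]_d :=
  [set x | saa_feasible w x /\ Fhat None x w <= saa_opt w + theta].

Record LSCQ (eta_s theta_s : R) : Prop := MkLSCQ {
  lscq_convex_dom : @convex_set R 'rV[R]_d Y;
  lscq_closed_dom : closed Y;
  lscq_continuous : forall i, {within Y, continuous (fmean i)};
  lscq_convex : forall i, @convex_function R 'rV[R]_d Y (fmean i);
  lscq_eta_gt0 : 0 < eta_s;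
  lscq_bounded : bounded_set (near_opt 0 theta_s);
  lscq_slater : near_opt (- eta_s) theta_s !=set0
}.

(* Common shape of goodness and greatness over Z: the condition [ok s2 h] on
   single functions h is [good] or [great]. *)
Record regular_over (ok : R -> (Xi -> R) -> Prop) (xstar : 'rV[R]_d)
    (sigma_s2 s2 alpha : R) (Z : set 'rV[R]_d) : Prop := RegularOver {
  reg_sigma_s2_gt0 : 0 < sigma_s2;
  reg_s2_gt0 : 0 < s2;
  reg_alpha : 0 < alpha <= 1;
  reg_fmean_continuous : forall i, {within Y, continuous (fmean i)};
  reg_F_continuous : forall i z, {within Y, continuous (F i ^~ z)};
  reg_variance : forall i,
    ok sigma_s2 (fun z => (F i xstar z - fmean i xstar) ^+ 2);
  reg_hoelder : forall i, exists2 L : Xi -> R,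
    ok s2 (fun z => L z ^+ 2)
    & forall x x' z, Z x -> Z x' ->
        `|F i x z - F i x' z| <= L z * powR (nrm (x - x')) alpha
}.

Definition goodness_over xstar sigma_s2 s2 alpha rho Z : Prop :=
  0 < rho /\ regular_over (good P xi rho) xstar sigma_s2 s2 alpha Z.

Definition greatness_over xstar sigma_s2 s2 alpha p kappa Z : Prop :=
  [/\ 2 <= p, 1 <= kappa &
      regular_over (great P p kappa) xstar sigma_s2 s2 alpha Z].

(* sig2 (theta, delta) is the Hoelder-modulus parameter over
   near_opt delta theta. *)
Variables (sigma_s2 alpha : R) (sig2 : R * R -> R).
Variables (eta_s theta_s t eps0 : R).

Definition log_factor : R := 1 + ln (2 * #|I| + 2)%:R + t.

Definition base_error : R :=
  Num.sqrt sigma_s2 * Num.sqrt (6 * log_factor / N%:R).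

(* gamma2 is finite on the nonempty bounded subsets of R^d to which it is
   applied here. *)
Definition what (delta eps : R) : R :=
  let theta := eps + gap (- delta) in
  let M := near_opt 0 theta in
  Num.sqrt (sig2 (theta, delta)) *
  (4 * Num.sqrt 3 * (fine (gamma2 (ndist nrm) alpha M) / Num.sqrt N%:R)
   + 6 * Num.sqrt 3 *
     (powR (diam nrm M) alpha * Num.sqrt log_factor / Num.sqrt N%:R)).

Definition S_set (eps : R) : set R :=
  [set delta | [/\ 0 < delta < eta_s,
                   eps + gap (- delta) <= theta_s
                 & what delta eps + base_error < delta]].

Definition check_delta (eps : R) : R :=
  if #|I| == 0%N then 0 else inf (S_set eps).

(* the values of eps for which check_delta eps is meaningful *)
Definition check_dom : set R :=
  [set eps | 0 < eps <= theta_s /\ (#|I| = 0%N \/ S_set eps !=set0)].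

Definition check_w (eps : R) : R := what (check_delta eps) eps.

Definition R_set : set R :=
  [set eps | [/\ eps0 < eps <= theta_s, check_dom eps
               & eps0 + gap (- check_delta eps) + 2 * check_w eps < eps]].

Definition check_r : R := inf R_set.

(* eps decreases to check_r within the domain of check_delta *)
Definition check_r_filter : set_system R :=
  within check_dom (at_right check_r).

Definition check_delta_lim : R := lim (check_delta @ check_r_filter).

Definition good_event : set Omega :=
  [set w |
   [/\ saa_near_opt eps0 w `<=` near_opt check_delta_lim check_r,
       `|saa_opt w - fopt 0| <=
         base_error + check_r / 2 + Num.max check_r (gap check_delta_lim)
     & forall x, saa_near_opt eps0 w x ->
         dist_to nrm x (feasible 0) <=
         Num.min (diam nrm (near_opt 0 theta_s) * check_delta_lim / eta_s)
                 (2 * diam nrm (near_opt 0 check_r))]].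

End problem.

(* Main.v *)
(* If a function U with |U| <= a L satisfies E L^2 <= s2, then the inequality
   exp (x - x^2/2) <= 1 + x + x^2/2 gives sub-Gaussian tails for the empirical
   mean of U on the event where the empirical mean of L^2 is at most 2 s2.
   Goodness therefore allows generic chaining over T = near_opt delta eps: the
   empirical increments from x* are at most the width [what delta eps] there,
   up to an arbitrarily small error, and the errors at x* are at most
   [base_error], off an event of probability e^-t + 2(|I|+1)rho.

   Off that event, let y minimize f over feasible (- delta).  The inequalities
   defining S_set and R_set make y feasible for the SAA problem and, by
   convexity along segments issued from y, confine the eps0-optimal SAA
   solutions to T.  This holds for delta and eps slightly away from check_delta
   and check_r: check_r is not attained, so some eps in R_set decrease to it,
   and since the width depends on delta only through the continuous sig2 and
   gap and through quantities monotone in the level, some delta near check_delta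
   satisfies the strict inequalities.  The good event contains the limsup of the
   corresponding events, whose probability is at least that of each of them.

   Greatness implies goodness by truncation (Fuk and Nagaev). *)

(* The probabilistic part yields one measurable event, a countable union of two-point deviations,
   outside which all increments over T are controlled at once; localization is then deterministic,
   sample by sample. Each function pays rho twice, once for its variance at the minimizer and once
   for its Hoelder modulus.

   Two obstacles shape the rest. [what] measures an ideal sublevel set, while deviations are needed
   on [near_opt delta eps], which leaves the feasible set; a contraction by one half toward a
   minimizer over [feasible (- delta)] carries the second set into the first. And gamma_2 and the
   diameter are only monotone in the level, so plain continuity says nothing at the infimum of
   [S_set]: the identity width + base error = delta there comes from two one-sided arguments, and it
   is what deprives [R_set] of a least element. Since delta may approach its limit from either side,
   the sets [near_opt delta eps] are not nested, and the last step cannot be a monotone limit of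
   events. *)
Require Import Defs.
From mathcomp Require Import all_boot all_order all_algebra.
From mathcomp Require Import all_classical all_reals all_analysis.
From mathcomp Require Import measurable_realfun ring lra.

Set Implicit Arguments.
Unset Strict Implicit.
Unset Printing Implicit Defensive.

Import Order.TTheory GRing.Theory Num.Theory.
Import numFieldNormedType.Exports.

Local Open Scope classical_set_scope.
Local Open Scope ring_scope.

(** * Concentration of empirical means *)

Section iid.
Context {R : realType} {dX dO : measure_display}.
Context {Xi : measurableType dX} {Omega : measurableType dO}.
Variables (P : probability Xi R) (Pr : probability Omega R).
Local Open Scope ereal_scope.
Import HBNNSimple.

(** The weighted product rule passes from indicators to simple functions by linearity and to
    nonnegative functions by monotone convergence. With [g] the product of the other factors, this
    frees one factor of a product at a time. *)
Lemma integral_weighted_law (X : {RV Pr >-> Xi}) (g : Omega -> R) (c : R) :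
  measurable_fun setT g -> (forall w, 0 <= g w)%R -> (0 <= c)%R ->
  (forall B, measurable B ->
     \int[Pr]_w ((\1_B (X w))%:E * (g w)%:E) = c%:E * P B) ->
  forall f : Xi -> \bar R, measurable_fun setT f -> (forall z, 0 <= f z) ->
  \int[Pr]_w (f (X w) * (g w)%:E) = c%:E * \int[P]_z f z.
Proof.
move=> mg g0 c0 Hind f mf f0.
pose a := nnsfun_approx measurableT mf.
have a0 n z : (0 <= a n z)%R by [].
have mX (h : Xi -> \bar R) : measurable_fun setT h ->
    measurable_fun setT (fun w => h (X w)).
  by move=> mh; apply: (measurableT_comp mh).
have mgE : measurable_fun setT (fun w => (g w)%:E) by exact/measurable_EFinP.
have maE n : measurable_fun setT (fun z => (a n z)%:E) by exact/measurable_EFinP.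
have a_nd z : nondecreasing_seq (fun n => (a n z)%:E).
  by move=> m n mn; rewrite lee_fin; exact/lefP/nd_nnsfun_approx.
have a_lim z : limn (fun n => (a n z)%:E) = f z.
  by apply/cvg_lim => //; exact: cvg_nnsfun_approx.
have a_cvg z : cvgn (fun n => (a n z)%:E).
  exact: ereal_nondecreasing_is_cvgn (a_nd z).
have step n : \int[Pr]_w ((a n (X w))%:E * (g w)%:E) = c%:E * \int[P]_z (a n z)%:E.
  have aE z : (a n z)%:E =
      \sum_(r \in range (a n)) (r%:E * (\1_(a n @^-1` [set r]) z)%:E).
    rewrite [a n z in LHS]fimfunE -fsumEFin//.
  have r0 r : r \in range (a n) -> (0 <= r)%R.
    by rewrite inE => -[z _ <-].
  have i0 r z : 0 <= r%:E * (\1_(a n @^-1` [set r]) z)%:E :> \bar R.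
    have [/mem_set rR|rR] := pselect (range (a n) r).
      by rewrite mule_ge0// lee_fin ?r0// indicE.
    by rewrite preimage10// indicE in_set0 mule0.
  have mI r : measurable_fun setT (fun z : Xi => (\1_(a n @^-1` [set r]) z)%:E : \bar R).
    by apply/measurable_EFinP; exact: measurable_indic.
  transitivity (\sum_(r \in range (a n))
     \int[Pr]_w (r%:E * ((\1_(a n @^-1` [set r]) (X w))%:E * (g w)%:E))).
    rewrite -ge0_integral_fsum//.
    - apply: eq_integral => w _; rewrite aE ge0_mule_fsuml//.
      by apply: eq_fsbigr => r _; rewrite muleA.
    - move=> r; apply: measurable_funeM; apply: emeasurable_funM => //.
      exact: (mX _ (mI r)).
    - by move=> r w _; rewrite muleA; apply: mule_ge0 => //; rewrite lee_fin.
  transitivity (\sum_(r \in range (a n)) (c%:E * (r%:E * P (a n @^-1` [set r])))).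
    apply: eq_fsbigr => r rR; rewrite ge0_integralZl ?lee_fin ?r0//.
    - by rewrite Hind// muleCA.
    - by apply: emeasurable_funM => //; exact: (mX (fun z => (\1_(a n @^-1` [set r]) z)%:E)).
    - by move=> w _; apply: mule_ge0; rewrite lee_fin ?indicE.
  rewrite -ge0_mule_fsumr; last first.
    move=> r; have [/mem_set rR|rR] := pselect (range (a n) r).
      by rewrite mule_ge0 ?lee_fin ?r0.
    by rewrite preimage10// measure0 mule0.
  congr (_ * _).
  transitivity (\int[P]_z \sum_(r \in range (a n)) (r%:E * (\1_(a n @^-1` [set r]) z)%:E)); last first.
    by apply: eq_integral => z _; rewrite aE.
  rewrite ge0_integral_fsum//; last by move=> r; exact: measurable_funeM.
  apply: eq_fsbigr => r rR; rewrite ge0_integralZl ?lee_fin ?r0//.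
  by rewrite integral_indic// setIT.
have -> : \int[P]_z f z = limn (fun n => \int[P]_z (a n z)%:E).
  rewrite -monotone_convergence//.
  - by apply: eq_integral => z _; rewrite a_lim.
  - by move=> n z _; rewrite lee_fin.
transitivity (limn (fun n => \int[Pr]_w ((a n (X w))%:E * (g w)%:E))).
  rewrite -monotone_convergence//.
  - apply: eq_integral => w _.
    by rewrite -[in LHS](a_lim (X w)) -limeMr.
  - by move=> n; apply: emeasurable_funM => //; apply: (measurableT_comp (maE n)).
  - by move=> n w _; apply: mule_ge0; rewrite lee_fin.
  - by move=> w _ m n mn; apply: lee_wpmul2r; rewrite ?lee_fin//; exact/lefP/nd_nnsfun_approx.
under eq_fun do rewrite step.
rewrite limeMl//; apply: ereal_nondecreasing_is_cvgn => m n mn.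
apply: ge0_le_integral => // z _; rewrite ?lee_fin//.
exact/lefP/nd_nnsfun_approx.
Qed.

(** Independence is given on rectangles, that is for indicators. Induction on the number [m] of
    leading coordinates whose factor is arbitrary; [integral_weighted_law] frees the next one. *)
Lemma iid_integral_prod (N : nat) (xi : 'I_N -> {RV Pr >-> Xi}) (f : 'I_N -> Xi -> R) :
  iid_with_law P xi ->
  (forall k, measurable_fun setT (f k)) -> (forall k z, (0 <= f k z)%R) ->
  (forall k, \int[P]_z (f k z)%:E < +oo) ->
  \int[Pr]_w (\prod_(k < N) f k (xi k w))%:E = \prod_(k < N) \int[P]_z (f k z)%:E.
Proof.
move=> [hlaw hind] mf f0 fy.
pose good_f (f : 'I_N -> Xi -> R) := [/\ forall k, measurable_fun setT (f k),
  forall k z, (0 <= f k z)%R & forall k, \int[P]_z (f k z)%:E < +oo].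
suff H m : forall f, good_f f ->
    (forall k : 'I_N, (m <= k)%N -> exists2 B, measurable B & f k = \1_B) ->
    \int[Pr]_w (\prod_(k < N) f k (xi k w))%:E = \prod_(k < N) \int[P]_z (f k z)%:E.
  by apply: (H N) => // k; rewrite leqNgt ltn_ord.
elim: m => [|m IH] {mf f0 fy}f [mf f0 fy] fB.
  have /choice[B hB] : forall k : 'I_N, exists B : set Xi, measurable B /\ f k = \1_B.
    by move=> k; have [B] := fB k (leq0n k); exists B.
  have mB k : measurable (B k) by have [] := hB k.
  transitivity (Pr (\bigcap_(k in [set: 'I_N]) (xi k @^-1` B k))).
    rewrite -[in RHS](setIT (\bigcap_(_ in _) _)) -integral_indic//; last first.
      apply: fin_bigcap_measurable; first exact: finite_finset.
      by move=> k _; exact: measurable_funPTI.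
    apply: eq_integral => w _; congr EFin.
    under eq_bigr => k _ do rewrite (hB k).2.
    have [h|h] := pselect (forall k, B k (xi k w)).
      rewrite big1; last by move=> k _; rewrite indicE mem_set.
      by rewrite indicE mem_set//= => k _; exact: h.
    have [k hk] : exists k, ~ B k (xi k w) by exact/existsNP.
    rewrite (bigD1 k)//= [\1_(B k) _]indicE memNset// mul0r.
    by rewrite indicE memNset//= => /(_ k Logic.I).
  rewrite hind//; apply: eq_bigr => k _.
  rewrite (hB k).2 integral_indic// setIT.
  exact: (hlaw k _ (mB k)).
have [mN|Nm] := ltnP m N; last first.
  by apply: IH => // k mk; have := leq_trans Nm mk; rewrite leqNgt ltn_ord.
pose k0 := Ordinal mN.
pose g w := (\prod_(k < N | k != k0) f k (xi k w))%R.
pose c := (\prod_(k < N | k != k0) fine (\int[P]_z (f k z)%:E))%R.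
have If0 k : 0 <= \int[P]_z (f k z)%:E by apply: integral_ge0 => z _; rewrite lee_fin.
have g0 w : (0 <= g w)%R by apply: prodr_ge0.
have c0 : (0 <= c)%R by apply: prodr_ge0 => k _; rewrite fine_ge0.
have mfx k : measurable_fun setT (fun w => f k (xi k w)).
  by apply: (measurableT_comp (mf k)).
have mg : measurable_fun setT g.
  rewrite /g; under eq_fun do rewrite -big_filter.
  by apply: measurable_prod => k _; exact: mfx.
have cE : \prod_(k < N | k != k0) (\int[P]_z (f k z)%:E) = c%:E.
  rewrite /c; elim/big_rec2 : _ => // k y1 y2 _ ->.
  by rewrite EFinM fineK// ge0_fin_numE.
rewrite [RHS](bigD1 k0)//= cE muleC.
have := @integral_weighted_law (xi k0) g c mg g0 c0.
move=> /(_ _ (fun z => (f k0 z)%:E)) <-//.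
- apply: eq_integral => w _.
  by rewrite (bigD1 k0)//= EFinM.
- move=> B mB.
  pose F k := if k == k0 then \1_B else f k.
  have FE : \prod_(k < N) \int[P]_z (F k z)%:E = c%:E * P B.
    rewrite (bigD1 k0)//= muleC -cE /F eqxx integral_indic// setIT.
    by congr (_ * _); apply: eq_bigr => k /negbTE ->.
  rewrite -FE -IH.
  + apply: eq_integral => w _; rewrite (bigD1 k0)//= /F eqxx EFinM; congr (_ * (_)%:E).
    by apply: eq_bigr => k /negbTE ->.
  + split=> [k|k z|k]; rewrite /F; case: ifPn => _ //.
    by rewrite integral_indic// setIT (le_lt_trans (probability_le1 P mB))// ltry.
  + move=> k mk; rewrite /F; case: eqP => [_|kk0]; first by exists B.
    apply: fB; rewrite ltn_neqAle mk andbT; apply/eqP => mk'; apply: kk0.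
    exact/val_inj.
- exact/measurable_EFinP.
- by move=> z; rewrite lee_fin.
Qed.

End iid.

Section measurable_comparison.
Context {R : realType} {dO : measure_display} {Omega : measurableType dO}.
Implicit Types f g : Omega -> R.

Lemma measurable_le_set f g : measurable_fun setT f -> measurable_fun setT g ->
  measurable [set w | f w <= g w].
Proof.
by move=> mf mg; rewrite -[X in measurable X]setTI; exact: measurable_fun_le.
Qed.

Lemma measurable_lt_set f g : measurable_fun setT f -> measurable_fun setT g ->
  measurable [set w | f w < g w].
Proof.
move=> mf mg; rewrite (_ : [set _ | _] = ~` [set w | g w <= f w]).
  by apply: measurableC; exact: measurable_le_set.
by apply/seteqP; split=> w /=; rewrite ltNge => /negP.
Qed.

End measurable_comparison.

Section union_bound.
Context {R : realType} {dO : measure_display} {Omega : measurableType dO}.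
Variable Pr : probability Omega R.

(** Measurability travels with the bound, since subadditivity of [Pr] asks for it at every union. *)
Definition pr_le (A : set Omega) (b : R) := measurable A /\ (Pr A <= b%:E)%E.

Lemma pr_leW A b b' : b <= b' -> pr_le A b -> pr_le A b'.
Proof. by move=> bb' [mA Ab]; split=> //; apply: le_trans Ab _; rewrite lee_fin. Qed.

Lemma pr_leU A B a b : pr_le A a -> pr_le B b -> pr_le (A `|` B) (a + b).
Proof.
move=> [mA Aa] [mB Bb]; split; first exact: measurableU.
by rewrite EFinD; apply: le_trans (measureU2 _ _ _) (leeD Aa Bb).
Qed.

Lemma pr_le_sum (I : eqType) (s : seq I) (A : I -> set Omega) (b : I -> R) :
  (forall i, i \in s -> pr_le (A i) (b i)) ->
  pr_le [set w | exists2 i, i \in s & A i w] (\sum_(i <- s) b i).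
Proof.
elim: s => [|i s IH] h.
  rewrite big_nil (_ : [set _ | _] = set0).
    by split; rewrite ?measure0.
  by apply/seteqP; split=> // w [].
rewrite big_cons (_ : [set _ | _] = A i `|` [set w | exists2 i, i \in s & A i w]).
  apply: pr_leU; first by apply: h; rewrite mem_head.
  by apply: IH => j js; apply: h; rewrite inE js orbT.
apply/seteqP; split=> w /=.
  by move=> [j]; rewrite inE => /orP[/eqP->|js] Aj; [left|right; exists j].
by move=> [Ai|[j js Aj]]; [exists i; rewrite ?mem_head|exists j; rewrite // inE js orbT].
Qed.

Lemma pr_le_fin (I : finType) (A : I -> set Omega) (b : I -> R) :
  (forall i, pr_le (A i) (b i)) ->
  pr_le [set w | exists i, A i w] (\sum_i b i).
Proof.
move=> h; rewrite -big_enum/= (_ : [set _ | _] = [set w | exists2 i, i \in enum I & A i w]).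
  exact: pr_le_sum.
by apply/seteqP; split=> w [i]; exists i => //; rewrite mem_enum.
Qed.

Lemma pr_le_series (A : nat -> set Omega) (b : nat -> R) (B : R) :
  (forall k, pr_le (A k) (b k)) -> (forall n, \sum_(0 <= k < n) b k <= B) ->
  pr_le [set w | exists k, A k w] B.
Proof.
move=> h bB.
pose E n := [set w | exists2 k, k \in index_iota 0 n & A k w].
have hE n : pr_le (E n) B.
  by apply: (pr_leW (bB n)); exact: pr_le_sum.
have UE : [set w | exists k, A k w] = \bigcup_n E n.
  apply/seteqP; split=> [w [k Ak]|w [n _ [k _ Ak]]]; last by exists k.
  by exists k.+1 => //; exists k; rewrite // mem_index_iota leq0n ltnSn.
rewrite UE; have mU : measurable (\bigcup_n E n).
  by apply: bigcup_measurable => n _; exact: (hE n).1.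
split=> //.
have cv : Pr (E n) @[n --> \oo] --> Pr (\bigcup_n E n).
  apply: nondecreasing_cvg_mu => //; first by move=> n; exact: (hE n).1.
  move=> m n mn; apply/subsetPset => w [k km Ak]; exists k => //.
  by move: km; rewrite !mem_index_iota => /andP[-> /leq_trans]; apply.
rewrite -(cvg_lim _ cv)//; apply: lime_le; first by apply/cvg_ex; eexists; exact: cv.
by apply: nearW => n; exact: (hE n).2.
Qed.

End union_bound.

Section chernoff.
Context {R : realType} {dX dO : measure_display}.
Context {Xi : measurableType dX} {Omega : measurableType dO}.
Variables (P : probability Xi R) (Pr : probability Omega R).
Variables (N : nat) (xi : 'I_N -> {RV Pr >-> Xi}).
Hypothesis iid : iid_with_law P xi.

Lemma measurable_emp_mean (h : Xi -> R) :
  measurable_fun setT h -> measurable_fun setT (emp_mean xi h).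
Proof.
move=> mh; apply: measurable_funM => //.
apply: measurable_sum => k; apply: (measurableT_comp mh).
exact: measurable_funPT.
Qed.

(** Markov's inequality for the product of the [phi (xi k)]. Only a lower bound of this product on
    [A] is asked, so [A] may contain a side condition on the sample, such as a bound on an empirical
    second moment. *)
Lemma iid_chernoff (phi : Xi -> R) (a m : R) (A : set Omega) :
  measurable_fun setT phi -> (forall z, 0 <= phi z) ->
  (\int[P]_z (phi z)%:E <= m%:E)%E ->
  measurable A -> 0 <= a ->
  (forall w, A w -> a <= \prod_(k < N) phi (xi k w)) ->
  (a%:E * Pr A <= (m ^+ N)%:E)%E.
Proof.
move=> mphi phi0 phim mA a0 hA.
have phiy : (\int[P]_z (phi z)%:E < +oo)%E by rewrite (le_lt_trans phim) ?ltry.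
have i0 : (0 <= \int[P]_z (phi z)%:E)%E.
  by apply: integral_ge0 => z _; rewrite lee_fin.
have mW : measurable_fun setT (fun w => \prod_(k < N) phi (xi k w)).
  apply: measurable_prod => k _; apply: (measurableT_comp mphi).
  exact: measurable_funPT.
apply: (@le_trans _ _ (\int[Pr]_w (\prod_(k < N) phi (xi k w))%:E)%E); last first.
  rewrite (@iid_integral_prod _ _ _ _ _ P Pr N xi (fun=> phi))//.
  have -> : (\int[P]_z (phi z)%:E = (fine (\int[P]_z (phi z)%:E))%:E)%E.
    by rewrite fineK// ge0_fin_numE.
  rewrite -(big_morph EFin (@EFinM R) (erefl _)) prodr_const card_ord lee_fin.
  apply: lerXn2r; rewrite ?nnegrE ?fine_ge0//.
    by rewrite -lee_fin; apply: le_trans phim.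
  by rewrite -lee_fin fineK// ge0_fin_numE.
rewrite -[X in (X * _)%E]/(a%:E) -[A in Pr A]setIT -integral_indic//.
rewrite -ge0_integralZl ?lee_fin//; last exact/measurable_EFinP/measurable_indic.
apply: ge0_le_integral => //.
- by move=> w _; rewrite -EFinM lee_fin mulr_ge0.
- exact/measurable_funeM/measurable_EFinP/measurable_indic.
- exact/measurable_EFinP.
- move=> w _; rewrite -EFinM lee_fin indicE.
  have [wA|wA] := pselect (A w); first by rewrite mem_set// mulr1 hA.
  by rewrite memNset// mulr0 prodr_ge0.
Qed.

End chernoff.

Section real_inequalities.
Context {R : realType}.
Implicit Types x : R.

Lemma expR_sub_sqr_le x : expR (x - x ^+ 2 / 2) <= 1 + x + x ^+ 2 / 2.
Proof.
(* exp (x^2/2 - x) >= 1 - x + x^2/2, and (1 + x^2/2)^2 - x^2 >= 1 *)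
have h : 1 - x + x ^+ 2 / 2 <= expR (- (x - x ^+ 2 / 2)).
  by apply: le_trans (expR_ge1Dx _); lra.
have p1 : 0 < 1 + x + x ^+ 2 / 2 by nra.
have e0 := expR_gt0 (x - x ^+ 2 / 2).
have h1 : (1 - x + x ^+ 2 / 2) * expR (x - x ^+ 2 / 2) <= 1.
  rewrite -[leRHS](expRxMexpNx_1 (x - x ^+ 2 / 2)) [leRHS]mulrC.
  by rewrite ler_wpM2r// ltW.
have h2 : 1 <= (1 + x + x ^+ 2 / 2) * (1 - x + x ^+ 2 / 2).
  have -> : (1 + x + x ^+ 2 / 2) * (1 - x + x ^+ 2 / 2) = 1 + (x ^+ 2) ^+ 2 / 4.
    by field.
  by rewrite lerDl divr_ge0// sqr_ge0.
rewrite -[leLHS]mul1r; apply: (@le_trans _ _ ((1 + x + x ^+ 2 / 2) * (1 - x + x ^+ 2 / 2) * expR (x - x ^+ 2 / 2))).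
  by rewrite ler_wpM2r// ltW.
by rewrite -mulrA -[leRHS]mulr1 ler_wpM2l// ltW.
Qed.

(** Meant for variables truncated from above only, so x has no lower bound. For x <= 0, exp x <= 1 /
    (1 - x) <= 1 + x + x^2; for 0 < x < 1, exp x <= 1 + x exp x is used twice; for x >= 1 the
    quadratic term suffices. *)
Lemma expR_le_quadratic x v : x <= v -> 0 <= v ->
  expR x <= 1 + x + x ^+ 2 * expR v.
Proof.
move=> xv v0; have [x0|x0] := leP x 0.
  have h : 1 - x <= expR (- x) by have := expR_ge1Dx (- x); lra.
  have h1 : (1 - x) * expR x <= 1.
    by rewrite -[leRHS](expRxMexpNx_1 x) [leRHS]mulrC ler_wpM2r// expR_ge0.
  have h2 : expR x <= 1 + x + x ^+ 2 by have := expR_ge0 x; nra.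
  apply: le_trans h2 _; rewrite lerD2l -[leLHS]mulr1 ler_wpM2l ?sqr_ge0//.
  by rewrite -expR0 ler_expR.
have ev : expR x <= expR v by rewrite ler_expR.
apply: (@le_trans _ _ (1 + x + x ^+ 2 * expR x)); last first.
  by rewrite lerD2l ler_wpM2l ?sqr_ge0.
have e0 := expR_gt0 x.
have [x1|x1] := leP 1 x.
  have : expR x <= x ^+ 2 * expR x by rewrite ler_peMl ?expR_ge0//; nra.
  lra.
have h1 : (1 - x) * expR x <= 1.
  rewrite -[leRHS](expRxMexpNx_1 x) [leRHS]mulrC ler_wpM2r ?expR_ge0//.
  by have := expR_ge1Dx (- x); lra.
nra.
Qed.

End real_inequalities.

Section tails.
Context {R : realType} {dX dO : measure_display}.
Context {Xi : measurableType dX} {Omega : measurableType dO}.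
Variables (P : probability Xi R) (Pr : probability Omega R).
Variables (N : nat) (xi : 'I_N -> {RV Pr >-> Xi}).
Hypothesis iid : iid_with_law P xi.
Hypothesis N_gt0 : (0 < N)%N.

Lemma emp_meanZ c (h : Xi -> R) w :
  emp_mean xi (fun z => c * h z) w = c * emp_mean xi h w.
Proof. by rewrite /emp_mean -mulr_sumr mulrCA. Qed.

Lemma emp_meanD (h1 h2 : Xi -> R) w :
  emp_mean xi (fun z => h1 z + h2 z) w = emp_mean xi h1 w + emp_mean xi h2 w.
Proof. by rewrite /emp_mean big_split/= mulrDr. Qed.

Lemma emp_mean_cst c w : emp_mean xi (fun=> c) w = c.
Proof.
rewrite /emp_mean sumr_const card_ord -[c *+ N]mulr_natl mulrA mulVf ?mul1r//.
by rewrite pnatr_eq0 -lt0n.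
Qed.

Lemma le_emp_mean (h1 h2 : Xi -> R) w : (forall z, h1 z <= h2 z) ->
  emp_mean xi h1 w <= emp_mean xi h2 w.
Proof.
by move=> h; rewrite /emp_mean ler_wpM2l ?invr_ge0// ler_sum.
Qed.

Lemma natr_emp_mean (h : Xi -> R) w :
  N%:R * emp_mean xi h w = \sum_(k < N) h (xi k w).
Proof. by rewrite /emp_mean mulrA divff ?mul1r// pnatr_eq0 -lt0n. Qed.

Lemma EFin_Rintegral (h : Xi -> R) : P.-integrable setT (EFin \o h) ->
  (\int[P]_z (h z)%:E)%E = (\int[P]_z h z)%:E.
Proof. by move=> ih; rewrite /Rintegral fineK//; exact: integrable_fin_num. Qed.

Lemma Rintegral_prob_cst (c : R) : \int[P]_(z in setT) c = c.
Proof.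
rewrite Rintegral_cst// -[RHS]mulr1; congr (_ * _).
exact: (congr1 fine (probability_setT P)).
Qed.

Lemma integrable_ge0 (h : Xi -> R) (c : R) : measurable_fun setT h ->
  (forall z, 0 <= h z) -> (\int[P]_z (h z)%:E <= c%:E)%E ->
  P.-integrable setT (EFin \o h).
Proof.
move=> mh h0 hc; apply/integrableP; split; first exact/measurable_EFinP.
apply: (@le_lt_trans _ _ c%:E); last exact: ltry.
apply: le_trans hc; under eq_integral do rewrite /= ger0_norm//.
by [].
Qed.

(** Exponential tilting by l U - (l U)^2 / 2, whose exponential has a mean controlled by the second
    moment of U. The quadratic term costs l^2 s2 on the event, and the bound on the mean another l^2
    s2 / 2, so each sample gains l r - 3/2 l^2 s2; this is maximal at l = r / (3 s2), with value r^2
    / (6 s2), whence the 6. *)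
Lemma self_normalized_tail (U : Xi -> R) (s2 u : R) :
  measurable_fun setT U -> P.-integrable setT (EFin \o U) ->
  (\int[P]_z (U z ^+ 2)%:E <= s2%:E)%E -> 0 < s2 -> 0 <= u ->
  (Pr [set w | (emp_mean xi (fun z => U z ^+ 2) w <= 2 * s2)%R /\
        (Num.sqrt (6 * s2 * u / N%:R) < emp_mean xi U w - \int[P]_z U z)%R]
    <= (expR (- u))%:E)%E.
Proof.
move=> mU iU U2 s20 u0.
have N0 : 0 < N%:R :> R by rewrite ltr0n.
set r := Num.sqrt _; set EU := (\int[P]_z U z)%R.
have r0 : 0 <= r by exact: sqrtr_ge0.
have r2 : r ^+ 2 = 6 * s2 * u / N%:R.
  have s20' := ltW s20; have N0' := ltW N0.
  by rewrite sqr_sqrtr// divr_ge0// !mulr_ge0.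
pose l := r / (3 * s2).
have l0 : 0 <= l by rewrite divr_ge0// mulr_ge0// ltW.
pose phi z := expR (l * U z - (l * U z) ^+ 2 / 2).
have mU2 : measurable_fun setT (fun z => U z ^+ 2) by exact: measurable_funX.
have mlU : measurable_fun setT (fun z => l * U z) by exact: measurable_funM.
have mphi : measurable_fun setT phi.
  apply: measurableT_comp => //; apply: measurable_funB => //.
  by apply: measurable_funM => //; exact: measurable_funX.
have iU2 : P.-integrable setT (EFin \o (fun z => U z ^+ 2)).
  by apply: integrable_ge0 U2 => // z; exact: sqr_ge0.
have iq : P.-integrable setT (EFin \o (fun z => l ^+ 2 / 2 * U z ^+ 2)).
  exact: (integrableZl measurableT (l ^+ 2 / 2) iU2).
have il : P.-integrable setT (EFin \o (fun z => l * U z)).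
  exact: (integrableZl measurableT l iU).
have i1 : P.-integrable setT (EFin \o (fun z : Xi => 1 : R)).
  exact: finite_measure_integrable_cst.
have i1l : P.-integrable setT (EFin \o (fun z => 1 + l * U z)).
  exact: (integrableD measurableT i1 il).
have itot : P.-integrable setT (EFin \o (fun z => 1 + l * U z + l ^+ 2 / 2 * U z ^+ 2)).
  exact: (integrableD measurableT i1l iq).
pose m := expR (l * EU + l ^+ 2 * s2 / 2).
pose A := [set w | emp_mean xi (fun z => U z ^+ 2) w <= 2 * s2 /\ r < emp_mean xi U w - EU].
pose a := expR (u + N%:R * (l * EU + l ^+ 2 * s2 / 2)).
have mA : measurable A.
  apply: measurableI.
    apply: measurable_le_set => //.
    exact: measurable_emp_mean.
  apply: measurable_lt_set => //.
  by apply: measurable_funB => //; exact: measurable_emp_mean.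
have phim : (\int[P]_z (phi z)%:E <= m%:E)%E.
  apply: (@le_trans _ _ (\int[P]_z (1 + l * U z + l ^+ 2 / 2 * U z ^+ 2)%:E)%E).
    have le z : phi z <= 1 + l * U z + l ^+ 2 / 2 * U z ^+ 2.
      by apply: le_trans (expR_sub_sqr_le _) _; rewrite exprMn; lra.
    apply: ge0_le_integral => //.
    - by move=> z _; rewrite lee_fin expR_ge0.
    - exact/measurable_EFinP.
    - exact: (measurable_int _ itot).
    - by move=> z _; rewrite lee_fin le.
  rewrite EFin_Rintegral// lee_fin.
  rewrite RintegralD// RintegralD// !RintegralZl// Rintegral_prob_cst.
  apply: le_trans (expR_ge1Dx _); rewrite -addrA lerD2l lerD2l.
  rewrite mulrAC ler_pM2r ?invr_gt0// ler_wpM2l ?sqr_ge0//.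
  by rewrite -lee_fin -EFin_Rintegral.
have Aa w : A w -> a <= \prod_(k < N) phi (xi k w).
  move=> [QA rA]; rewrite -expR_sum ler_expR.
  rewrite -(natr_emp_mean (fun z => l * U z - (l * U z) ^+ 2 / 2)).
  have -> : emp_mean xi (fun z => l * U z - (l * U z) ^+ 2 / 2) w =
      l * emp_mean xi U w - l ^+ 2 / 2 * emp_mean xi (fun z => U z ^+ 2) w.
    rewrite -emp_meanZ -mulNr -emp_meanZ -emp_meanD.
    by congr emp_mean; apply/funext => z; rewrite exprMn; lra.
  have e1 : N%:R * (l * r) = 2 * u.
    rewrite /l mulrAC -expr2 r2; field; rewrite !gt_eqF//.
  have e2 : N%:R * (l ^+ 2 * s2 * 3) = 2 * u.
    rewrite -e1 /l; field; rewrite !gt_eqF//.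
  have h : l * (EU + r) - l ^+ 2 * s2 <= l * emp_mean xi U w - l ^+ 2 / 2 * emp_mean xi (fun z => U z ^+ 2) w.
    have h1 : l * (EU + r) <= l * emp_mean xi U w by rewrite ler_wpM2l//; lra.
    have h2 : l ^+ 2 / 2 * emp_mean xi (fun z => U z ^+ 2) w <= l ^+ 2 / 2 * (2 * s2).
      by rewrite ler_wpM2l// divr_ge0// sqr_ge0.
    lra.
  have := ler_wpM2l (ltW N0) h; apply: le_trans.
  lra.
have := iid_chernoff iid mphi (fun z => expR_ge0 _) phim mA (expR_ge0 _) Aa.
rewrite /m -expRM_natl -/A.
rewrite -(fineK (fin_num_measure Pr _ mA)) -EFinM !lee_fin => h.
rewrite -(@ler_pM2l _ a) ?expR_gt0//; apply: le_trans h _.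
by rewrite /a -expRD ler_expR addrAC subrr add0r.
Qed.

(** The side condition bears on [L] and not on [U]: one bound on the empirical mean of L^2 then
    serves all increments met in chaining. [self_normalized_tail] is applied to both signs of [U]
    with second moment a^2 s2, which must be positive; hence the separate case a = 0. *)
Lemma empirical_tail (U L : Xi -> R) (a s2 u : R) :
  measurable_fun setT U -> P.-integrable setT (EFin \o U) ->
  measurable_fun setT (fun z => L z ^+ 2) ->
  (\int[P]_z (L z ^+ 2)%:E <= s2%:E)%E -> 0 < s2 -> 0 <= u -> 0 <= a ->
  (forall z, `|U z| <= `|L z| * a) ->
  (Pr [set w | (emp_mean xi (fun z => L z ^+ 2) w <= 2 * s2)%R /\
        (Num.sqrt s2 * a * Num.sqrt (6 * u / N%:R) <
           `|emp_mean xi U w - \int[P]_z U z|)%R]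
    <= (2 * expR (- u))%:E)%E.
Proof.
move=> mU iU mL iL s20 u0 a0 UL.
have N0 : 0 < N%:R :> R by rewrite ltr0n.
have [a00|a1] := eqVneq a 0.
  rewrite [X in Pr X](_ : _ = set0) ?measure0 ?lee_fin ?mulr_ge0 ?expR_ge0//.
  apply/seteqP; split=> // w /= [_].
  have U0 : U = fun=> 0.
    by apply/funext => z; have := UL z; rewrite a00 mulr0 normr_le0 => /eqP.
  by rewrite U0 emp_mean_cst Rintegral_prob_cst subrr normr0 a00 mulr0 mul0r ltxx.
have {}a1 : 0 < a by rewrite lt_neqAle eq_sym a1.
have U2L z : U z ^+ 2 <= a ^+ 2 * L z ^+ 2.
  rewrite -(real_normK (num_real (U z))) -(real_normK (num_real (L z))) -exprMn.
  by apply: lerXn2r; rewrite ?nnegrE ?mulr_ge0// mulrC.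
have mU2 : measurable_fun setT (fun z => U z ^+ 2) by exact: measurable_funX.
have U2s : (\int[P]_z (U z ^+ 2)%:E <= (a ^+ 2 * s2)%:E)%E.
  apply: (@le_trans _ _ (\int[P]_z ((a ^+ 2)%:E * (L z ^+ 2)%:E))%E).
    apply: ge0_le_integral => //.
    - by move=> z _; rewrite lee_fin sqr_ge0.
    - exact/measurable_EFinP.
    - by apply: measurable_funeM; exact/measurable_EFinP.
    - by move=> z _; rewrite -EFinM lee_fin.
  rewrite ge0_integralZl//.
  - by rewrite [leRHS]EFinM; apply: lee_wpmul2l => //; rewrite lee_fin sqr_ge0.
  - exact/measurable_EFinP.
  - by move=> z _; rewrite lee_fin sqr_ge0.
  - by rewrite lee_fin sqr_ge0.
have s20' : 0 < a ^+ 2 * s2 by rewrite mulr_gt0// exprn_gt0.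
have sq : Num.sqrt (6 * (a ^+ 2 * s2) * u / N%:R) = Num.sqrt s2 * a * Num.sqrt (6 * u / N%:R).
  have -> : 6 * (a ^+ 2 * s2) * u / N%:R = s2 * (a ^+ 2 * (6 * u / N%:R)) by ring.
  rewrite sqrtrM ?ltW// sqrtrM ?sqr_ge0// sqrtr_sqr gtr0_norm// mulrA//.
have Um : measurable_fun setT (fun z => - U z) by exact: measurableT_comp.
have iUm : P.-integrable setT (EFin \o (fun z => - U z)).
  exact: (integrableN iU).
have t1 := self_normalized_tail mU iU U2s s20' u0.
have U2s' : (\int[P]_z ((- U z) ^+ 2)%:E <= (a ^+ 2 * s2)%:E)%E.
  by under eq_integral do rewrite sqrrN.
have t2 := self_normalized_tail Um iUm U2s' s20' u0.
rewrite sq in t1; rewrite sq in t2.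
have -> : 2 * expR (- u) = expR (- u) + expR (- u) by lra.
rewrite EFinD; apply: le_trans (leeD t1 t2).
have mset (V : Xi -> R) (c d e : R) : measurable_fun setT V ->
    measurable [set w | emp_mean xi (fun z => V z ^+ 2) w <= c /\ d < emp_mean xi V w - e].
  move=> mV; apply: measurableI.
    apply: measurable_le_set => //.
    by apply: measurable_emp_mean; exact: measurable_funX.
  apply: measurable_lt_set => //.
  by apply: measurable_funB => //; exact: measurable_emp_mean.
apply: le_trans (measureU2 _ _ _); [|exact: mset|exact: mset].
apply: le_measure; rewrite ?inE.
- apply: measurableI.
    apply: measurable_le_set => //.
    exact: measurable_emp_mean.
  apply: measurable_lt_set => //.
  by apply: measurableT_comp => //; apply: measurable_funB => //; exact: measurable_emp_mean.
- by apply: measurableU; exact: mset.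
move=> w /= [wL wU].
have wU2 : emp_mean xi (fun z => U z ^+ 2) w <= 2 * (a ^+ 2 * s2).
  apply: (@le_trans _ _ (emp_mean xi (fun z => a ^+ 2 * L z ^+ 2) w)).
    exact: le_emp_mean.
  by rewrite emp_meanZ (mulrCA 2) ler_wpM2l// sqr_ge0.
move: wU; rewrite ltr_normr => /orP[|] h; [left|right]; split => //.
  by under [X in emp_mean _ X]eq_fun do rewrite sqrrN.
have -> : (\int[P]_z (- U z) = - \int[P]_z U z)%R.
  have := RintegralZl (-1) measurableT iU.
  by under eq_Rintegral do rewrite mulN1r; rewrite mulN1r.
have -> : emp_mean xi (fun z => - U z) w = - emp_mean xi U w.
  by rewrite -mulN1r -emp_meanZ; congr emp_mean; apply/funext => z; rewrite mulN1r.
by rewrite opprK; move: h; rewrite opprB addrC.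
Qed.

End tails.

(** * Truncation under a moment of order p *)

Section great_is_good.
Context {R : realType} {dX dO : measure_display}.
Context {Xi : measurableType dX} {Omega : measurableType dO}.
Variables (P : probability Xi R) (Pr : probability Omega R).
Variables (N : nat) (xi : 'I_N -> {RV Pr >-> Xi}).
Hypothesis iid : iid_with_law P xi.
Hypothesis N_gt0 : (0 < N)%N.

Lemma markov_powR (X : Xi -> R) (p K y : R) :
  measurable_fun setT X -> 0 < p -> 0 < y ->
  (\int[P]_z (powR `|X z| p)%:E <= (powR K p)%:E)%E -> 0 <= K ->
  (P [set z | (y < X z)%R] <= (powR (K / y) p)%:E)%E.
Proof.
move=> mX p0 y0 IX K0.
have yp0 : 0 < powR y p by exact: powR_gt0.
have mS : measurable [set z | y < X z] by exact: measurable_lt_set.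
have mP : measurable_fun setT (fun z => powR `|X z| p).
  by apply: (measurableT_comp (measurable_powR p)); exact: measurableT_comp.
have h : ((powR y p)%:E * P [set z | (y < X z)%R] <= (powR K p)%:E)%E.
  apply: le_trans IX; rewrite -[X in P X]setIT -integral_indic//.
  rewrite -ge0_integralZl ?lee_fin ?powR_ge0//; last exact/measurable_EFinP/measurable_indic.
  apply: ge0_le_integral => //.
  - by move=> w _; rewrite -EFinM lee_fin mulr_ge0// powR_ge0.
  - exact/measurable_funeM/measurable_EFinP/measurable_indic.
  - exact/measurable_EFinP.
  - move=> w _; rewrite -EFinM lee_fin indicE.
    have [wA|wA] := pselect ([set z | y < X z] w).
      rewrite mem_set// mulr1; apply: ge0_ler_powR; rewrite ?nnegrE ?(ltW p0) ?(ltW y0)//.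
      by rewrite ltW// ltr_normr wA.
    by rewrite memNset// mulr0 powR_ge0.
move: h; rewrite -(fineK (fin_num_measure P _ mS)) -EFinM !lee_fin => h.
have -> : powR (K / y) p = powR K p / powR y p.
  apply: (mulIf (lt0r_neq0 yp0)); rewrite divfK ?gt_eqF// -powRM ?divfK ?gt_eqF ?(ltW y0)//.
  by rewrite divr_ge0// ltW.
by rewrite ler_pdivlMr// mulrC.
Qed.

(** With th = kappa sqrt (p / N), there are two exceptional events of probability at most (exp 4
    th)^p: a sample exceeds the truncation level, or the truncated sum is large. The factor 2 <= 2^p
    absorbs their sum. If th >= 1, the claimed bound is at least 1. *)
Lemma great_good (p kappa s2 : R) (h : Xi -> R) :
  2 <= p -> 1 <= kappa -> 0 < s2 -> great P p kappa s2 h ->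
  good P xi (powR (2 * expR 4 * kappa * Num.sqrt (p / N%:R)) p) s2 h.
Proof.
move=> p2 k1 s20 [h0 mh hs hL]; split => //.
have N0 : 0 < N%:R :> R by rewrite ltr0n.
have p0 : 0 < p by apply: lt_le_trans p2.
have [th thE] : {th : R | th = kappa * Num.sqrt (p / N%:R)} by eexists.
have th0 : 0 < th by rewrite thE mulr_gt0 ?sqrtr_gt0 ?divr_gt0//; apply: lt_le_trans k1.
have th0' := ltW th0; have N0' := ltW N0; have p0' := ltW p0.
have e1 : 1 <= expR 4 :> R by rewrite -expR0 ler_expR.
rewrite -mulrA -thE.
have mE : measurable [set w | 2 * s2 < emp_mean xi h w].
  by apply: measurable_lt_set => //; exact: measurable_emp_mean.
have [th1|th1] := leP 1 th.
  apply: (@le_trans _ _ 1%E); first exact: probability_le1.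
  rewrite lee_fin; apply: (@le_trans _ _ (powR 1 p)); first by rewrite powR1.
  apply: ge0_ler_powR; rewrite ?nnegrE ?ler01 ?(ltW p0)//; last by nra.
  by rewrite !mulr_ge0.
have ih : P.-integrable setT (EFin \o h) by exact: integrable_ge0 hs.
set Eh := \int[P]_u h u in hL.
have Eh_le : Eh <= s2 by rewrite -lee_fin -EFin_Rintegral.
pose X z := h z - Eh.
have mX : measurable_fun setT X by exact: measurable_funB.
have ic : P.-integrable setT (EFin \o (fun=> Eh)).
  exact: finite_measure_integrable_cst.
have iX : P.-integrable setT (EFin \o X).
  exact: (integrableB measurableT ih ic).
have EX : \int[P]_z X z = 0.
  by rewrite RintegralB// Rintegral_prob_cst subrr.
pose K := kappa * s2.
have K0 : 0 < K by rewrite mulr_gt0//; apply: lt_le_trans k1.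
have K0' := ltW K0.
have IXp : (\int[P]_z (powR `|X z| p)%:E <= (powR K p)%:E)%E.
  have := poweR_Lnorm P (EFin \o X) (lt0r_neq0 p0).
  rewrite (_ : (\int[P]_x (`|(EFin \o X) x| `^ p) = \int[P]_z (powR `|X z| p)%:E)%E)//.
  move=> <-; rewrite -poweR_EFin; apply: gt0_ler_poweR => //.
  - by rewrite in_itv/= Lnorm_ge0 leey.
  - by rewrite in_itv/= lee_fin ltW//= leey.
have mXp : measurable_fun setT (fun z => powR `|X z| p).
  by apply: (measurableT_comp (measurable_powR p)); exact: measurableT_comp.
have Kp0 : 0 < powR K p by exact: powR_gt0.
have mX2 : measurable_fun setT (fun z => X z ^+ 2) by exact: measurable_funX.
(* Pointwise X^2 <= K^2 + K^2 (|X| / K)^p, because p >= 2. *)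
have IX2 : (\int[P]_z (X z ^+ 2)%:E <= (2 * K ^+ 2)%:E)%E.
  pose q := K ^+ 2 / powR K p.
  have q0 : 0 <= q by rewrite divr_ge0 ?sqr_ge0// ltW.
  apply: (@le_trans _ _ (\int[P]_z ((K ^+ 2)%:E + q%:E * (powR `|X z| p)%:E))%E).
    apply: ge0_le_integral => //.
    - by move=> z _; rewrite lee_fin sqr_ge0.
    - exact/measurable_EFinP.
    - apply: emeasurable_funD => //; apply: measurable_funeM; exact/measurable_EFinP.
    - move=> z _; rewrite -EFinM -EFinD lee_fin -real_normK ?num_real//.
      have [xK|xK] := leP `|X z| K.
        apply: (@le_trans _ _ (K ^+ 2)).
          by apply: lerXn2r; rewrite ?nnegrE ?normr_ge0.
        by rewrite lerDl mulr_ge0// powR_ge0.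
      apply: (@le_trans _ _ (q * powR `|X z| p)); last by rewrite lerDr sqr_ge0.
      have x0 : 0 < `|X z| by apply: lt_trans xK.
      have pw a : 0 < a -> powR a p = a ^+ 2 * powR a (p - 2).
        move=> a0; rewrite -(powR_mulrn 2 (ltW a0)) -powRD 1?addrC ?subrK//.
        by rewrite (gt_eqF a0) implybT.
      rewrite /q mulrAC ler_pdivlMr// (pw _ K0) (pw _ x0).
      have le2 : powR K (p - 2) <= powR `|X z| (p - 2).
        by apply: ge0_ler_powR; rewrite ?nnegrE ?subr_ge0// ltW.
      have := ler_wpM2l (mulr_ge0 (sqr_ge0 `|X z|) (sqr_ge0 K)) le2.
      lra.
  rewrite ge0_integralD//; first last.
  - by apply: measurable_funeM; exact/measurable_EFinP.
  - by move=> z _; rewrite -EFinM lee_fin mulr_ge0// powR_ge0.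
  - by move=> z _; rewrite lee_fin sqr_ge0.
  rewrite integral_cst// [X in (_ * X)%E](_ : _ = 1%E); last exact: probability_setT.
  rewrite mule1 ge0_integralZl//; first last.
  - exact/measurable_EFinP.
  have -> : 2 * K ^+ 2 = K ^+ 2 + q * powR K p.
    by rewrite /q divfK ?gt_eqF//; lra.
  by rewrite EFinD leeD2l// [leRHS]EFinM; apply: lee_wpmul2l.
have iX2 : P.-integrable setT (EFin \o (fun z => X z ^+ 2)).
  by apply: integrable_ge0 IX2 => // z; exact: sqr_ge0.
(* Bernstein-type bound for h - E h truncated at y, plus a union bound for the
   event that some sample exceeds y *)
pose y := N%:R * s2 / p.
have y0 : 0 < y by rewrite divr_gt0// mulr_gt0.
have y0' := ltW y0.
(* The tilt [l] is fixed by l y = v, so that exp (l Xm) <= exp v = 1 / th. The second moment then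
   contributes 2 p v^2 th^2 exp v = 2 p v^2 exp (- v) <= 4 p, the origin of exp 4, against the gain
   l N s2 = v p. *)
pose v := - ln th.
have v0 : 0 < v by rewrite oppr_gt0 ln_lt0// th0.
have ev : expR (- v) = th by rewrite opprK lnK// posrE.
pose l := v / y.
have l0 : 0 < l by rewrite divr_gt0.
have v0' := ltW v0; have l0' := ltW l0.
pose Xm z := Num.min (X z) y.
have mXm : measurable_fun setT Xm by exact: measurable_minr.
pose phi z := expR (l * Xm z).
have mphi : measurable_fun setT phi.
  by apply: measurableT_comp => //; exact: measurable_funM.
pose m := expR (2 * l ^+ 2 * K ^+ 2 * expR v).
have phim : (\int[P]_z (phi z)%:E <= m%:E)%E.
  pose c := l ^+ 2 * expR v.
  have c0 : 0 <= c by rewrite mulr_ge0 ?sqr_ge0 ?expR_ge0.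
  have i1 : P.-integrable setT (EFin \o (fun z : Xi => 1 : R)).
    exact: finite_measure_integrable_cst.
  have il : P.-integrable setT (EFin \o (fun z => l * X z)).
    exact: (integrableZl measurableT l iX).
  have iq : P.-integrable setT (EFin \o (fun z => c * X z ^+ 2)).
    exact: (integrableZl measurableT c iX2).
  have i1l : P.-integrable setT (EFin \o (fun z => 1 + l * X z)).
    exact: (integrableD measurableT i1 il).
  have itot : P.-integrable setT (EFin \o (fun z => 1 + l * X z + c * X z ^+ 2)).
    exact: (integrableD measurableT i1l iq).
  apply: (@le_trans _ _ (\int[P]_z (1 + l * X z + c * X z ^+ 2)%:E)%E).
    have le z : phi z <= 1 + l * X z + c * X z ^+ 2.
      have Xv : l * Xm z <= v.
        have -> : v = l * y by rewrite /l divfK// gt_eqF.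
        by rewrite ler_wpM2l // ge_min lexx orbT.
      apply: le_trans (expR_le_quadratic Xv (ltW v0)) _.
      have -> : (l * Xm z) ^+ 2 * expR v = c * Xm z ^+ 2 by rewrite /c; ring.
      apply: lerD.
        by rewrite lerD2l ler_wpM2l // ge_min lexx.
      rewrite ler_wpM2l// /Xm; case: (leP (X z) y) => // yX.
      by apply: lerXn2r; rewrite ?nnegrE ?(ltW yX)//; apply/ltW/(lt_trans y0).
    apply: ge0_le_integral => //.
    - by move=> z _; rewrite lee_fin expR_ge0.
    - exact/measurable_EFinP.
    - exact: (measurable_int _ itot).
    - by move=> z _; rewrite lee_fin le.
  rewrite EFin_Rintegral// lee_fin.
  rewrite RintegralD// RintegralD// !RintegralZl// Rintegral_prob_cst EX mulr0 addr0.
  apply: le_trans (expR_ge1Dx _); rewrite lerD2l.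
  have -> : 2 * l ^+ 2 * K ^+ 2 * expR v = c * (2 * K ^+ 2) by rewrite /c; ring.
  by rewrite ler_wpM2l// -lee_fin -EFin_Rintegral.
pose B := [set w | N%:R * s2 <= \sum_(k < N) Xm (xi k w)].
have mB : measurable B.
  apply: measurable_le_set => //; apply: measurable_sum => k.
  by apply: (measurableT_comp mXm).
have Ba w : B w -> expR (l * (N%:R * s2)) <= \prod_(k < N) phi (xi k w).
  by rewrite /B/= => Bw; rewrite -expR_sum ler_expR -mulr_sumr ler_wpM2l.
pose target := powR (expR 4 * th) p.
have PB : (Pr B <= target%:E)%E.
  have := iid_chernoff iid mphi (fun z => expR_ge0 _) phim mB (expR_ge0 _) Ba.
  rewrite /m -expRM_natl -(fineK (fin_num_measure Pr _ mB)) -EFinM !lee_fin => H.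
  rewrite -(@ler_pM2l _ (expR (l * (N%:R * s2)))) ?expR_gt0//; apply: le_trans H _.
  rewrite /target {1}/powR gt_eqF ?mulr_gt0 ?expR_gt0// lnM ?posrE ?expR_gt0// expRK.
  rewrite -expRD ler_expR.
  have -> : l * (N%:R * s2) = v * p by rewrite /l /y; field; rewrite !gt_eqF.
  have th2 : th ^+ 2 = kappa ^+ 2 * (p / N%:R).
    by rewrite thE exprMn sqr_sqrtr// divr_ge0.
  have -> : N%:R * (2 * l ^+ 2 * K ^+ 2 * expR v) = 2 * p * (v ^+ 2 * (th ^+ 2 * expR v)).
    by rewrite th2 /l /y /K; field; rewrite !gt_eqF.
  have -> : th ^+ 2 * expR v = expR (- v).
    by rewrite expr2 -{1}ev -mulrA -ev -expRD addNr expR0 mulr1.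
  have v2 : v ^+ 2 * expR (- v) <= 2.
    have := @expR_ge1Dxn R v 1 (ltW v0); rewrite (_ : 2`! = 2%N)// => h1.
    have h2 := expRxMexpNx_1 v; have h3 := expR_ge0 (- v); nra.
  have -> : ln th = - v by rewrite opprK.
  nra.
pose A k := [set w | y < X (xi k w)].
have mA k : measurable (A k).
  by apply: measurable_lt_set => //; apply: (measurableT_comp mX).
have PA : pr_le Pr [set w | exists k, A k w] target.
  have PAk k : pr_le Pr (A k) (powR (K / y) p).
    split=> //; rewrite (_ : Pr (A k) = P [set z | y < X z]).
      exact: markov_powR.
    by rewrite -(iid.1 k)//; exact: measurable_lt_set.
  apply: pr_leW (pr_le_fin PAk).
  rewrite sumr_const card_ord -[_ *+ N]mulr_natl.
  have pN0 : 0 < p / N%:R by rewrite divr_gt0.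
  have pN0' := ltW pN0.
  have sp0 : 0 <= Num.sqrt (p / N%:R) by exact: sqrtr_ge0.
  have -> : K / y = th * Num.sqrt (p / N%:R).
    rewrite thE -mulrA -expr2 sqr_sqrtr // /K /y; field.
    by rewrite !gt_eqF.
  rewrite /target !powRM ?expR_ge0 //.
  rewrite mulrCA [leRHS]mulrC ler_wpM2l ?powR_ge0//.
  rewrite -powR12_sqrt // -powRrM.
  have pN1 : p / N%:R <= 1.
    have : Num.sqrt (p / N%:R) < 1 by apply: le_lt_trans th1; rewrite thE ler_peMl.
    by rewrite -[X in _ < X]sqrtr1 ltr_sqrt// => /ltW.
  (* Since p / 2 >= 1 and p / N <= 1, (p / N)^(p / 2) <= p / N; the union over N samples then costs
     N p / N = p <= exp p. *)
  apply: (@le_trans _ _ (N%:R * (p / N%:R))).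
    rewrite ler_wpM2l // -[leRHS](powRr1 (ltW pN0)); apply: ger_powR.
      by rewrite pN0.
    by rewrite mulrC ler_pdivlMr// mul1r.
  rewrite mulrCA divff ?gt_eqF// mulr1 -expRM.
  apply: (@le_trans _ _ (expR p)); first by have := expR_ge1Dx p; lra.
  by rewrite ler_expR; lra.
have [mBA PBA] := pr_leU (conj mB PB : pr_le Pr B target) PA.
apply: (@le_trans _ _ (Pr (B `|` [set w | exists k, A k w]))).
  apply: le_measure; rewrite ?inE// => w /= hw.
  have [Aw|nA] := pselect (exists k, A k w); [by right|left].
  rewrite /B/=.
  have -> : \sum_(k < N) Xm (xi k w) = \sum_(k < N) X (xi k w).
    apply: eq_bigr => k _; rewrite /Xm min_l// leNgt; apply/negP => h1.
    by apply: nA; exists k.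
  rewrite -natr_emp_mean// ler_wpM2l //.
  rewrite /X emp_meanD emp_mean_cst//; lra.
apply: le_trans PBA _.
rewrite lee_fin -mulrA powRM ?mulr_ge0 ?expR_ge0//.
rewrite -/target.
have t0 : 0 <= target by exact: powR_ge0.
have : 2 <= powR 2 p :> R.
  by rewrite -[leLHS]powRr1//; apply: ler_powR => //; rewrite ?ler1n//; lra.
nra.
Qed.

End great_is_good.

(** * Index functions for the chaining functional *)

Section gamma2_index.
Context {R : realType} {T : pointedType}.
Variables (dst : T -> T -> R) (alpha : R).
Hypothesis alpha_gt0 : 0 < alpha.
Hypothesis dst_ge0 : forall x y, 0 <= dst x y.
Local Open Scope card_scope.

Local Notation w j := (powR 2 (j%:R / 2) : R).

(** Partitions encoded by cell numbers: the cells at level j are the level sets of [g j]. This form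
    restricts to subsets and pulls back along maps, where partitions could acquire empty cells.
    Level 0 is listed apart because 2^(2^0) = 2 while one cell is allowed there. *)
Definition indexing (M : set T) (g : nat -> T -> nat) : Prop :=
  (forall x y, M x -> M y -> g 0%N x = g 0%N y) /\
  (forall j x, M x -> (g j x < 2 ^ (2 ^ j))%N).

Lemma indexingS M M' g : M' `<=` M -> indexing M g -> indexing M' g.
Proof. by move=> s [h0 h]; split=> [x y /s Mx /s My|j x /s Mx]; [exact: h0|exact: h]. Qed.

Lemma le_mesh (C : set (set T)) c x y : C c -> c x -> c y ->
  ((dst x y)%:E <= mesh dst C)%E.
Proof.
move=> Cc cx cy; apply: (@le_trans _ _ (ediam dst c)).
  by apply: ereal_sup_ubound; exists (x, y).
by apply: ereal_sup_ubound; exists c.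
Qed.

Lemma admissible_indexing M A : admissible M A ->
  exists2 g, indexing M g &
    forall j x y, M x -> M y -> g j x = g j y -> exists2 c, A j c & c x /\ c y.
Proof.
move=> [part card0 card].
have /choice[f hf] : forall j, exists f : set T -> nat,
    (forall c, A j c -> (f c < 2 ^ (2 ^ j))%N) /\ set_inj (A j) f /\
    (j = 0%N -> forall c, A j c -> f c = 0%N).
  case=> [|j].
    have : A 0%N #<= `I_1 by move: card0; rewrite card_eq_le => /andP[].
    move=> /pcard_leP/injfunPex[f fI finj]; exists f; split.
      by move=> c /fI /=; case: (f c).
    by split=> // _ c /fI /=; case: (f c).
  have /pcard_leP/injfunPex[f fI finj] := card j.+1 isT.
  by exists f; split=> // c /fI.
have /choice[cell hcell] : forall jx : nat * T, exists c,
    M jx.2 -> A jx.1 c /\ c jx.2.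
  move=> [j x] /=; have [Mx|nMx] := pselect (M x); last by exists set0.
  have [cov _ _] := part j.
  have : cover (A j) id x by rewrite cov.
  by move=> [c Ac cx]; exists c.
exists (fun j x => f j (cell (j, x))).
  split=> [x y Mx My|j x Mx].
    have [_ [_ f0]] := hf 0%N.
    by rewrite !f0//; [exact: (hcell (0%N, y) My).1|exact: (hcell (0%N, x) Mx).1].
  by apply: (hf j).1; exact: (hcell (j, x) Mx).1.
move=> j x y Mx My e.
have [Ax cx] := hcell (j, x) Mx; have [Ay cy] := hcell (j, y) My.
exists (cell (j, x)) => //; split=> //.
have -> // : cell (j, x) = cell (j, y).
by apply: (hf j).2.1 => //; rewrite inE.
Qed.

(** The level sets of [g j] in M form an admissible sequence with mesh at most [D j]. As M is
    nonempty, level 0 has exactly one cell, as admissibility asks. *)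
Lemma le_gamma2_indexing M g (D : nat -> \bar R) : M !=set0 -> indexing M g ->
  (forall j, 0 <= D j)%E ->
  (forall j x y, M x -> M y -> g j x = g j y -> ((dst x y)%:E <= D j)%E) ->
  (gamma2 dst alpha M <= \sum_(0 <= j <oo) (w j)%:E * poweR (D j) alpha)%E.
Proof.
move=> [x0 Mx0] [g0 gb] D0 gD.
pose A j := [set c | exists2 x, M x & c = [set y | M y /\ g j y = g j x]].
have Ac j c x y : A j c -> c x -> c y -> M x /\ g j x = g j y.
  by move=> [z Mz ->] [Mx ->] [My ->].
have meshD j : (mesh dst (A j) <= D j)%E.
  apply: ge_ereal_sup => _ [c Acj <-]; apply: ge_ereal_sup => _ [[x y] [/= cx cy] <-].
  have [Mx xy] := Ac _ _ _ _ Acj cx cy; have [My _] := Ac _ _ _ _ Acj cy cx.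
  exact: gD.
have adm : admissible M A.
  split=> [j||j _].
  - split.
    + apply/seteqP; split=> [x [_ [z Mz ->]] []//|x Mx].
      by exists [set y | M y /\ g j y = g j x] => //; exists x.
    + move=> _ _ [x Mx ->] [y My ->] [z [[Mz zx] [_ zy]]].
      by apply/seteqP; split=> u [Mu ux]; split=> //; rewrite ux -?zx -?zy.
    + by move=> _ [x Mx ->]; exists x.
  - have -> : A 0%N = (fun=> M) @` `I_1.
      apply/seteqP; split=> [_ [x Mx ->]|_ [n _ <-]].
        exists 0%N => //; apply/seteqP; split=> [y My|y []//]; split=> //.
        exact: g0.
      exists x0 => //; apply/seteqP; split=> [y My|y []//]; split=> //.
      exact: g0.
    by apply: inj_card_eq => -[|m] [|n] /=; rewrite !inE//=.
  - apply/pcard_leP/injfunPex; exists (fun c => g j (xget x0 c)).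
      move=> _ [x Mx ->] /=.
      case: xgetP => [y _ [My _]|/(_ x)]; first exact: gb.
      by move=> /(_ (conj Mx erefl)).
    move=> _ _ /set_mem[x Mx ->] /set_mem[y My ->].
    case: xgetP => [u _ [Mu ux]|/(_ x) /(_ (conj Mx erefl))//].
    case: xgetP => [v _ [Mv vy]|/(_ y) /(_ (conj My erefl))//].
    by rewrite ux vy => ->.
apply: (@le_trans _ _ (\sum_(0 <= j <oo) (w j)%:E * poweR (mesh dst (A j)) alpha)%E).
  by apply: ereal_inf_lbound; exists A.
apply: lee_nneseries => j _; first by rewrite mule_ge0 ?poweR_ge0// lee_fin powR_ge0.
apply: lee_wpmul2l; first by rewrite lee_fin powR_ge0.
apply: gt0_ler_poweR => //; first exact: ltW.
- rewrite in_itv/= leey andbT; apply: (@le_trans _ _ (dst x0 x0)%:E).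
    by rewrite lee_fin.
  by apply: (@le_mesh _ [set y | M y /\ g j y = g j x0]) => //; exists x0.
- by rewrite in_itv/= D0 leey.
Qed.

Lemma le_gamma2_real M g (D : nat -> R) (B : R) : M !=set0 -> indexing M g ->
  (forall j, 0 <= D j) ->
  (forall j x y, M x -> M y -> g j x = g j y -> dst x y <= D j) ->
  (forall n, \sum_(0 <= j < n) w j * powR (D j) alpha <= B) ->
  (gamma2 dst alpha M <= B%:E)%E.
Proof.
move=> M0 gI D0 gD DB.
have h : (gamma2 dst alpha M <= \sum_(0 <= j <oo) (w j)%:E * poweR (D j)%:E alpha)%E.
  apply: le_gamma2_indexing gI _ _ => // [j|j x y Mx My e]; rewrite lee_fin//.
apply: le_trans h _; apply: lime_le.
  by apply: is_cvg_nneseries => j _ _; rewrite mule_ge0 ?poweR_ge0// lee_fin powR_ge0.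
apply: nearW => n; under eq_bigr do rewrite poweR_EFin -EFinM.
by rewrite sumEFin lee_fin.
Qed.

(** The indexing of a sequence admissible for M restricts to M', and the meshes over M remain valid
    bounds. *)
Lemma gamma2S M M' : M' !=set0 -> M' `<=` M ->
  (gamma2 dst alpha M' <= gamma2 dst alpha M)%E.
Proof.
move=> M'0 M'M; apply: le_ereal_inf_tmp => _ [A admA <-].
have [g gI gA] := admissible_indexing admA.
have [x0 M'x0] := M'0.
apply: le_gamma2_indexing (indexingS M'M gI) _ _ => // [j|j x y M'x M'y e].
  have [c Ac [cx _]] := gA j x0 x0 (M'M _ M'x0) (M'M _ M'x0) erefl.
  by apply: le_trans (le_mesh Ac cx cx); rewrite lee_fin.
have [c Ac [cx cy]] := gA j x y (M'M _ M'x) (M'M _ M'y) e.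
exact: le_mesh Ac cx cy.
Qed.

Lemma gamma2_ge0 M : (0 <= gamma2 dst alpha M)%E.
Proof.
apply: le_ereal_inf_tmp => _ [A admA <-]; apply: nneseries_ge0 => j _ _.
by rewrite mule_ge0 ?poweR_ge0// lee_fin powR_ge0.
Qed.

(** The infimum need not be attained, so the bound [c] is strict; the series is handed on through
    its partial sums, with real diameters. *)
Lemma gamma2_indexing M (c : R) : M !=set0 -> (gamma2 dst alpha M < c%:E)%E ->
  exists g, exists D : nat -> R, [/\ indexing M g, forall j, 0 <= D j,
    forall j x y, M x -> M y -> g j x = g j y -> dst x y <= D j
  & forall n, \sum_(0 <= j < n) w j * powR (D j) alpha <= c].
Proof.
move=> [x0 Mx0] /ereal_inf_lt[_ [A admA <-] sc].
have [g gI gA] := admissible_indexing admA.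
have mesh0 j : (0 <= mesh dst (A j))%E.
  have [e Ac [cx _]] := gA j x0 x0 Mx0 Mx0 erefl.
  by apply: le_trans (le_mesh Ac cx cx); rewrite lee_fin.
have t0 j : (0 <= (w j)%:E * poweR (mesh dst (A j)) alpha)%E.
  by rewrite mule_ge0 ?poweR_ge0// lee_fin powR_ge0.
have part n : (\sum_(0 <= j < n) (w j)%:E * poweR (mesh dst (A j)) alpha < c%:E)%E.
  by apply: le_lt_trans sc; apply: nneseries_lim_ge.
(* An infinite mesh would make a partial sum infinite. *)
have meshy j : mesh dst (A j) \is a fin_num.
  rewrite ge0_fin_numE//; apply: (@lty_poweRy _ _ alpha); first exact: lt0r_neq0.
  rewrite ltey; apply/negP => /eqP e.
  have := part j.+1; rewrite big_nat_recr//= e.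
  rewrite gt0_muley ?lte_fin ?powR_gt0// addey ?ltNge ?leey//.
  by rewrite gt_eqF// (lt_le_trans (ltNyr 0))// sume_ge0.
exists g, (fun j => fine (mesh dst (A j))); split => //.
- by move=> j; rewrite fine_ge0.
- move=> j x y Mx My e; rewrite -lee_fin fineK//.
  by have [? Ac [cx cy]] := gA j x y Mx My e; exact: le_mesh Ac cx cy.
- move=> n; rewrite -lee_fin -sumEFin; apply/ltW; apply: le_lt_trans (part n).
  by apply: lee_sum => j _; rewrite -[in leRHS](fineK (meshy j)) poweR_EFin EFinM.
Qed.

End gamma2_index.

(** * Norms on row vectors; finiteness of gamma_2 *)

Section norm_facts.
Context {R : realType} {d : nat}.
Variable nrm : 'rV[R]_d -> R.
Hypothesis nrmP : is_norm nrm.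
Implicit Types (x y : 'rV[R]_d) (M : set 'rV[R]_d).

Lemma nrm0 : nrm 0 = 0.
Proof. by rewrite -(scale0r 0) (norm_homogeneous nrmP) normr0 mul0r. Qed.

Lemma nrmN x : nrm (- x) = nrm x.
Proof. by rewrite -scaleN1r (norm_homogeneous nrmP) normrN1 mul1r. Qed.

Lemma nrm_ge0 x : 0 <= nrm x.
Proof.
have := norm_triangle nrmP x (- x); rewrite subrr nrm0 nrmN; lra.
Qed.

Lemma ndistxx x : ndist nrm x x = 0.
Proof. by rewrite /ndist subrr nrm0. Qed.

Lemma ndistC x y : ndist nrm x y = ndist nrm y x.
Proof. by rewrite /ndist -nrmN opprB. Qed.

Lemma ndist_ge0 x y : 0 <= ndist nrm x y.
Proof. exact: nrm_ge0. Qed.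

Lemma ndist_triangle x y z : ndist nrm x z <= ndist nrm x y + ndist nrm y z.
Proof.
rewrite /ndist (_ : x - z = (x - y) + (y - z)); first exact: norm_triangle.
by rewrite addrA subrK.
Qed.

(** Factor by which [nrm] is dominated by the library's norm, the maximum of the coordinates, in
    which boundedness is expressed. *)
Definition nrm_const : R := \sum_(i < d) nrm (delta_mx 0 i).

Lemma nrm_const_ge0 : 0 <= nrm_const.
Proof. by apply: sumr_ge0 => i _; exact: nrm_ge0. Qed.

Lemma le_coord_norm x i : `|x 0 i| <= `|x|.
Proof.
rewrite [leRHS]/Num.norm /= mx_normrE; apply: le_trans (le_bigmax _ _ (0, i)).
by [].
Qed.

Lemma nrm_le_coord x (b : R) : (forall i, `|x 0 i| <= b) -> nrm x <= nrm_const * b.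
Proof.
move=> xb; rewrite [x in nrm x]row_sum_delta /nrm_const mulr_suml.
elim/big_ind2: _ => [|u a v c ha hc|i _]; first by rewrite nrm0.
  by apply: le_trans (norm_triangle nrmP _ _) _; exact: lerD.
by rewrite (norm_homogeneous nrmP) mulrC ler_wpM2l// nrm_ge0.
Qed.

Lemma nrm_le_norm x : nrm x <= nrm_const * `|x|.
Proof. by apply: nrm_le_coord => i; exact: le_coord_norm. Qed.

Lemma bounded_set_norm M : bounded_set M ->
  exists2 B : R, 0 < B & forall x, M x -> `|x| <= B.
Proof.
move=> /ex_strict_bound_gt0[B B0 MB]; exists B => // x Mx.
by apply/ltW/MB.
Qed.

Lemma bounded_ndist M : bounded_set M ->
  exists B : R, forall x y, M x -> M y -> ndist nrm x y <= B.
Proof.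
move=> /bounded_set_norm[B B0 MB]; exists (nrm_const * (B + B)) => x y Mx My.
apply: le_trans (nrm_le_norm _) _; rewrite ler_wpM2l ?nrm_const_ge0//.
by apply: le_trans (ler_normB _ _) _; rewrite lerD// MB.
Qed.

Lemma le_diam M x y : bounded_set M -> M x -> M y -> ndist nrm x y <= diam nrm M.
Proof.
move=> /bounded_ndist[B MB] Mx My; rewrite -lee_fin /diam fineK.
  by apply: ereal_sup_ubound; exists (x, y).
rewrite ge0_fin_numE.
  apply: (@le_lt_trans _ _ B%:E); last exact: ltry.
  by apply: ge_ereal_sup => _ [[u v] [/= Mu Mv] <-]; rewrite lee_fin MB.
apply: (@le_trans _ _ (ndist nrm x x)%:E); first by rewrite lee_fin ndist_ge0.
by apply: ereal_sup_ubound; exists (x, x).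
Qed.

Lemma diam_le M (B : R) : M !=set0 ->
  (forall x y, M x -> M y -> ndist nrm x y <= B) -> diam nrm M <= B.
Proof.
move=> [x0 Mx0] MB; rewrite -lee_fin /diam fineK.
  by apply: ge_ereal_sup => _ [[u v] [/= Mu Mv] <-]; rewrite lee_fin MB.
rewrite ge0_fin_numE.
  apply: (@le_lt_trans _ _ B%:E); last exact: ltry.
  by apply: ge_ereal_sup => _ [[u v] [/= Mu Mv] <-]; rewrite lee_fin MB.
apply: (@le_trans _ _ (ndist nrm x0 x0)%:E); first by rewrite lee_fin ndist_ge0.
by apply: ereal_sup_ubound; exists (x0, x0).
Qed.

Lemma diam_ge0 M : M !=set0 -> bounded_set M -> 0 <= diam nrm M.
Proof. by move=> [x Mx] bM; rewrite -(ndistxx x); exact: le_diam. Qed.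

Lemma diamS M M' : M' !=set0 -> M' `<=` M -> bounded_set M ->
  diam nrm M' <= diam nrm M.
Proof.
by move=> M'0 s bM; apply: diam_le => // x y /s Mx /s My; exact: le_diam.
Qed.

Lemma geometric_sum_le (r : R) n : 0 <= r < 1 ->
  \sum_(0 <= k < n) r ^+ k <= (1 - r)^-1.
Proof.
move=> /andP[r0 r1]; have r1' : 0 < 1 - r by rewrite subr_gt0.
rewrite -[leRHS]mul1r ler_pdivlMr// big_mkord mulrC.
have -> : (1 - r) * (\sum_(i < n) r ^+ i) = 1 - r ^+ n.
  by rewrite -[RHS]opprB subrX1 -mulNr opprB.
by rewrite gerBl exprn_ge0.
Qed.

(** Grid partitions: each coordinate is cut into k = 2^e parts with e about 2^j / (d + 1), which
    gives at most 2^(2^j) cells of diameter of order 2^(- e). The powers alpha of the diameters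
    decay much faster than the weights 2^(j / 2) grow; the comparison exp (- c e) <= C 2^(- j)
    already leaves a geometric series of ratio 2^(- 1/2). *)
Lemma gamma2_fin_num (alpha : R) M : 0 < alpha -> M !=set0 -> bounded_set M ->
  gamma2 (ndist nrm) alpha M \is a fin_num.
Proof.
move=> a0 M0 /bounded_set_norm[B B0 MB].
rewrite ge0_fin_numE; last exact: gamma2_ge0.
(* The predecessor makes e 0 = 0, hence one cell at level 0 in every dimension, while 2^j <= (d + 1)
   (e j + 1) still holds. *)
pose e j := ((2 ^ j).-1 %/ d.+1)%N.
pose k j := (2 ^ e j)%N.
have k0 j : (0 < k j)%N by rewrite expn_gt0.
have kS j : (k j).-1.+1 = k j by rewrite prednK.
(* The width 2 B + 1 exceeds the range 2 B of a coordinate on M, so the quotient stays below 1, the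
   truncation below [k j], and [inord] is exact. *)
pose q j x (i : 'I_d) : 'I_(k j).-1.+1 :=
  inord (Num.truncn ((x 0 i + B) / (2 * B + 1) * (k j)%:R)).
pose g j x : nat := enum_rank [ffun i => q j x i].
have W0 : 0 < 2 * B + 1 by lra.
have gb j x : (g j x < 2 ^ (2 ^ j))%N.
  apply: leq_trans (ltn_ord _) _.
  rewrite card_ffun !card_ord kS /k -expnM leq_exp2l//.
  apply: (@leq_trans (e j * d.+1)); first by rewrite leq_mul2l leqnSn orbT.
  by apply: leq_trans (leq_divM _ _) _; exact: leq_pred.
have gI : indexing M g.
  split=> [x y _ _|j x _]; last exact: gb.
  rewrite /g; congr (nat_of_ord (enum_rank _)); apply/ffunP => i; rewrite !ffunE.
  have k1 : (k 0%N).-1 = 0%N by rewrite /k /e (_ : (2 ^ 0).-1 = 0%N)// div0n.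
  have z u : nat_of_ord (u : 'I_(k 0%N).-1.+1) = 0%N.
    by apply/eqP; rewrite -leqn0; apply: leq_trans (leq_ord u) _; rewrite k1.
  by apply/val_inj; rewrite /= !z.
pose D j := nrm_const * ((2 * B + 1) / (k j)%:R).
have kR j : 0 < (k j)%:R :> R by rewrite ltr0n.
have D0 j : 0 <= D j by rewrite mulr_ge0 ?nrm_const_ge0// divr_ge0// ltW.
have gD j x y : M x -> M y -> g j x = g j y -> ndist nrm x y <= D j.
  move=> Mx My gxy; apply: nrm_le_coord => i; rewrite !mxE.
  have /ffunP/(_ i) : [ffun i => q j x i] = [ffun i => q j y i].
    by apply: enum_rank_inj; apply/val_inj.
  rewrite !ffunE => /(congr1 val) /=.
  pose s (z : 'rV[R]_d) : R := (z 0 i + B) / (2 * B + 1) * (k j)%:R.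
  have s0 z : M z -> 0 <= s z /\ (Num.truncn (s z) < k j)%N.
    move=> Mz; have := le_trans (le_coord_norm z i) (MB _ Mz).
    rewrite ler_norml => /andP[z1 z2].
    have sz0 : 0 <= s z by rewrite mulr_ge0// ?divr_ge0//; lra.
    split=> //; rewrite truncn_lt_nat// /s -ltr_pdivlMr// divff ?gt_eqF//.
    by rewrite ltr_pdivrMr//; lra.
  have [sx0 sx] := s0 _ Mx; have [sy0 sy] := s0 _ My.
  rewrite !inordK ?kS// => tr.
  have /andP[x1 x2] := truncn_itv sx0; have /andP[y1 y2] := truncn_itv sy0.
  rewrite -/(s x) -/(s y) in tr; rewrite tr in x1 x2.
  have : `|s x - s y| <= 1.
    by rewrite ler_norml; apply/andP; split; rewrite -natr1 in x2 y2; lra.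
  have -> : s x - s y = (x 0 i - y 0 i) * ((k j)%:R / (2 * B + 1)).
    by rewrite /s; ring.
  rewrite normrM [X in _ * X]ger0_norm ?divr_ge0// ?(ltW W0)//.
  rewrite mulrA ler_pdivrMr// mul1r -ler_pdivlMr//.
have [c cE] : {c : R | c = alpha * ln 2} by eexists.
have c0 : 0 < c by rewrite cE mulr_gt0// ln_gt0// ltr1n.
pose A := nrm_const * (2 * B + 1).
have A0 : 0 <= A by rewrite mulr_ge0 ?nrm_const_ge0// ltW.
pose K := powR A alpha * (expR c * d.+1%:R / c).
have K0 : 0 <= K by rewrite mulr_ge0 ?powR_ge0// divr_ge0 ?mulr_ge0 ?expR_ge0// ltW.
pose r : R := powR 2 (- 2^-1).
have r01 : 0 <= r < 1.
  rewrite powR_ge0/= /r /powR pnatr_eq0/= expR_lt1 mulNr oppr_lt0 mulr_gt0//.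
  by rewrite ln_gt0// ltr1n.
apply: (@le_lt_trans _ _ (K * (1 - r)^-1)%:E); last exact: ltry.
apply: (le_gamma2_real a0 ndist_ge0 M0 gI D0 gD) => n.
apply: (@le_trans _ _ (\sum_(0 <= j < n) K * r ^+ j)); last first.
  by rewrite -mulr_sumr ler_wpM2l// geometric_sum_le.
apply: ler_sum => j _.
have -> : D j = A * expR (- (ln 2 * (e j)%:R)).
  rewrite /D mulrA -/A; congr (_ * _).
  by rewrite /k natrX -[2%:R in LHS]lnK ?posrE// -expRM_natr expRN.
rewrite powRM ?expR_ge0// -expRM.
have -> : - (ln 2 * (e j)%:R) * alpha = - (c * (e j)%:R) by rewrite cE; ring.
have key : expR (- (c * (e j)%:R)) <= expR c * d.+1%:R / c * powR 2 (- j%:R).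
  have h1 : 2 ^+ j <= d.+1%:R * (e j).+1%:R :> R.
    rewrite -natrX -natrM ler_nat mulnC /e.
    have -> : (2 ^ j = (2 ^ j).-1.+1)%N by rewrite prednK// expn_gt0.
    exact: ltn_ceil.
  have h2 : c * (e j).+1%:R <= expR (c * (e j).+1%:R).
    by have := expR_ge1Dx (c * (e j).+1%:R); lra.
  rewrite powRN powR_mulrn//.
  have -> : - (c * (e j)%:R) = c - c * (e j).+1%:R by rewrite -natr1; ring.
  rewrite expRD -!mulrA ler_wpM2l ?expR_ge0//.
  have p2 : 0 < 2 ^+ j :> R by rewrite exprn_gt0.
  rewrite mulrA ler_pdivlMr// ler_pdivlMr//.
  have XY := expRxMexpNx_1 (c * (e j).+1%:R).
  set X := expR _ in h2 XY; set Y := expR _ in XY *.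
  have Y0 : 0 <= Y by exact: expR_ge0.
  have := ler_wpM2l (mulr_ge0 Y0 (ltW c0)) h1.
  have := ler_wpM2l (mulr_ge0 Y0 (ler0n R d.+1)) h2.
  have -> : Y * d.+1%:R * X = d.+1%:R by rewrite mulrC mulrA XY mul1r.
  lra.
have rj : r ^+ j = powR 2 (j%:R / 2) * powR 2 (- j%:R).
  rewrite -powRD ?pnatr_eq0 ?implybT// -powR_mulrn ?powR_ge0// -powRrM.
  by congr (powR _ _); field.
rewrite rj /K mulrCA -!mulrA ler_wpM2l ?powR_ge0//.
rewrite mulrCA [leRHS]mulrC -!mulrA [leRHS]mulrC -!mulrA.
have := ler_wpM2l (powR_ge0 2 (j%:R / 2)) key.
lra.
Qed.

End norm_facts.

(** * Chaining *)

Section numeric_bounds.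
Context {R : realType}.

(** Lower bounds of exp by repeated doubling of the argument, from 1 + x <= exp x at a small x. In
    the proofs below, each rational is the square of the preceding one, rounded down. *)
Lemma expR_double_ge (x a b : R) : 0 <= a -> a <= expR x -> b <= a * a ->
  b <= expR (2 * x).
Proof.
move=> a0 ax ab; apply: le_trans ab _.
by rewrite expRM_natl expr2; apply: ler_pM.
Qed.

(** Enough for the union bound over the constraints, which asks for exp 1 >= 21/8 = (2 + 13/4) /
    2. *)
Lemma ge_expR1 : 263 / 100 <= expR 1 :> R.
Proof.
have h0 : 33 / 32 <= expR (1 / 32) :> R by have := @expR_ge1Dx R (1 / 32); lra.
have h1 : 1063 / 1000 <= expR (2 * (1 / 32)) :> R by apply: (expR_double_ge _ h0); clear; lra.
have h2 : 1129 / 1000 <= expR (2 * (2 * (1 / 32))) :> R by apply: (expR_double_ge _ h1); clear; lra.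
have h3 : 1274 / 1000 <= expR (2 * (2 * (2 * (1 / 32)))) :> R by apply: (expR_double_ge _ h2); clear; lra.
have h4 : 1623 / 1000 <= expR (2 * (2 * (2 * (2 * (1 / 32))))) :> R by apply: (expR_double_ge _ h3); clear; lra.
have h5 : 263 / 100 <= expR (2 * (2 * (2 * (2 * (2 * (1 / 32)))))) :> R by apply: (expR_double_ge _ h4); clear; lra.
have e : (2 * (2 * (2 * (2 * (2 * (1 / 32)))))) = 1 :> R by field.
by rewrite -[X in expR X]e.
Qed.

(** The value 71/100 fits both chaining budgets: 49/10 * 71/100 <= 7/2 and 49/10 * (1 - 71/100) >=
    7/5. *)
Lemma ln2_le : ln 2 <= 71 / 100 :> R.
Proof.
rewrite -[leRHS]expRK ler_ln ?posrE ?expR_gt0//.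
have h0 : 1671 / 1600 <= expR (71 / 1600) :> R by have := @expR_ge1Dx R (71 / 1600); lra.
have h1 : 409 / 375 <= expR (2 * (71 / 1600)) :> R by apply: (expR_double_ge _ h0); clear; lra.
have h2 : 2379 / 2000 <= expR (2 * (2 * (71 / 1600))) :> R by apply: (expR_double_ge _ h1); clear; lra.
have h3 : 2829 / 2000 <= expR (2 * (2 * (2 * (71 / 1600)))) :> R by apply: (expR_double_ge _ h2); clear; lra.
have h4 : 2 <= expR (2 * (2 * (2 * (2 * (71 / 1600))))) :> R by apply: (expR_double_ge _ h3); clear; lra.
suff <- : (2 * (2 * (2 * (2 * (71 / 1600))))) = 71 / 100 :> R by [].
by field.
Qed.

(** Makes [log_factor] at least 1 + 3/5 = 8/5, the threshold assumed in chaining. *)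
Lemma ln2_ge : 3 / 5 <= ln 2 :> R.
Proof.
rewrite -[leLHS]expRK ler_ln ?posrE ?expR_gt0//.
have h0 : 17 / 20 <= expR (- (3 / 20)) :> R by have := @expR_ge1Dx R (- (3 / 20)); lra.
have h1 : 72 / 100 <= expR (2 * (- (3 / 20))) :> R by apply: (expR_double_ge _ h0); clear; lra.
have h2 : 1 / 2 <= expR (2 * (2 * (- (3 / 20)))) :> R by apply: (expR_double_ge _ h1); clear; lra.
have e35 : (2 * (2 * (- (3 / 20)))) = - (3 / 5) :> R by field.
rewrite e35 in h2.
have h3 := @expRxMexpNx_1 R (3 / 5); have h4 := @expR_gt0 R (3 / 5).
move: h2 h3 h4; set u := expR (- (3 / 5)); set v := expR _; clear; nra.
Qed.

(** The left side sums the tails 2 exp (- 7/5 L (k + 1)) of successive chaining levels. With y = exp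
    (- 2/5 L) and z = exp (- L), the claim reads y + 5/8 y z <= 5/8, which holds from L = 8/5 on. *)
Lemma exp_geometric_tail (L : R) : 8 / 5 <= L ->
  2 * expR (- (7 / 5 * L)) / (1 - expR (- (7 / 5 * L))) <= 5 / 4 * expR (- L) /\
  expR (- (7 / 5 * L)) < 1.
Proof.
move=> L85; have -> : expR (- (7 / 5 * L)) = expR (- (2 / 5 * L)) * expR (- L).
  by rewrite -expRD; congr expR; field.
have y0 := @expR_gt0 R (- (2 / 5 * L)); have z0 := @expR_gt0 R (- L).
have y1 : expR (- (2 / 5 * L)) <= 542 / 1000.
  have h0 : 27 / 25 <= expR (2 / 25) :> R by have := @expR_ge1Dx R (2 / 25); lra.
  have h1 : 1166 / 1000 <= expR (2 * (2 / 25)) :> R by apply: (expR_double_ge _ h0); clear; lra.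
  have h2 : 1359 / 1000 <= expR (2 * (2 * (2 / 25))) :> R by apply: (expR_double_ge _ h1); clear; lra.
  have h3 : 1846 / 1000 <= expR (2 * (2 * (2 * (2 / 25)))) :> R by apply: (expR_double_ge _ h2); clear; lra.
  have h4 := @expRxMexpNx_1 R (2 * (2 * (2 * (2 / 25)))); have h5 := @expR_gt0 R (- (2 * (2 * (2 * (2 / 25))))).
  apply: (@le_trans _ _ (expR (- (2 * (2 * (2 * (2 / 25))))))); first by rewrite ler_expR; move: L85; clear; lra.
  move: h3 h4 h5; set u := expR (2 * (2 * (2 * (2 / 25)))); set v := expR _; clear; nra.
have z1 : expR (- L) <= 218 / 1000.
  have h0 : 11 / 10 <= expR (1 / 10) :> R by have := @expR_ge1Dx R (1 / 10); lra.
  have h1 : 121 / 100 <= expR (2 * (1 / 10)) :> R by apply: (expR_double_ge _ h0); clear; lra.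
  have h2 : 1464 / 1000 <= expR (2 * (2 * (1 / 10))) :> R by apply: (expR_double_ge _ h1); clear; lra.
  have h3 : 2143 / 1000 <= expR (2 * (2 * (2 * (1 / 10)))) :> R by apply: (expR_double_ge _ h2); clear; lra.
  have h4 : 459 / 100 <= expR (2 * (2 * (2 * (2 * (1 / 10))))) :> R by apply: (expR_double_ge _ h3); clear; lra.
  have h5 := @expRxMexpNx_1 R (2 * (2 * (2 * (2 * (1 / 10))))); have h6 := @expR_gt0 R (- (2 * (2 * (2 * (2 * (1 / 10)))))).
  apply: (@le_trans _ _ (expR (- (2 * (2 * (2 * (2 * (1 / 10)))))))); first by rewrite ler_expR; move: L85; clear; lra.
  move: h4 h5 h6; set u := expR (2 * (2 * (2 * (2 * (1 / 10))))); set v := expR _; clear; nra.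
move: y0 y1 z0 z1; move: (expR _) (expR _) => z y y0 y1 z0 z1.
have yz : y * z <= 542 / 1000 * (218 / 1000).
  by apply: ler_pM => //; exact: ltW.
split; last by lra.
rewrite ler_pdivrMr; last lra.
have : z * (y + 5 / 8 * (y * z) - 5 / 8) <= 0.
  by rewrite pmulr_rle0//; lra.
lra.
Qed.

End numeric_bounds.

Lemma exists_pow2 {R : archiRealFieldType} (x : R) : 1 < x ->
  exists j : nat, x / 2 < 2 ^+ j /\ 2 ^+ j <= x.
Proof.
move=> x1; have ex : exists j : nat, x / 2 < 2 ^+ j.
  exists (Num.truncn x); have := truncnS_gt x; rewrite -natr1 => h.
  have : (Num.truncn x)%:R + 1 <= 2 * 2 ^+ Num.truncn x :> R.
    rewrite natr1 -exprS -natrX ler_nat; exact/ltnW/ltn_expl.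
  lra.
case: (ex_minnP ex) => j xj jmin; exists j; split=> //.
case: j xj jmin => [|j] xj jmin; first by rewrite expr0 ltW.
rewrite leNgt; apply/negP => h.
have /jmin : x / 2 < 2 ^+ j by rewrite exprS in h; lra.
by rewrite ltnn.
Qed.

Section chaining.
Context {R : realType} {dX dO : measure_display} {V : choiceType}.
Context {Xi : measurableType dX} {Omega : measurableType dO}.
Variables (P : probability Xi R) (Pr : probability Omega R).
Variables (N : nat) (xi : 'I_N -> {RV Pr >-> Xi}).
Hypothesis iid : iid_with_law P xi.
Hypothesis N_gt0 : (0 < N)%N.
Variables (T : set V) (F : V -> Xi -> R) (xs : V) (L : Xi -> R) (s2 : R).
Variable dst : V -> V -> R.
Hypothesis Txs : T xs.
Hypothesis mF : forall x, T x -> measurable_fun setT (F x).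
Hypothesis iF : forall x, T x -> P.-integrable setT (EFin \o F x).
Hypothesis mL : measurable_fun setT (fun z => L z ^+ 2).
Hypothesis iL : (\int[P]_z (L z ^+ 2)%:E <= s2%:E)%E.
Hypothesis s2_gt0 : 0 < s2.
Hypothesis FL : forall x y z, T x -> T y -> `|F x z - F y z| <= L z * dst x y.
Hypothesis dst_ge0 : forall x y, 0 <= dst x y.

Definition centered x w : R := emp_mean xi (F x) w - \int[P]_z F x z.

Let dev_event x y (a u : R) : set Omega :=
  [set w | emp_mean xi (fun z => L z ^+ 2) w <= 2 * s2 /\
     Num.sqrt s2 * a * Num.sqrt (6 * u / N%:R) < `|centered x w - centered y w|].

Let centeredB x y w : T x -> T y -> centered x w - centered y w =
  emp_mean xi (fun z => F x z - F y z) w - \int[P]_z (F x z - F y z).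
Proof.
move=> Tx Ty; rewrite RintegralB//; [|exact: iF..].
rewrite (emp_meanD xi (F x) (fun z => - F y z)).
have -> : emp_mean xi (fun z => - F y z) w = - emp_mean xi (F y) w.
  by rewrite -mulN1r -emp_meanZ; congr emp_mean; apply/funext => z; rewrite mulN1r.
by rewrite /centered; ring.
Qed.

Let dev_tail x y a u : T x -> T y -> 0 <= u -> dst x y <= a ->
  pr_le Pr (dev_event x y a u) (2 * expR (- u)).
Proof.
move=> Tx Ty u0 xya.
have a0 : 0 <= a by apply: le_trans xya.
have mU : measurable_fun setT (fun z => F x z - F y z).
  by apply: measurable_funB; exact: mF.
have iU : P.-integrable setT (EFin \o (fun z => F x z - F y z)).
  exact: (integrableB measurableT (iF Tx) (iF Ty)).
have UL z : `|F x z - F y z| <= L z * dst x y by exact: FL.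
have L0 z : L z * dst x y <= `|L z| * a.
  apply: (@le_trans _ _ (`|L z| * dst x y)); first by rewrite ler_wpM2r// ler_norm.
  by rewrite ler_wpM2l.
have -> : dev_event x y a u = [set w | emp_mean xi (fun z => L z ^+ 2) w <= 2 * s2 /\
   Num.sqrt s2 * a * Num.sqrt (6 * u / N%:R) <
   `|emp_mean xi (fun z => F x z - F y z) w - \int[P]_z (F x z - F y z)|].
  by apply/seteqP; split=> w; rewrite /dev_event/= centeredB.
split; last by apply: empirical_tail => // z; apply: le_trans (UL z) (L0 z).
apply: measurableI.
  apply: measurable_le_set => //; exact: measurable_emp_mean.
apply: measurable_lt_set => //; apply: measurableT_comp => //.
by apply: measurable_funB => //; exact: measurable_emp_mean.
Qed.

Variables (g : nat -> V -> nat) (a : nat -> R) (A S Lc : R).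
Hypothesis g_lt : forall j x, T x -> (g j x < 2 ^ (2 ^ j))%N.
Hypothesis g_dst : forall j x y, T x -> T y -> g j x = g j y -> dst x y <= a j.
Hypothesis dst_A : forall x y, T x -> T y -> dst x y <= A.
Hypothesis sum_a : forall n, \sum_(0 <= j < n) powR 2 (j%:R / 2) * a j <= S.
Hypothesis Lc_ge : 8 / 5 <= Lc.

(** Empty cells receive [xs]: every number then has a representative in T, and the union bounds run
    over all numbers below 2^(2^j). *)
Let rep j n : V := xget xs [set x | T x /\ g j x = n].

Let T_rep j n : T (rep j n).
Proof. by rewrite /rep; case: xgetP => [x _ []|]. Qed.

Let g_rep j x : T x -> g j (rep j (g j x)) = g j x.
Proof. by move=> Tx; rewrite /rep; case: xgetP => [y _ []//|/(_ x)[]]. Qed.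

Let a_ge0 j : 0 <= a j.
Proof. by apply: le_trans (dst_ge0 xs xs) _; exact: g_dst. Qed.

Let A_ge0 : 0 <= A.
Proof. by apply: le_trans (dst_ge0 xs xs) _; exact: dst_A. Qed.

Let Lc_gt0 : 0 < Lc. Proof. by move: Lc_ge; lra. Qed.

(** There are 2^(2^j0) <= exp (7/2 Lc) cells, and 9/2 - 7/2 = 1. *)
Let first_link (j0 : nat) : 2 ^+ j0 <= 49 / 10 * Lc ->
  pr_le Pr [set w | exists n : 'I_(2 ^ (2 ^ j0)), dev_event (rep j0 n) xs A (9 / 2 * Lc) w]
    (2 * expR (- Lc)).
Proof.
move=> j0L.
have h n : pr_le Pr (dev_event (rep j0 n) xs A (9 / 2 * Lc)) (2 * expR (- (9 / 2 * Lc))).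
  apply: dev_tail => //; last exact: dst_A.
  by move: Lc_gt0; lra.
apply: pr_leW (pr_le_fin (fun n : 'I_(2 ^ (2 ^ j0)) => h n)).
rewrite sumr_const card_ord -[_ *+ _]mulr_natl mulrCA ler_wpM2l//.
rewrite natrX -[X in X ^+ _ * _]lnK ?posrE// -expRM_natl -expRD ler_expR natrX.
have := ler_wpM2l (exprn_ge0 j0 (ler0n R 2)) (@ln2_le R).
move: j0L Lc_gt0; lra.
Qed.

Let link j n := dev_event (rep j.+1 n) (rep j (g j (rep j.+1 n))) (a j) (2 ^+ j.+1).

(** For j = j0 + k, 2^(j + 1) >= 49/10 Lc (k + 1), so the 2^(2^(j + 1)) links at this level fail
    with total probability at most 2 exp (- (1 - ln 2) 2^(j + 1)) <= 2 exp (- 7/5 Lc (k + 1)). *)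
Let later_links (j0 : nat) : 49 / 10 * Lc / 2 < 2 ^+ j0 ->
  pr_le Pr [set w | exists k, exists n : 'I_(2 ^ (2 ^ (j0 + k).+1)), link (j0 + k) n w]
    (5 / 4 * expR (- Lc)).
Proof.
move=> j0L; pose q := expR (- (7 / 5 * Lc)).
have [qL q1] := exp_geometric_tail Lc_ge; rewrite -/q in qL q1.
have q0 : 0 < q by exact: expR_gt0.
apply: (pr_leW qL); apply: (@pr_le_series _ _ _ _ _ (fun k => 2 * q * q ^+ k)); last first.
  move=> n; rewrite -mulr_sumr ler_wpM2l ?mulr_ge0 ?(ltW q0)//.
  by apply: geometric_sum_le; rewrite (ltW q0).
move=> k; set j := (j0 + k)%N.
have h n : pr_le Pr (link j n) (2 * expR (- 2 ^+ j.+1)).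
  rewrite /link; apply: dev_tail => //.
  by apply: g_dst => //; rewrite g_rep.
apply: pr_leW (pr_le_fin (fun n : 'I_(2 ^ (2 ^ j.+1)) => h n)).
rewrite sumr_const card_ord -[_ *+ _]mulr_natl mulrCA -mulrA ler_wpM2l//.
rewrite natrX -[X in X ^+ _ * _]lnK ?posrE// -expRM_natl -expRD natrX.
rewrite -exprS -expRM_natl ler_expR.
have Mk : 49 / 10 * Lc * k.+1%:R <= 2 ^+ j.+1.
  rewrite -addSn exprD exprS.
  apply: ler_pM => //; [by move: Lc_gt0; lra|by move: j0L; lra|].
  by rewrite -natrX ler_nat ltn_expl.
have := ler_wpM2l (exprn_ge0 j.+1 (ler0n R 2)) (@ln2_le R).
have : 0 <= Lc * k.+1%:R by rewrite mulr_ge0 ?(ltW Lc_gt0).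
move: Mk; lra.
Qed.

(* A single link from level j0, where 2^j0 is about 49/10 Lc, to xs carries the
   tail parameter 9/2 Lc, which absorbs the union over 2^(2^j0) cells; a link
   from level j+1 to level j carries 2^(j+1).  Linking the representative of a
   cell to that of the coarser cell containing it, and not the two
   representatives of the same point, leaves one event per cell. *)
Lemma chaining : exists2 Bad, pr_le Pr Bad (13 / 4 * expR (- Lc)) &
  forall w, emp_mean xi (fun z => L z ^+ 2) w <= 2 * s2 -> ~ Bad w ->
  forall x, T x -> `|centered x w - centered xs w| <=
    Num.sqrt s2 * (2 * Num.sqrt 3 * (S / Num.sqrt N%:R)
      + 3 * Num.sqrt 3 * (A * Num.sqrt Lc / Num.sqrt N%:R)).
Proof.
have [j0 [j0L Lj0]] : exists j : nat, 49 / 10 * Lc / 2 < 2 ^+ j /\ 2 ^+ j <= 49 / 10 * Lc.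
  by apply: exists_pow2; move: Lc_ge; lra.
eexists.
  apply: pr_leW; last exact: (pr_leU (first_link Lj0) (later_links j0L)).
  lra.
move=> w wL nB.
have N0 : 0 < N%:R :> R by rewrite ltr0n.
have s0 := ltW s2_gt0.
have sN0 : 0 < Num.sqrt N%:R :> R by rewrite sqrtr_gt0.
have nB1 n : (n < 2 ^ (2 ^ j0))%N -> `|centered (rep j0 n) w - centered xs w| <=
    Num.sqrt s2 * A * Num.sqrt (6 * (9 / 2 * Lc) / N%:R).
  move=> nlt; rewrite leNgt; apply/negP => h.
  by apply: nB; left; exists (Ordinal nlt).
have nB2 j n : (j0 <= j)%N -> (n < 2 ^ (2 ^ j.+1))%N ->
    `|centered (rep j.+1 n) w - centered (rep j (g j (rep j.+1 n))) w| <=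
    Num.sqrt s2 * a j * Num.sqrt (6 * 2 ^+ j.+1 / N%:R).
  move=> j0j nlt; rewrite leNgt; apply/negP => h.
  apply: nB; right; exists (j - j0)%N; rewrite subnKC//.
  by exists (Ordinal nlt).
have chain k n : (n < 2 ^ (2 ^ (j0 + k)))%N ->
    `|centered (rep (j0 + k) n) w - centered xs w| <=
    Num.sqrt s2 * A * Num.sqrt (6 * (9 / 2 * Lc) / N%:R) +
    \sum_(j0 <= j < j0 + k) Num.sqrt s2 * a j * Num.sqrt (6 * 2 ^+ j.+1 / N%:R).
  elim: k n => [|k IH] n.
    by rewrite addn0 big_geq// addr0; exact: nB1.
  rewrite addnS => nlt; rewrite big_nat_recr ?leq_addr//= addrA.
  have h1 := nB2 _ _ (leq_addr k j0) nlt.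
  have h2 := IH _ (g_lt (j0 + k) (T_rep (j0 + k).+1 n)).
  have := ler_normD (centered (rep (j0 + k).+1 n) w - centered (rep (j0 + k) (g (j0 + k) (rep (j0 + k).+1 n))) w) (centered (rep (j0 + k) (g (j0 + k) (rep (j0 + k).+1 n))) w - centered xs w).
  rewrite addrA subrK; lra.
(* The constants of the conclusion: 6 * 9/2 = 3^2 * 3 here, and 6 * 2 = 2^2 * 3 for the later
   links. *)
have sqA : Num.sqrt (6 * (9 / 2 * Lc) / N%:R) = 3 * Num.sqrt 3 * (Num.sqrt Lc / Num.sqrt N%:R) :> R.
  have -> : 6 * (9 / 2 * Lc) / N%:R = 3 ^+ 2 * (3 * (Lc * N%:R^-1)) by field; rewrite gt_eqF.
  rewrite sqrtrM ?sqr_ge0// sqrtr_sqr ger0_norm// sqrtrM// sqrtrM ?(ltW Lc_gt0)//.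
  by rewrite sqrtrV ?(ltW N0)// mulrA.
have sqj j : Num.sqrt (6 * 2 ^+ j.+1 / N%:R) = 2 * Num.sqrt 3 * (powR 2 (j%:R / 2) / Num.sqrt N%:R) :> R.
  have -> : 6 * 2 ^+ j.+1 / N%:R = 2 ^+ 2 * (3 * (2 ^+ j * N%:R^-1)) :> R.
    by rewrite exprS; field; rewrite gt_eqF.
  rewrite sqrtrM ?sqr_ge0// sqrtr_sqr ger0_norm// sqrtrM// sqrtrM ?exprn_ge0//.
  rewrite sqrtrV ?(ltW N0)// mulrA; congr (_ * (_ / _)).
  by rewrite powRrM powR_mulrn// powR12_sqrt// exprn_ge0.
have chainS k : \sum_(j0 <= j < j0 + k) Num.sqrt s2 * a j * Num.sqrt (6 * 2 ^+ j.+1 / N%:R) <=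
    Num.sqrt s2 * (2 * Num.sqrt 3 * (S / Num.sqrt N%:R)).
  have -> : \sum_(j0 <= j < j0 + k) Num.sqrt s2 * a j * Num.sqrt (6 * 2 ^+ j.+1 / N%:R) =
      Num.sqrt s2 * (2 * Num.sqrt 3 / Num.sqrt N%:R) * \sum_(j0 <= j < j0 + k) powR 2 (j%:R / 2) * a j.
    by rewrite mulr_sumr; apply: eq_bigr => j _; rewrite sqj; ring.
  have -> : Num.sqrt s2 * (2 * Num.sqrt 3 * (S / Num.sqrt N%:R)) =
      Num.sqrt s2 * (2 * Num.sqrt 3 / Num.sqrt N%:R) * S by ring.
  rewrite ler_wpM2l ?mulr_ge0 ?sqrtr_ge0 ?invr_ge0//.
  apply: le_trans (sum_a (j0 + k)); rewrite [leRHS](@big_cat_nat _ _ _ j0)//= ?leq_addr//.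
  by rewrite lerDr sumr_ge0// => j _; rewrite mulr_ge0 ?powR_ge0.
move=> x Tx; apply/ler_addgt0Pr => e e0.
(* The error from x to its representative at a fine level J: |F x - F rep| <= a J (1 + L^2), hence
   at most a J (1 + 2 s2) for the empirical mean and a J (1 + s2) for the expectation; [cc] adds the
   two factors. *)
pose cc := 2 + 3 * s2.
have cc0 : 0 < cc by rewrite /cc; move: s2_gt0; lra.
(* The [a j] cannot stay above a positive constant: their sum with weights at least 1 is bounded by
   [S]. *)
have [k ak] : exists k, a (j0 + k)%N * cc < e.
  apply: contrapT => /forallNP h.
  have le k : e / cc <= a (j0 + k)%N.
    by rewrite ler_pdivrMr// leNgt; apply/negP => h1; exact: (h k).
  have ec : 0 < e / cc by rewrite divr_gt0.
  have S0 : 0 <= S by have := sum_a 0; rewrite big_geq.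
  pose n := Num.truncn (S / (e / cc)).
  have := sum_a (j0 + n.+1)%N; rewrite (@big_cat_nat _ _ _ j0)//= ?leq_addr// leNgt => /negP; apply.
  have sum1 : 0 <= \sum_(0 <= i < j0) powR 2 (i%:R / 2) * a i.
    by apply: sumr_ge0 => j _; rewrite mulr_ge0 ?powR_ge0.
  apply: (@lt_le_trans _ _ (\sum_(j0 <= i < j0 + n.+1) e / cc)).
    rewrite sumr_const_nat addKn -[_ *+ _]mulr_natl -ltr_pdivrMr//.
    exact: truncnS_gt.
  apply: (@le_trans _ _ (\sum_(j0 <= i < j0 + n.+1) powR 2 (i%:R / 2) * a i)); last by rewrite lerDr.
  rewrite big_nat [leRHS]big_nat; apply: ler_sum => j /andP[j0j _].
  have := le (j - j0)%N; rewrite subnKC// => h1; apply: le_trans h1 _.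
  rewrite ler_peMl// -[leLHS](powRr0 2); apply: ler_powR; first by rewrite ler1n.
  by rewrite divr_ge0.
set J := (j0 + k)%N in ak *.
have TJ := T_rep J (g J x).
have h1 := chain k _ (g_lt J Tx); rewrite -/J in h1.
have h2 := chainS k.
have h3 : `|centered x w - centered (rep J (g J x)) w| <= a J * cc.
  have UL z : `|F x z - F (rep J (g J x)) z| <= a J * (1 + L z ^+ 2).
    apply: le_trans (FL z Tx TJ) _.
    have d1 : dst x (rep J (g J x)) <= a J by apply: g_dst => //; rewrite g_rep.
    apply: (@le_trans _ _ ((1 + L z ^+ 2) * dst x (rep J (g J x)))).
      by rewrite ler_wpM2r//; have := sqr_ge0 (L z - 1); nra.
    by rewrite mulrC ler_wpM2r// addr_ge0// sqr_ge0.
  have iU : P.-integrable setT (EFin \o (fun z => F x z - F (rep J (g J x)) z)).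
    exact: (integrableB measurableT (iF Tx) (iF TJ)).
  have iL2 : P.-integrable setT (EFin \o (fun z => L z ^+ 2)).
    by apply: integrable_ge0 iL => // z; exact: sqr_ge0.
  have i1 : P.-integrable setT (EFin \o (fun z : Xi => 1 : R)).
    exact: finite_measure_integrable_cst.
  have i1L : P.-integrable setT (EFin \o (fun z => 1 + L z ^+ 2)).
    exact: (integrableD measurableT i1 iL2).
  have iaL : P.-integrable setT (EFin \o (fun z => a J * (1 + L z ^+ 2))).
    exact: (integrableZl measurableT (a J) i1L).
  rewrite centeredB//.
  have e1 : `|emp_mean xi (fun z => F x z - F (rep J (g J x)) z) w| <= a J * (1 + 2 * s2).
    apply: (@le_trans _ _ (emp_mean xi (fun z => a J * (1 + L z ^+ 2)) w)); last first.
      by rewrite emp_meanZ ler_wpM2l// emp_meanD emp_mean_cst// lerD2l.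
    rewrite /emp_mean normrM ger0_norm ?invr_ge0// ler_wpM2l ?invr_ge0//.
    by apply: le_trans (ler_norm_sum _ _ _) _; exact: ler_sum.
  have e2 : `|\int[P]_z (F x z - F (rep J (g J x)) z)| <= a J * (1 + s2).
    apply: le_trans (le_normr_Rintegral measurableT iU) _.
    apply: (@le_trans _ _ (\int[P]_z (a J * (1 + L z ^+ 2)))).
      by apply: le_Rintegral => //; exact: integrable_norm.
    rewrite RintegralZl// ler_wpM2l// RintegralD// Rintegral_prob_cst lerD2l.
    by rewrite -lee_fin -EFin_Rintegral.
  have := ler_normB (emp_mean xi (fun z => F x z - F (rep J (g J x)) z) w) (\int[P]_z (F x z - F (rep J (g J x)) z)).
  by rewrite /cc; lra.
have := ler_normD (centered x w - centered (rep J (g J x)) w) (centered (rep J (g J x)) w - centered xs w).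
rewrite addrA subrK => h4.
have h5 : Num.sqrt s2 * A * Num.sqrt (6 * (9 / 2 * Lc) / N%:R) =
   Num.sqrt s2 * (3 * Num.sqrt 3 * (A * Num.sqrt Lc / Num.sqrt N%:R)).
  by rewrite sqA; ring.
rewrite h5 in h1; rewrite mulrDr; lra.
Qed.

End chaining.

(** * The sets defining the critical tolerances *)

Section check_sets.
Context {R : realType}.
Variables (eta th b eps0 : R) (gp K : R -> R) (sgm : R -> R -> R).
Hypothesis eta_gt0 : 0 < eta.
Hypothesis eps0_ge0 : 0 <= eps0.
Hypothesis gp0 : gp 0 = 0.
Hypothesis gp_lip : forall u v : R, 0 <= u -> u <= v -> v < eta ->
  gp u <= gp v /\ gp v - gp u <= (v - u) / (eta - u) * th.
Hypothesis K_ge0 : forall u : R, 0 < u -> u <= th -> 0 <= K u.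
Hypothesis K_mono : forall u v : R, 0 < u -> u <= v -> v <= th -> K u <= K v.
Hypothesis sgm_ge0 : forall u v : R, 0 <= sgm u v.
Hypothesis sgm_cont : forall u v : R, 0 <= u -> u <= th -> 0 <= v -> v <= eta ->
  forall e : R, 0 < e -> exists2 r : R, 0 < r & forall u' v' : R,
    0 <= u' -> u' <= th -> 0 <= v' -> v' <= eta -> `|u' - u| < r -> `|v' - v| < r ->
    `|sgm u' v' - sgm u v| < e.
Hypothesis b_gt0 : 0 < b.

Let wh dl ep := sgm (ep + gp dl) dl * K (ep + gp dl).

Let gp_ge0 v : 0 <= v -> v < eta -> 0 <= gp v.
Proof. by move=> v0 ve; have [h _] := gp_lip (lexx 0) v0 ve; rewrite -gp0. Qed.

(* gamma_2 and the diameter only decrease with the level, so that the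
   continuity of sigma alone makes the width upper semicontinuous from the left *)
Let wh_left dl ep c : 0 <= dl -> dl < eta -> 0 < ep -> ep + gp dl <= th ->
  wh dl ep < c -> exists2 r, 0 < r & forall dl' ep', 0 <= dl' -> dl' <= dl ->
    0 < ep' -> ep' <= ep -> dl - r < dl' -> gp dl - r < gp dl' -> ep - r < ep' ->
    wh dl' ep' < c.
Proof.
move=> dl0 dle ep0 epth whc; have g0 := gp_ge0 dl0 dle.
set t := ep + gp dl in epth *; have t0 : 0 < t by rewrite /t; lra.
have K0 : 0 <= K t by apply: K_ge0.
pose e := (c - wh dl ep) / (K t + 1).
have e0 : 0 < e by rewrite divr_gt0 ?subr_gt0//; lra.
have [r r0 hr] := sgm_cont (ltW t0) epth dl0 (ltW dle) e0.
exists (r / 2); first by lra.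
move=> dl' ep' dl'0 dl'dl ep'0 ep'ep h1 h2 h3.
set t' := ep' + gp dl'.
have [gle _] := gp_lip dl'0 dl'dl dle.
have g'0 : 0 <= gp dl' by apply: gp_ge0; lra.
have t't : t' <= t by rewrite /t /t'; lra.
have t'0 : 0 < t' by rewrite /t'; lra.
have s1 : `|sgm t' dl' - sgm t dl| < e.
  apply: hr; rewrite ?(ltW t'0) ?(le_trans t't)//; first by lra.
    by rewrite distrC ger0_norm /t /t'; lra.
  by rewrite distrC ger0_norm; lra.
have s2 : sgm t' dl' < sgm t dl + e by move: s1; rewrite ltr_distl => /andP[].
have K1 : K t' <= K t by apply: K_mono.
have K'0 : 0 <= K t' by apply: K_ge0; rewrite ?(le_trans t't).
have w1 : wh dl' ep' <= (sgm t dl + e) * K t.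
  by apply: ler_pM => //; exact: ltW.
have eK : e * (K t + 1) = c - wh dl ep by rewrite /e divfK// gt_eqF//; lra.
apply: le_lt_trans w1 _; move: eK; rewrite /wh -/t; lra.
Qed.

Variable emp : bool.

(* S_set, check_delta, check_dom and R_set with the gap, the width and the
   Hoelder modulus left abstract; emp stands for #|I| = 0. *)
Definition S_of (ep : R) : set R :=
  [set dl | [/\ 0 < dl < eta, ep + gp dl <= th & wh dl ep + b < dl]].
Definition delta_of (ep : R) : R := if emp then 0 else inf (S_of ep).
Definition dom_of : set R := [set ep | 0 < ep <= th /\ (emp \/ S_of ep !=set0)].
Definition R_of : set R := [set ep | [/\ eps0 < ep <= th, dom_of ep &
  eps0 + gp (delta_of ep) + 2 * wh (delta_of ep) ep < ep]].

Let has_infS ep : S_of ep !=set0 -> has_inf (S_of ep).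
Proof. by move=> S0; split=> //; exists 0 => d [/andP[/ltW]]. Qed.

Let infS_le ep d : S_of ep d -> inf (S_of ep) <= d.
Proof.
by move=> Sd; apply: ge_inf => //; have [] := @has_infS ep; first by exists d.
Qed.

Let S_gt_b ep d : 0 < ep -> S_of ep d -> b < d.
Proof.
move=> ep0 [/andP[d0 de] h1 h2]; apply: le_lt_trans h2.
have g0 := gp_ge0 (ltW d0) de.
by rewrite lerDr mulr_ge0//; apply: K_ge0 => //; lra.
Qed.

Let infS_bounds ep : 0 < ep -> S_of ep !=set0 ->
  [/\ b <= inf (S_of ep), inf (S_of ep) < eta & ep + gp (inf (S_of ep)) <= th].
Proof.
move=> ep0 S0.
have h1 : b <= inf (S_of ep) by apply: lb_le_inf => // d /(S_gt_b ep0)/ltW.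
have [d Sd] := S0; have [/andP[d0 de] dth _] := Sd.
have h2 := infS_le Sd.
have h3 : inf (S_of ep) < eta by apply: le_lt_trans de.
split=> //; apply: le_trans dth; rewrite lerD2l.
have D0 : 0 <= inf (S_of ep) by move: b_gt0; lra.
by have [] := gp_lip D0 h2 de.
Qed.

Let gp_close D h : 0 < D -> D < eta -> 0 < th -> 0 < h ->
  exists2 r, 0 < r & forall d, 0 <= d -> d < eta -> `|d - D| < r -> `|gp d - gp D| < h.
Proof.
move=> D0 De th0 h0; have eD : 0 < eta - D by rewrite subr_gt0.
pose q := h * (eta - D) / (th + 1).
have q0 : 0 < q by rewrite divr_gt0 ?mulr_gt0//; lra.
have qth : q / (eta - D) * th < h.
  have -> : q / (eta - D) = h / (th + 1) by rewrite /q; field; rewrite !gt_eqF//; lra.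
  by rewrite mulrAC ltr_pdivrMr; nra.
have key u v : 0 <= u -> u <= v -> v < eta -> u <= D -> v - u < q -> gp v - gp u < h.
  move=> u0 uv ve uD vuq; have [_ gl] := gp_lip u0 uv ve.
  apply: le_lt_trans gl _; apply: le_lt_trans qth.
  rewrite ler_wpM2r ?(ltW th0)//; apply: ler_pM; [lra| |exact: ltW|].
    by rewrite invr_ge0; lra.
  by rewrite lef_pV2 ?posrE; lra.
exists q => // d d0 de dD.
have [Dd|dD'] := leP D d.
  have [gl _] := gp_lip (ltW D0) Dd de.
  rewrite ger0_norm ?subr_ge0//; apply: key => //; first exact: ltW.
  by move: dD; rewrite ger0_norm; lra.
have [gl _] := gp_lip d0 (ltW dD') De.
rewrite distrC ger0_norm ?subr_ge0//; apply: key => //; [exact: ltW|exact: ltW|].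
by move: dD; rewrite distrC ger0_norm; lra.
Qed.

Let infS_close ep h : 0 < ep -> S_of ep !=set0 -> 0 < h -> exists d,
  [/\ S_of ep d, inf (S_of ep) <= d, d < inf (S_of ep) + h &
      gp d < gp (inf (S_of ep)) + h].
Proof.
move=> ep0 S0 h0; have [h1 h2 h3] := infS_bounds ep0 S0.
have D0 : 0 < inf (S_of ep) by apply: lt_le_trans h1.
have g0 := gp_ge0 (ltW D0) h2.
have th0 : 0 < th by lra.
have [r r0 hr] := gp_close D0 h2 th0 h0.
have q0 : 0 < Num.min r h by rewrite lt_min r0.
have [d Sd dD] := inf_adherent q0 (has_infS S0).
have [/andP[d0 de] _ _] := Sd.
have Dd := infS_le Sd.
exists d; split=> //.
  by apply: lt_le_trans dD _; rewrite lerD2l ge_min lexx orbT.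
have : `|gp d - gp (inf (S_of ep))| < h.
  apply: hr => //; [exact: ltW|].
  rewrite ger0_norm ?subr_ge0// ltrBlDl; apply: lt_le_trans dD _.
  by rewrite lerD2l ge_min lexx.
by rewrite ltr_distl => /andP[].
Qed.

(** If the width at the infimum D were below D - b, [wh_left] would keep it so slightly to the left
    of D and put smaller points into S. *)
Let wh_infS_ge ep : 0 < ep -> S_of ep !=set0 ->
  inf (S_of ep) - b <= wh (inf (S_of ep)) ep.
Proof.
move=> ep0 S0; have [bD De tth] := infS_bounds ep0 S0.
have hS := has_infS S0; have infle := @infS_le ep.
move: bD De tth infle; set D := inf _ => bD De tth infle.
have D0 : 0 < D by apply: lt_le_trans bD.
have g0 := gp_ge0 (ltW D0) De.
have th0 : 0 < th by lra.
rewrite leNgt; apply/negP => lt; set s := D - b - wh D ep.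
have s0 : 0 < s by rewrite /s; lra.
have whc : wh D ep < wh D ep + s / 2 by lra.
have [r r0 hr] := wh_left (ltW D0) De ep0 tth whc.
have [r' r'0 hr'] := gp_close D0 De th0 r0.
pose q := Num.min (Num.min (r / 2) (r' / 2)) (Num.min (D / 2) (s / 4)).
have q0 : 0 < q by rewrite !lt_min !divr_gt0.
have [q1 q2 q3 q4] : [/\ q <= r / 2, q <= r' / 2, q <= D / 2 & q <= s / 4].
  by split; rewrite /q !ge_min lexx ?orbT.
have d0 : 0 < D - q by lra.
have dD : D - q <= D by lra.
have [gle _] := gp_lip (ltW d0) dD De.
have gc : `|gp (D - q) - gp D| < r.
  apply: hr'; [exact: ltW|lra|].
  by rewrite addrC addKr normrN ger0_norm; lra.
have Sd : S_of ep (D - q).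
  split; [by rewrite d0/=; lra|lra|].
  have := hr (D - q) ep (ltW d0) dD ep0 (lexx _).
  move: gc; rewrite ltr_distl => /andP[gc _].
  have e1 : D - r < D - q by lra.
  have e2 : gp D - r < gp (D - q) by lra.
  have e3 : ep - r < ep by lra.
  move=> /(_ e1 e2 e3) whd; have sE : s = D - b - wh D ep by [].
  move: whd q4; rewrite sE; lra.
by have := infle _ Sd; lra.
Qed.

(** Points of S converge to D from the right, where [K] is at least its value at D; so only [sgm]
    has to converge for the bound d - b on the width to pass to the limit. *)
Let wh_infS_le ep : 0 < ep -> S_of ep !=set0 ->
  wh (inf (S_of ep)) ep <= inf (S_of ep) - b.
Proof.
move=> ep0 S0; have [bD De tth] := infS_bounds ep0 S0.
have close h := @infS_close ep h ep0 S0.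
move: bD De tth close; set D := inf _ => bD De tth close.
have D0 : 0 < D by apply: lt_le_trans bD.
have g0 := gp_ge0 (ltW D0) De.
set t := ep + gp D in tth; have t0 : 0 < t by rewrite /t; lra.
have K0 : 0 <= K t by apply: K_ge0.
rewrite leNgt; apply/negP => lt; set s := wh D ep - (D - b).
have s0 : 0 < s by rewrite /s; lra.
pose e := s / 2 / (K t + 1).
have e0 : 0 < e by rewrite divr_gt0 ?divr_gt0//; lra.
have [r r0 hr] := sgm_cont (ltW t0) tth (ltW D0) (ltW De) e0.
have q0 : 0 < Num.min r (s / 4) by rewrite lt_min r0 divr_gt0.
have [q1 q2] : Num.min r (s / 4) <= r /\ Num.min r (s / 4) <= s / 4.
  by split; rewrite !ge_min lexx ?orbT.
have [d [Sd Dd dD gd]] := close _ q0.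
have [/andP[d0 de] dth dw] := Sd.
have [gle _] := gp_lip (ltW D0) Dd de.
set t' := ep + gp d in dth.
have tt' : t <= t' by rewrite /t /t'; lra.
have t'0 : 0 < t' by apply: lt_le_trans tt'.
have s1 : `|sgm t' d - sgm t D| < e.
  apply: hr => //; [exact: ltW|exact: ltW|exact: ltW| |].
    by rewrite ger0_norm /t /t'; lra.
  by rewrite ger0_norm; lra.
have s2 : sgm t D - e < sgm t' d by move: s1; rewrite ltr_distl => /andP[].
have K1 : K t <= K t' by apply: K_mono.
have w1 : sgm t' d * K t <= wh d ep by rewrite /wh -/t' ler_wpM2l.
have w2 : (sgm t D - e) * K t <= sgm t' d * K t by rewrite ler_wpM2r// ltW.
have eK : e * (K t + 1) = s / 2 by rewrite /e divfK// gt_eqF//; lra.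
have ws : s = sgm t D * K t - (D - b) by [].
move: eK dw w1; rewrite ws; lra.
Qed.

(** The infimum D of S misses the strict inequality defining S, so a close element d replaces it.
    Its width is below d - b, and D - b is at most the width at D by [wh_infS_ge], so the inequality
    of [R_of] survives a small error. *)
Lemma R_of_slack ep h : R_of ep -> 0 < h -> exists dl,
  [/\ 0 <= dl < eta, ep + gp dl <= th, ~~ emp -> wh dl ep + b < dl,
      eps0 + gp dl + 2 * wh dl ep < ep & `|dl - delta_of ep| < h].
Proof.
move=> [/andP[ep0 epth] [/andP[ep0' _] dom] Rep] h0.
move: dom Rep; rewrite /delta_of; case: emp => [_ Rep|[//|S0] Rep].
  by exists 0; rewrite lexx eta_gt0 gp0 addr0 subrr normr0; split=> //; move: Rep; rewrite gp0 addr0.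
have ge := wh_infS_ge ep0' S0.
have [bD De tth] := infS_bounds ep0' S0.
have close h := @infS_close ep h ep0' S0.
move: bD De tth close ge Rep; set D := inf _ => bD De tth close ge Rep.
set s := ep - (eps0 + gp D + 2 * wh D ep).
have s0 : 0 < s by rewrite /s; lra.
have q0 : 0 < Num.min h (s / 4) by rewrite lt_min h0 divr_gt0.
have [q1 q2] : Num.min h (s / 4) <= h /\ Num.min h (s / 4) <= s / 4.
  by split; rewrite !ge_min lexx ?orbT.
have [d [Sd Dd dD gd]] := close _ q0.
have [/andP[d0 de] dth dw] := Sd.
exists d; split=> //; first by rewrite (ltW d0).
  by move: q2 gd dD; rewrite /s; lra.
by rewrite ger0_norm; lra.
Qed.

(** A fixed d in S at [ep] stays in S at slightly smaller levels, by [wh_left]. The infimum there is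
    at most d, so its gap is at most gp d and its width at most d - b, the latter by
    [wh_infS_le]. *)
Lemma R_of_left ep : R_of ep -> exists2 ep', R_of ep' & ep' < ep.
Proof.
have e00 := eps0_ge0.
move=> [/andP[ep0 epth] [/andP[ep0' _] dom] Rep].
have [c [d [d0 dc wc Rd]]] : exists c d, [/\ 0 <= d /\ d < eta,
    ep + gp d <= th, wh d ep < c & [/\ eps0 + gp d + 2 * c < ep,
    emp -> d = 0 & ~~ emp -> S_of ep d /\ c = d - b]].
  move: dom Rep; rewrite /delta_of; case: emp => [_ Rep|[//|S0] Rep].
    exists (wh 0 ep + (ep - (eps0 + gp 0 + 2 * wh 0 ep)) / 4), 0; split => //.
    - by rewrite gp0 addr0.
    - lra.
    - by split=> //; lra.
  have ge := wh_infS_ge ep0' S0.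
  have [bD De tth] := infS_bounds ep0' S0.
  have close h := @infS_close ep h ep0' S0.
  move: bD De tth close ge Rep; set D := inf _ => bD De tth close ge Rep.
  set s := ep - (eps0 + gp D + 2 * wh D ep).
  have s0 : 0 < s by rewrite /s; lra.
  have q0 : 0 < s / 4 by rewrite divr_gt0.
  have [d [Sd Dd dD gd]] := close _ q0.
  have [/andP[d0 de] dth dw] := Sd.
  exists (d - b), d; split=> //; [by split=> //; exact: ltW|lra|split=> //].
  by move: gd dD; rewrite /s; lra.
have [Rc demp dS] := Rd.
have [r r0 hr] : exists2 r, 0 < r & forall ep', 0 < ep' -> ep' <= ep -> ep - r < ep' ->
    wh d ep' < c.
  have [d00 de] := d0.
  have [r r0 hr] := wh_left d00 de ep0' dc wc.
  exists r => // ep' h1 h2 h3; apply: hr => //; lra.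
pose s := ep - (eps0 + gp d + 2 * c).
have s0 : 0 < s by rewrite /s; lra.
pose q := Num.min (Num.min (r / 2) (s / 2)) ((ep - eps0) / 2).
have q0 : 0 < q by rewrite !lt_min !divr_gt0//; lra.
have [q1 q2 q3] : [/\ q <= r / 2, q <= s / 2 & q <= (ep - eps0) / 2].
  by split; rewrite /q !ge_min lexx ?orbT.
have w' : wh d (ep - q) < c by apply: hr; lra.
have ep'0 : 0 < ep - q by lra.
exists (ep - q); last by lra.
have epI : eps0 < ep - q <= th by apply/andP; split; lra.
have epI' : 0 < ep - q <= th by apply/andP; split; lra.
split=> //.
  split=> //; case E : emp; [by left|right].
  have [[/andP[h1 h2] h3 h4] cE] := dS (negbT E).
  by exists d; split; [rewrite h1|lra|lra].
rewrite /delta_of; case E : emp.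
  have d_0 := demp E; move: q2 w' s0 Rc; rewrite /s d_0 => *; lra.
have [[/andP[h1 h2] h3 h4] cE] := dS (negbT E).
have Sd' : S_of (ep - q) d by split; [rewrite h1|lra|lra].
have S'0 : S_of (ep - q) !=set0 by exists d.
have [bD' _ _] := infS_bounds ep'0 S'0.
have le' := wh_infS_le ep'0 S'0.
have D'd := infS_le Sd'.
have D'0 : 0 <= inf (S_of (ep - q)) by move: b_gt0; lra.
have [gle _] := gp_lip D'0 D'd h2.
by move: q2; rewrite /s; lra.
Qed.

End check_sets.

(** * Convex geometry of the perturbed problems *)

Section convex_sets.
Context {R : realType} {d : nat}.
Implicit Types (Y : set 'rV[R]_d) (g : 'rV[R]_d -> R).

Definition comb (s : R) (x y : 'rV[R]_d) : 'rV[R]_d := s *: x + (1 - s) *: y.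

Lemma comb_in Y s x y : @convex_set R 'rV[R]_d Y -> 0 <= s <= 1 ->
  Y x -> Y y -> Y (comb s x y).
Proof.
move=> cY /andP[s0 s1] Yx Yy.
have := cY x y (Itv01 s0 s1); rewrite !inE => /(_ Yx Yy).
by rewrite /conv /=.
Qed.

Lemma comb_le Y g s x y : @convex_function R 'rV[R]_d Y g -> 0 <= s <= 1 ->
  Y x -> Y y -> g (comb s x y) <= s * g x + (1 - s) * g y.
Proof.
move=> cg /andP[s0 s1] Yx Yy.
have := cg (Itv01 s0 s1) x y; rewrite !inE => /(_ Yx Yy).
by rewrite /conv /=.
Qed.

Lemma comb_le_le Y g s x y a b : @convex_function R 'rV[R]_d Y g ->
  0 <= s <= 1 -> Y x -> Y y -> g x <= a -> g y <= b ->
  g (comb s x y) <= s * a + (1 - s) * b.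
Proof.
move=> cg s01 Yx Yy ga gb; apply: le_trans (comb_le cg s01 Yx Yy) _.
by case/andP: s01 => s0 s1; rewrite lerD// ler_wpM2l// subr_ge0.
Qed.

Lemma closed_sublevel Y g c : closed Y -> {within Y, continuous g} ->
  closed [set x | Y x /\ g x <= c].
Proof.
move=> cY cg; have -> : [set x | Y x /\ g x <= c] = Y `&` g @^-1` [set r | r <= c].
  by [].
have := (continuous_closedP (g : subspace Y -> R)).1 cg _ (@closed_le R c).
by rewrite -(closed_setSI _ cY).
Qed.

(** Each step covers the fixed fraction [s] of what remains to x, so points of A tend to x.
    Convexity in [saa_localization] delivers steps of this proportional kind. *)
Lemma segment_closed (A : set 'rV[R]_d) (s : R) x y :
  closed A -> 0 < s <= 1 -> A y ->
  (forall u, 0 <= u <= 1 -> A (comb u x y) -> A (comb s x (comb u x y))) ->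
  A x.
Proof.
move=> cA /andP[s0 s1] Ay step.
(* the iterates of [comb s x] from y *)
pose z n := comb (1 - (1 - s) ^+ n) x y.
have u01 n : 0 <= 1 - (1 - s) ^+ n <= 1.
  have h : 0 <= (1 - s) ^+ n by rewrite exprn_ge0// subr_ge0.
  have h' : (1 - s) ^+ n <= 1 by rewrite exprn_ile1// ?subr_ge0// gerBl ltW.
  by rewrite subr_ge0 h' gerBl h.
have Az n : A (z n).
  elim: n => [|n ih]; first by rewrite /z /comb expr0 subrr scale0r add0r subr0 scale1r.
  have := step _ (u01 n) ih.
  rewrite (_ : comb s x _ = z n.+1)// /z /comb scalerDr !scalerA addrA -scalerDl.
  by congr (_ *: _ + _ *: _); rewrite exprS; ring.
have zx : z n @[n --> \oo] --> x.
  have e : (fun n : nat => (1 - s) ^+ n) @ \oo --> (0 : R).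
    by apply: cvg_expr; rewrite ger0_norm ?subr_ge0// gtrBl.
  have e1 : (1 - (1 - s) ^+ n) *: x @[n --> \oo] --> (1 - 0) *: x.
    apply: cvgZr_tmp.
    by apply: cvgB => //; exact: cvg_cst.
  have e2 : (1 - (1 - (1 - s) ^+ n)) *: y @[n --> \oo] --> (1 - (1 - 0)) *: y.
    apply: cvgZr_tmp.
    by apply: cvgB; [exact: cvg_cst|apply: cvgB => //; exact: cvg_cst].
  have e3 : z n @[n --> \oo] --> (1 - 0) *: x + (1 - (1 - 0)) *: y by exact: cvgD e1 e2.
  by move: e3; rewrite !subr0 subrr scale1r scale0r addr0.
by apply: (@closed_cvg _ _ \oo _ z A cA _ x zx); apply: nearW.
Qed.

End convex_sets.

Section convex_program.
Context {R : realType} {d : nat} {dX : measure_display} {I : finType}.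
Context {Xi : measurableType dX}.
Variables (P : probability Xi R).
Variables (Y : set 'rV[R]_d) (F : option I -> 'rV[R]_d -> Xi -> R).
Variables (xstar : 'rV[R]_d) (eta th : R).
Hypothesis xstarP : minimizer P Y F xstar.
Hypothesis slater : LSCQ P Y F eta th.

Local Notation f := (fmean P F).
Local Notation feas := (feasible P Y F).
Local Notation near := (near_opt P Y F).
Local Notation v := (fopt P Y F).
Local Notation gp a := (gap P Y F (- a)).

Let cvx := lscq_convex slater.

Lemma feasibleS a b : a <= b -> feas a `<=` feas b.
Proof. by move=> ab x [Yx fx]; split=> // i; exact: le_trans (fx i) ab. Qed.

Lemma near_optS a b r s : a <= b -> r <= s -> near a r `<=` near b s.
Proof.
move=> ab rs x [fx hx]; split; first exact: feasibleS fx.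
by rewrite (le_trans hx)// lerD2l.
Qed.

Lemma feasible_comb s a b c x y : 0 <= s <= 1 -> feas a x -> feas b y ->
  s * a + (1 - s) * b <= c -> feas c (comb s x y).
Proof.
move=> s01 [Yx fx] [Yy fy] abc; split.
  exact: comb_in (lscq_convex_dom slater) s01 Yx Yy.
by move=> i; apply: le_trans (comb_le_le (cvx (Some i)) s01 Yx Yy (fx i) (fy i)) abc.
Qed.

Lemma near_opt_comb s a b c r r' r'' x y : 0 <= s <= 1 ->
  near a r x -> near b r' y -> s * a + (1 - s) * b <= c ->
  s * r + (1 - s) * r' <= r'' -> near c r'' (comb s x y).
Proof.
move=> s01 [fx hx] [fy hy] abc rr; split; first exact: feasible_comb s01 fx fy abc.
apply: le_trans (comb_le_le (cvx None) s01 fx.1 fy.1 hx hy) _.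
by rewrite [leLHS](_ : _ = v 0 + (s * r + (1 - s) * r')) ?lerD2l//; ring.
Qed.

Lemma closed_near_opt a r : closed (near a r).
Proof.
have -> : near a r = \bigcap_(i in [set: option I])
    [set x | Y x /\ f i x <= if i is Some _ then a else v 0 + r].
  apply/seteqP; split=> x /=.
    by move=> [[Yx fx] hx] [i|] _ /=; split.
  move=> h; split; last exact: (h None Logic.I).2.
  by split; [exact: (h None Logic.I).1|move=> i; exact: (h (Some i) Logic.I).2].
apply: closed_bigI => i _.
apply: closed_sublevel; first exact: lscq_closed_dom slater.
by move=> x; exact: (lscq_continuous slater).
Qed.

Lemma bounded_near_opt a r : a <= 0 -> r <= th -> bounded_set (near a r).
Proof.
move=> a0 rth; have [M [Mr hM]] := lscq_bounded slater.
by exists M; split=> // y My x nx; apply: hM My _ _; exact: near_optS nx.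
Qed.

Lemma compact_near_opt a r : a <= 0 -> r <= th -> compact (near a r).
Proof.
by move=> a0 rth; apply: bounded_closed_compact;
  [exact: bounded_near_opt|exact: closed_near_opt].
Qed.

Lemma fopt0 : v 0 = f None xstar.
Proof.
have [xf xm] := xstarP; apply/eqP; rewrite eq_le; apply/andP; split.
  apply: ge_inf; last by exists xstar.
  by exists (f None xstar) => _ [x xx <-]; exact: xm.
apply: lb_le_inf; first by exists (f None xstar), xstar.
by move=> _ [x xx <-]; exact: xm.
Qed.

Lemma near_opt_xstar a r : 0 <= a -> 0 <= r -> near a r xstar.
Proof.
move=> a0 r0; split; first by apply: feasibleS a0 _ _; case: xstarP.
by rewrite fopt0 lerDl.
Qed.

Lemma fopt0_le x : feas 0 x -> v 0 <= f None x.
Proof. by rewrite fopt0; exact: xstarP.2. Qed.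

(** The infimum is meaningful once f is bounded below on [feas a], also for a > 0. The combination
    of z and the Slater point with weight eta / (eta + a') on z is feasible at level 0, so its value
    is at least v 0, and convexity turns this into a lower bound at z. *)
Lemma fopt_le a x : feas a x -> v a <= f None x.
Proof.
move=> fx; apply: ge_inf; last by exists x.
have eta0 := lscq_eta_gt0 slater; have [xs [xsf xsh]] := lscq_slater slater.
pose a' := Num.max a 0; have a'0 : 0 <= a' by rewrite le_max lexx orbT.
have aa' : a <= a' by rewrite le_max lexx.
pose s := eta / (eta + a').
have ea0 : 0 < eta + a' by rewrite ltr_wpDr.
have s0 : 0 < s by rewrite divr_gt0.
have s1 : s <= 1 by rewrite ler_pdivrMr// mul1r lerDl.
exists ((v 0 - (1 - s) * (v 0 + th)) / s) => _ [z zf <-].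
rewrite ler_pdivrMr// lerBlDr mulrC.
have zf' := feasibleS aa' zf.
have s01 : 0 <= s <= 1 by rewrite ltW.
have : feas 0 (comb s z xs).
  apply: feasible_comb s01 zf' xsf _.
  by rewrite le_eqVlt; apply/orP; left; apply/eqP; rewrite /s; field; rewrite gt_eqF.
move=> /fopt0_le/le_trans; apply.
exact: comb_le_le (cvx None) s01 zf.1 xsf.1 (lexx _) xsh.
Qed.

(** The Slater point has level at most [th], so it suffices to minimize over the compact set
    [near (- a) th]. *)
Lemma fopt_attained a : 0 <= a <= eta ->
  exists2 y, feas (- a) y & f None y = v (- a).
Proof.
move=> /andP[a0 aeta].
have [xs xsP] := lscq_slater slater.
have [|||y] := @compact_EVT_min _ _ (f None) (near (- a) th).
- by exists xs; apply: near_optS xsP => //; rewrite lerN2.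
- by apply: compact_near_opt; rewrite ?oppr_le0.
- apply: (@continuous_subspaceW _ _ _ Y) => [x [[]]//|x].
  exact: (lscq_continuous slater).
rewrite inE => -[yf yh] ymin; exists y => //.
apply/eqP; rewrite eq_le fopt_le// andbT.
apply: lb_le_inf; first by exists (f None y), y.
move=> _ [x xf <-]; have [xh|/ltW xh] := leP (f None x) (v 0 + th).
  by apply: ymin; rewrite inE.
exact: le_trans yh xh.
Qed.

Lemma fopt_opp_bounds a : 0 <= a <= eta -> v 0 <= v (- a) <= v 0 + th.
Proof.
move=> a0e; have /andP[a0 aeta] := a0e; apply/andP; split.
  have [y yf <-] := fopt_attained a0e.
  by apply: fopt0_le; apply: feasibleS yf; rewrite oppr_le0.
have [xs [xsf xsh]] := lscq_slater slater.
by apply: le_trans xsh; apply: fopt_le; apply: feasibleS xsf; rewrite lerN2.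
Qed.

Lemma gap_opp a : 0 <= a <= eta -> gp a = v (- a) - v 0.
Proof.
by move=> /fopt_opp_bounds/andP[h _]; rewrite /gap ger0_norm// subr_ge0.
Qed.

Lemma gap0 : gp 0 = 0.
Proof. by rewrite /gap oppr0 subrr normr0. Qed.

(** Moving a minimizer for -a by the fraction (b - a) / (eta - a) toward the Slater point makes it
    feasible at -b and raises its value by at most that fraction of [th]. *)
Lemma gap_lipschitz a b : 0 <= a -> a <= b -> b < eta ->
  gp a <= gp b /\ gp b - gp a <= (b - a) / (eta - a) * th.
Proof.
move=> a0 ab be; have ae := le_lt_trans ab be.
have a0e : 0 <= a <= eta by rewrite a0 ltW.
have b0e : 0 <= b <= eta by rewrite (le_trans a0 ab) ltW.
rewrite !gap_opp//.
have [ya yaf yae] := fopt_attained a0e.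
have [yb ybf ybe] := fopt_attained b0e.
split.
  rewrite lerD2r -ybe; apply: fopt_le; apply: feasibleS ybf.
  by rewrite lerN2.
have [xs [xsf xsh]] := lscq_slater slater.
pose s := (b - a) / (eta - a).
have ea0 : 0 < eta - a by rewrite subr_gt0.
have s0 : 0 <= s by rewrite divr_ge0 ?subr_ge0// ltW.
have s1 : s <= 1 by rewrite ler_pdivrMr// mul1r lerD2r ltW.
have s01 : 0 <= s <= 1 by rewrite s0.
have : feas (- b) (comb s xs ya).
  apply: feasible_comb s01 xsf yaf _.
  by rewrite le_eqVlt; apply/orP; left; apply/eqP; rewrite /s; field; rewrite gt_eqF.
move=> /fopt_le h.
have h2 := comb_le_le (cvx None) s01 xsf.1 yaf.1 xsh (lexx _).
have /andP[h3 _] := fopt_opp_bounds a0e.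
have := le_trans h h2; rewrite yae -/s => h4.
have h5 : s * v 0 <= s * v (- a) by rewrite ler_wpM2l.
have h6 : s * (v 0 + th) + (1 - s) * v (- a) = s * v 0 + s * th + v (- a) - s * v (- a) by ring.
by move: h4; rewrite h6 => h4; lra.
Qed.

End convex_program.

(** * Limits of near-optimal sets and distances to the feasible set *)

Section program_limits.
Context {R : realType} {d : nat} {dX : measure_display} {I : finType}.
Context {Xi : measurableType dX}.
Variables (nrm : 'rV[R]_d -> R) (P : probability Xi R).
Variables (Y : set 'rV[R]_d) (F : option I -> 'rV[R]_d -> Xi -> R).
Variables (eta th : R).
Hypothesis nrmP : is_norm nrm.
Hypothesis slater : LSCQ P Y F eta th.

Local Notation f := (fmean P F).
Local Notation feas := (feasible P Y F).
Local Notation near := (near_opt P Y F).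
Local Notation v := (fopt P Y F).

Lemma within_continuous_max0 (A : set 'rV[R]_d) (g : 'rV[R]_d -> R) (c : R) :
  {within A, continuous g} -> {within A, continuous (fun x => Num.max 0 (g x - c))}.
Proof.
move=> cg x; apply: (@continuous_max R (subspace A) (cst 0) (fun x => g x - c) x).
  exact: cvg_cst.
by apply: (@cvgB _ R^o (subspace A)); [exact: cg|exact: cvg_cst].
Qed.

(** A penalty vanishing on Y exactly at the points of [near a r]: one continuous function replaces
    |I| + 1 inequalities in compactness and measurability arguments. *)
Definition excess (a r : R) (x : 'rV[R]_d) : R :=
  \sum_i Num.max 0 (f i x - if i is Some _ then a else v 0 + r).

Lemma excess_continuous a r : {within Y, continuous (excess a r)}.
Proof.
apply: (@continuous_big R (option I) +%R 0 xpredT _ (subspace Y)) => [|i _].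
  by move=> z; exact: (@pseudometric_normed_Zmodule.add_continuous R R z).
by apply: within_continuous_max0 => z; exact: (lscq_continuous slater).
Qed.

Lemma excess_le0 a r x : Y x -> (excess a r x <= 0) <-> near a r x.
Proof.
move=> Yx; split=> [h|[fx hx]].
  have e0 : excess a r x = 0.
    by apply/eqP; rewrite eq_le h /excess sumr_ge0// => i _; rewrite le_max lexx.
  have hi i : f i x <= if i is Some _ then a else v 0 + r.
    have : Num.max 0 (f i x - if i is Some _ then a else v 0 + r) = 0.
      move/eqP: e0; rewrite /excess psumr_eq0 => [/allP/(_ i)|j _]; last by rewrite le_max lexx.
      by rewrite mem_index_enum => /(_ isT)/eqP.
    by move=> /eqP; rewrite eq_maxl => h'; rewrite -subr_le0.
  by split; [split=> // i; exact: (hi (Some i))|exact: (hi None)].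
rewrite /excess big1// => -[i|] _; apply/eqP; rewrite eq_maxl subr_le0//.
exact: fx.2.
Qed.

(** A minimizer of [excess] over the compact set [near 0 th] is the point sought: an approximant
    with h = e / (|I| + 1) shows that the minimum is at most e. *)
Lemma near_opt_limit a r : r <= th -> 
  (forall h, 0 < h -> exists x, [/\ near 0 th x & near (a + h) (r + h) x]) ->
  exists x, near a r x.
Proof.
move=> rth app.
have K0 : near 0 th !=set0 by have [x [? _]] := app 1 ltr01; exists x.
have cE : {within near 0 th, continuous (excess a r)}.
  by apply: continuous_subspaceW (@excess_continuous a r); move=> x [[]].
have [x] := compact_EVT_min K0 (compact_near_opt slater (lexx 0) (lexx th)) cE.
rewrite inE => xK xmin; exists x; apply/excess_le0; first by case: xK => -[].
apply/ler_addgt0Pl => e e0; rewrite addr0.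
pose h := e / (#|I|.+1)%:R; have h0 : 0 < h by rewrite divr_gt0.
have [z [zK [zf zh]]] := app h h0.
have := xmin z; rewrite inE => /(_ zK)/le_trans; apply.
have -> : e = \sum_(i : option I) h.
  by rewrite sumr_const card_option -mulr_natr /h divfK// pnatr_eq0.
apply: ler_sum => i _; rewrite ge_max ltW//=.
case: i => [i|]; rewrite lerBlDl; first exact: zf.2.
by rewrite -addrA.
Qed.

Lemma dist_to_le x y A : A y -> dist_to nrm x A <= ndist nrm x y.
Proof.
move=> Ay; apply: ge_inf; last by exists y.
by exists 0 => _ [z _ <-]; exact: ndist_ge0.
Qed.

(** The Slater slack eta compensates the violation a at the point u of the segment from x to the
    Slater point xs with x - u = (a / eta) (u - xs); both u and xs lie in [near 0 th]. *)
Lemma dist_feasible_slater a r x : 0 <= a -> r <= th -> near a r x ->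
  dist_to nrm x (feas 0) <= diam nrm (near 0 th) * a / eta.
Proof.
move=> a0 rth nx; have eta0 := lscq_eta_gt0 slater.
have [xs xsP] := lscq_slater slater.
pose s := eta / (eta + a).
have ea0 : 0 < eta + a by rewrite ltr_wpDr.
have s0 : 0 < s by rewrite divr_gt0.
have s1 : s <= 1 by rewrite ler_pdivrMr// mul1r lerDl.
have s01 : 0 <= s <= 1 by rewrite ltW.
have nu : near 0 th (comb s x xs).
  apply: (near_opt_comb slater s01 nx xsP).
    by rewrite le_eqVlt; apply/orP; left; apply/eqP; rewrite /s; field; rewrite gt_eqF.
  by have : s * r <= s * th; [rewrite ler_wpM2l// ltW|lra].
apply: le_trans (dist_to_le x nu.1) _.
have -> : ndist nrm x (comb s x xs) = a / eta * ndist nrm (comb s x xs) xs.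
  rewrite /ndist -[X in X * _]ger0_norm ?divr_ge0 ?(ltW eta0)// -(norm_homogeneous nrmP).
  congr nrm; rewrite /comb; apply/rowP => i; rewrite !mxE /s; field.
  by rewrite !gt_eqF.
rewrite mulrC -[leRHS]mulrA ler_wpM2r ?divr_ge0 ?(ltW eta0)//.
apply: (le_diam nrmP) => //; first exact: (bounded_near_opt slater).
by apply: near_optS xsP => //; rewrite oppr_le0 ltW.
Qed.

(** The midpoint of x, with violation a, and y, with slack a, is feasible; it is as far from x as
    from y, and both it and y lie in [near 0 r]. *)
Lemma dist_feasible_mid a r x y : 0 <= r -> r <= th -> 0 <= a ->
  near a r x -> near (- a) r y ->
  dist_to nrm x (feas 0) <= 2 * diam nrm (near 0 r).
Proof.
move=> r0 rth a0 nx ny.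
have bd : bounded_set (near 0 r) by exact: (bounded_near_opt slater).
have h01 : 0 <= (2^-1 : R) <= 1 by lra.
have nu : near 0 r (comb 2^-1 x y).
  by apply: (near_opt_comb slater h01 nx ny); lra.
have ny0 : near 0 r y by apply: near_optS ny; rewrite ?oppr_le0.
apply: le_trans (dist_to_le x nu.1) _.
have -> : ndist nrm x (comb 2^-1 x y) = ndist nrm (comb 2^-1 x y) y.
  rewrite /ndist /comb; congr nrm; apply/rowP => i; rewrite !mxE; lra.
apply: le_trans (le_diam nrmP bd nu ny0) _.
by rewrite ler_peMl ?(diam_ge0 nrmP)//; [exists y|lra].
Qed.

End program_limits.

Lemma card_neq0 (I : finType) (i : I) : #|I| != 0%N.
Proof. by rewrite -lt0n; apply/card_gt0P; exists i. Qed.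

(** * Localization of the SAA solutions *)

Section localization.
Context {R : realType} {d : nat} {dX dO : measure_display} {I : finType}.
Context {Xi : measurableType dX} {Omega : measurableType dO}.
Variables (P : probability Xi R) (Pr : probability Omega R).
Variables (N : nat) (xi : 'I_N -> {RV Pr >-> Xi}).
Variables (Y : set 'rV[R]_d) (F : option I -> 'rV[R]_d -> Xi -> R).
Variables (xstar : 'rV[R]_d) (eta th : R).
Hypothesis xstarP : minimizer P Y F xstar.
Hypothesis slater : LSCQ P Y F eta th.
Hypothesis solvable : forall w, saa_solvable xi Y F w.
Hypothesis convexF : forall i z, @convex_function R 'rV[R]_d Y (F i ^~ z).

Local Notation f := (fmean P F).
Local Notation Fh := (Fhat xi F).
Local Notation feas := (feasible P Y F).
Local Notation near := (near_opt P Y F).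
Local Notation v := (fopt P Y F).
Local Notation vh := (saa_opt xi Y F).
Local Notation gp a := (gap P Y F (- a)).

Lemma Fhat_comb_le i w s x y a b : 0 <= s <= 1 -> Y x -> Y y ->
  Fh i x w <= a -> Fh i y w <= b -> Fh i (comb s x y) w <= s * a + (1 - s) * b.
Proof.
move=> s01 Yx Yy xa yb; have /andP[s0 s1] := s01.
apply: (@le_trans _ _ (s * Fh i x w + (1 - s) * Fh i y w)); last first.
  by rewrite lerD// ler_wpM2l// subr_ge0.
rewrite /Fhat -!emp_meanZ -emp_meanD.
by apply: le_emp_mean => k; exact: (comb_le (convexF i _)).
Qed.

Lemma saa_opt_le w x : saa_feasible xi Y F w x -> vh w <= Fh None x w.
Proof.
move=> fx; apply: ge_inf; last by exists x.
have [y yf ym] := solvable w; exists (Fh None y w) => _ [z zf <-]; exact: ym.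
Qed.

Lemma saa_opt_attained w :
  exists2 x, saa_feasible xi Y F w x & Fh None x w = vh w.
Proof.
have [x xf xm] := solvable w; exists x => //.
apply/eqP; rewrite eq_le saa_opt_le// andbT.
apply: lb_le_inf; first by exists (Fh None x w), x.
by move=> _ [y yf <-]; exact: xm.
Qed.

(* The segment from y to an SAA near-optimal point stays SAA near-optimal.
   Wherever it lies in near_opt del ep, the deviation bound makes the
   inequalities defining near_opt del ep strict, with a uniform slack, so by
   convexity the segment never leaves that set. *)
Lemma saa_localization (w : Omega) (eps0 del ep b w' : R) y : 0 <= eps0 ->
  0 <= w' -> 0 <= del <= eta -> feas (- del) y -> f None y = v (- del) ->
  (forall i, `|Fh i xstar w - f i xstar| <= b) ->
  (forall i x, near del ep x ->
     `|(Fh i x w - f i x) - (Fh i xstar w - f i xstar)| <= w') ->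
  (#|I| != 0%N -> w' + b < del) -> eps0 + gp del + 2 * w' < ep ->
  [/\ saa_feasible xi Y F w y,
      saa_near_opt xi Y F eps0 w `<=` near del ep,
      vh w - v 0 <= gp del + b + w'
    & forall x, near del ep x -> f None x <= Fh None x w + b + w'].
Proof.
move=> e0 w'0 de yf yv hb hw sl1 sl2; have /andP[d0 de1] := de.
have gE := gap_opp xstarP slater de.
have g0 : 0 <= gp del by exact: normr_ge0.
have hT i x : near del ep x -> `|Fh i x w - f i x| <= b + w'.
  move=> Tx; have := hw i x Tx; have := hb i.
  by rewrite !ler_norml => /andP[? ?] /andP[? ?]; apply/andP; split; lra.
have Ty : near del ep y.
  split; first by apply: feasibleS yf; lra.
  by rewrite yv; lra.
have yS : saa_feasible xi Y F w y.
  split=> [|i]; first by case: yf.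
  have := hT (Some i) y Ty; rewrite ler_norml => /andP[_ h].
  by have := yf.2 i; have := sl1 (card_neq0 i); lra.
have hy := hT None y Ty; rewrite ler_norml in hy; case/andP: hy => hy1 hy2.
have vy := saa_opt_le yS.
split=> //.
(* The uniform slack: the smaller of those in the constraints and the objective, or the latter alone
   when there is no constraint. *)
- have [kap [kap0 kapI kapO]] : exists kap : R, [/\ 0 < kap,
      #|I| != 0%N -> kap <= del - w' - b & kap <= ep - eps0 - gp del - 2 * w'].
    case: (pickP (predT : pred I)) => [i _|noI]; last first.
      exists (ep - eps0 - gp del - 2 * w'); split=> //; first lra.
      by rewrite -lt0n => /card_gt0P[i]; have := noI i.
    exists (Num.min (del - w' - b) (ep - eps0 - gp del - 2 * w')).
    rewrite lt_min; split=> [|_|]; rewrite ?ge_min ?lexx ?orbT//.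
    by have := sl1 (card_neq0 i); move=> h; apply/andP; split; lra.
  move=> x [xS xO]; pose c (i : option I) := if i is Some _ then del else v 0 + ep.
  (* [M] bounds every f i x - c i + kap, so a step toward x by the fraction kap / M, from a point
     with slack kap, stays within the limits [c i]. *)
  pose M := kap + \sum_i (`|f i x| + `|c i|).
  have M0 : kap <= M by rewrite lerDl sumr_ge0// => i _; rewrite addr_ge0.
  have M1 i : f i x - c i + kap <= M.
    rewrite addrC lerD2l (bigD1 i)//= -[leLHS]addr0 lerD//.
      by rewrite lerD// ?ler_norm// -normrN ler_norm.
    by rewrite sumr_ge0// => j _; rewrite addr_ge0.
  have M2 : 0 < M := lt_le_trans kap0 M0.
  pose s := kap / M.
  have s0 : 0 < s by rewrite divr_gt0.
  have s1 : s <= 1 by rewrite ler_pdivrMr// mul1r.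
  have sM : s * M = kap by rewrite divfK// gt_eqF.
  have s01 : 0 <= s <= 1 by rewrite ltW.
  have s01' : 0 < s <= 1 by rewrite s0.
  apply: (segment_closed _ s01' Ty); first exact: (closed_near_opt slater).
  move=> u u01 Tz; set z := comb u x y in Tz *.
  have /andP[u0 u1] := u01.
  have Yz : Y z by case: Tz => -[].
  have hz i : f i z <= c i - kap.
    case: i => [i|].
      have h : Fh (Some i) z w <= u * 0 + (1 - u) * 0.
        by apply: Fhat_comb_le => //; [case: xS|case: yS|exact: xS.2|exact: yS.2].
      have := hT (Some i) z Tz; rewrite ler_norml => /andP[h1 _].
      by have := kapI (card_neq0 i); rewrite /c; lra.
    (* In the objective, z is compared with y: the errors at [xstar] cancel, and only 2 w' enters,
       without b. *)
    have h : Fh None z w <= u * (vh w + eps0) + (1 - u) * Fh None y w.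
      by apply: Fhat_comb_le => //; [case: xS|case: yS].
    have h1 : u * (vh w) <= u * Fh None y w by rewrite ler_wpM2l.
    have h2 : u * eps0 <= 1 * eps0 by rewrite ler_wpM2r.
    have h3 : Fh None z w <= Fh None y w + eps0 by lra.
    have := hw None z Tz; rewrite ler_norml => /andP[h4 _].
    have := hw None y Ty; rewrite ler_norml => /andP[_ h5].
    by rewrite /c; lra.
  have hc i : f i (comb s x z) <= c i.
    have h := comb_le_le (lscq_convex slater i) s01 xS.1 Yz (lexx _) (hz i).
    apply: le_trans h _.
    have : s * (f i x - c i + kap) <= s * M by rewrite ler_wpM2l// ltW.
    by rewrite sM; lra.
  split; last exact: (hc None).
  split; last by move=> i; exact: (hc (Some i)).
  exact: comb_in (lscq_convex_dom slater) s01 xS.1 Yz.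
- by lra.
- move=> x Tx; have := hT None x Tx; rewrite ler_norml => /andP[? _]; lra.
Qed.

End localization.

(** * Measurability of the good event *)

Section row_vectors.
Context {R : realType} {d : nat}.
Implicit Types (Y K : set 'rV[R]_d) (g : 'rV[R]_d -> R).

Lemma norm_le_coord (x : 'rV[R]_d) (b : R) :
  0 <= b -> (forall i, `|x 0 i| <= b) -> `|x| <= b.
Proof.
move=> b0 h; rewrite [leLHS]/Num.norm /= mx_normrE; apply/bigmax_leP; split=> // -[i j] _ /=.
by rewrite (ord1 i).
Qed.

Lemma within_continuous_dist Y g x (e : R) : {within Y, continuous g} -> Y x ->
  0 < e -> exists2 r, 0 < r & forall y, Y y -> `|x - y| < r -> `|g x - g y| < e.
Proof.
move=> /subspace_continuousP cg Yx e0; have /cvgrPdist_lt/(_ e e0) := cg x Yx.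
move=> /nbhs_normP[r /= r0 h].
by exists r => // y Yy xy; exact: h.
Qed.

(** One point of K is picked in each grid cell of mesh 1 / (n + 1) that meets K; pairs of a scale
    and a cell are countable. *)
Lemma dense_sequence K : exists2 D : nat -> 'rV[R]_d,
  forall n, K !=set0 -> K (D n) & forall x (e : R), K x -> 0 < e ->
    exists n, `|x - D n| < e.
Proof.
case: (pselect (K !=set0)) => [[x0 Kx0]|nK]; last first.
  exists (fun=> 0) => [n|x e Kx] //; by case: nK; exists x.
pose cell n (x : 'rV[R]_d) : {ffun 'I_d -> int} := [ffun i => Num.floor (n.+1%:R * x 0 i)].
pose pt (q : nat * {ffun 'I_d -> int}) := xget x0 [set x | K x /\ cell q.1 x = q.2].
pose D k := if unpickle k is Some q then pt q else x0.
have Kpt q : K (pt q) by rewrite /pt; case: xgetP => [x _ []|].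
exists D => [n _|x e Kx e0]; first by rewrite /D; case: unpickle.
pose n := Num.truncn (e^-1).
exists (pickle (n, cell n x)); rewrite /D pickleK.
have : [set y | K y /\ cell n y = cell n x] (pt (n, cell n x)).
  by rewrite /pt; case: xgetP => [//|/(_ x)[]].
move: (pt _) => y [Ky cy].
have n0 : 0 < n.+1%:R :> R by [].
have ne : n.+1%:R^-1 < e.
  by rewrite invf_plt ?posrE// truncnS_gt.
apply: le_lt_trans ne; apply: norm_le_coord => [|i]; first by rewrite invr_ge0.
have := congr1 (fun c : {ffun 'I_d -> int} => c i) cy; rewrite /cell !ffunE => fE.
have := floor_itv (n.+1%:R * x 0 i); have := floor_itv (n.+1%:R * y 0 i).
rewrite fE intrD => /andP[a1 a2] /andP[b1 b2].
rewrite -[leRHS]mul1r ler_pdivlMr// mulrC -(ger0_norm (ltW n0)) -normrM !mxE.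
rewrite mulrBr ler_norml; apply/andP; split; lra.
Qed.

Lemma compact_slice Y g (m : nat) c : closed Y -> {within Y, continuous g} ->
  compact [set x | [/\ Y x, `|x| <= m%:R & c <= g x]].
Proof.
move=> cY cg; apply: bounded_closed_compact.
  exists m%:R; split; first exact: num_real.
  by move=> M mM x [_ xm _]; exact: le_trans xm (ltW mM).
have -> : [set x | [/\ Y x, `|x| <= m%:R & c <= g x]] =
    [set x | Y x /\ (fun x => `|x|) x <= m%:R] `&` [set x | Y x /\ (fun x => - g x) x <= - c].
  apply/seteqP; split=> x /=; first by move=> [? ? ?]; rewrite lerN2.
  by move=> [[? ?] [_]]; rewrite lerN2.
apply: closedI; apply: closed_sublevel => //.
  by apply: continuous_subspaceT => x; exact: norm_continuous.
by move=> x; apply: (@cvgN _ R^o); exact: cg.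
Qed.

End row_vectors.

Section random_sublevel.
Context {R : realType} {d : nat} {dO : measure_display} {Omega : measurableType dO}.
Variables (Y : set 'rV[R]_d) (G : 'rV[R]_d -> Omega -> R).
Hypothesis mG : forall x, Y x -> measurable_fun setT (G x).
Hypothesis cG : forall w, {within Y, continuous (G ^~ w)}.

(** By compactness a value <= 0 is attained once the infimum is <= 0, and a dense sequence
    determines the infimum. *)
Lemma measurable_exists_le0 K : K `<=` Y -> compact K ->
  measurable [set w | exists2 x, K x & G x w <= 0].
Proof.
move=> KY cK; case: (pselect (K !=set0)) => [K0|nK]; last first.
  rewrite (_ : [set w | _] = set0)//; apply/seteqP; split=> // w [x Kx _].
  by apply: nK; exists x.
have [D DK Dd] := dense_sequence K.
rewrite (_ : [set w | _] = \bigcap_n \bigcup_k [set w | G (D k) w < n.+1%:R^-1]).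
  apply: bigcapT_measurable => n; apply: bigcupT_measurable => k.
  by apply: measurable_lt_set => //; exact: mG (KY _ (DK k K0)).
apply/seteqP; split=> w /=.
  move=> [x Kx Gx] n _.
  have n0 : 0 < n.+1%:R^-1 :> R by rewrite invr_gt0.
  have [r r0 hr] := within_continuous_dist (@cG w) (KY _ Kx) n0.
  have [k xk] := Dd x r Kx r0; exists k => //=.
  have := hr _ (KY _ (DK k K0)) xk; rewrite ltr_distlC => /andP[_].
  by move=> h; rewrite (lt_le_trans h)// gerDr.
move=> h; have cGK : {within K, continuous (G ^~ w)}.
  by apply: (continuous_subspaceW KY); exact: cG.
have [x] := compact_EVT_min K0 cK cGK; rewrite inE => Kx xm.
exists x => //; apply/ler_addgt0Pl => e e0; rewrite addr0.
pose n := Num.truncn (e^-1).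
have [k _ /= hk] := h n Logic.I.
apply: le_trans (xm (D k) _) _; first by rewrite inE; exact: DK.
apply: le_trans (ltW hk) _.
by rewrite ltW// invf_plt ?posrE// truncnS_gt.
Qed.

(** The open condition 0 < H is exhausted by the compact slices |x| <= m, 1 / (n + 1) <= H. *)
Lemma measurable_exists_le0_gt (H : 'rV[R]_d -> R) : closed Y ->
  {within Y, continuous H} ->
  measurable [set w | exists x, [/\ Y x, G x w <= 0 & 0 < H x]].
Proof.
move=> cY cH.
rewrite (_ : [set w | _] = \bigcup_m \bigcup_n [set w |
    exists2 x, [/\ Y x, `|x| <= m%:R & n.+1%:R^-1 <= H x] & G x w <= 0]).
  apply: bigcupT_measurable => m; apply: bigcupT_measurable => n.
  apply: measurable_exists_le0; first by move=> x [].
  exact: compact_slice.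
apply/seteqP; split=> w /=.
  move=> [x [Yx Gx Hx]].
  exists (Num.truncn `|x|).+1 => //; exists (Num.truncn (H x)^-1) => //=.
  exists x => //; split=> //; first by rewrite ltW// truncnS_gt.
  by rewrite ltW// invf_plt ?posrE// truncnS_gt.
move=> [m _ [n _ [x [Yx _ Hx] Gx]]]; exists x; split=> //.
by apply: lt_le_trans Hx; rewrite invr_gt0.
Qed.

End random_sublevel.

Lemma measurable_fun_sublevel {R : realType} {d : measure_display}
    {T : measurableType d} (h : T -> R) :
  (forall c, measurable [set w | h w <= c]) -> measurable_fun setT h.
Proof.
move=> mh; apply: (measurability _ (RGenOInfty.measurableE R)) => _ [_ [c ->] <-].
rewrite setTI (_ : _ @^-1` _ = ~` [set w | h w <= c]); first exact: measurableC.
by apply/seteqP; split=> w /=; rewrite in_itv /= andbT ltNge => /negP.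
Qed.

Section good_event_measurable.
Context {R : realType} {d : nat} {dX dO : measure_display} {I : finType}.
Context {Xi : measurableType dX} {Omega : measurableType dO}.
Variables (P : probability Xi R) (Pr : probability Omega R).
Variables (N : nat) (xi : 'I_N -> {RV Pr >-> Xi}).
Variables (Y : set 'rV[R]_d) (F : option I -> 'rV[R]_d -> Xi -> R).
Variables (nrm : 'rV[R]_d -> R) (eta th : R).
Hypothesis nrmP : is_norm nrm.
Hypothesis caraF : caratheodory_integrable P Y F.
Hypothesis slater : LSCQ P Y F eta th.
Hypothesis solvable : forall w, saa_solvable xi Y F w.

Local Notation Fh := (Fhat xi F).
Local Notation vh := (saa_opt xi Y F).

Let measurable_Fhat i x : Y x -> measurable_fun setT (Fh i x).
Proof. by move=> Yx; apply: measurable_emp_mean; exact: (cara_measurable caraF). Qed.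

Let continuous_Fhat i w : {within Y, continuous (Fh i ^~ w)}.
Proof.
move=> x; rewrite /Fhat /emp_mean.
apply: (@cvgM _ (subspace Y)); first exact: cvg_cst.
move: x; apply: (@continuous_big R 'I_N +%R 0 xpredT _ (subspace Y)) => [|k _].
  by move=> z; exact: (@pseudometric_normed_Zmodule.add_continuous R R z).
by move=> z; exact: (cara_continuous caraF).
Qed.

(* Nonpositive exactly at the SAA-feasible points whose SAA value is at most
   [c w]. *)
Let viol (c : Omega -> R) x w : R :=
  \sum_i Num.max 0 (Fh i x w - if i is Some _ then 0 else c w).

Let viol_le0 c x w : Y x ->
  viol c x w <= 0 <-> saa_feasible xi Y F w x /\ Fh None x w <= c w.
Proof.
move=> Yx; have ge0 : forall i, true ->
    0 <= Num.max 0 (Fh i x w - if i is Some _ then 0 else c w).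
  by move=> i _; rewrite le_max lexx.
split=> [h|[[_ fx] hx]]; last first.
  by rewrite /viol big1// => -[i|] _; apply/eqP; rewrite eq_maxl subr_le0.
have : viol c x w == 0 by rewrite eq_le h /viol sumr_ge0.
rewrite /viol psumr_eq0// => /allP e0.
have hi i : Fh i x w - (if i is Some _ then 0 else c w) <= 0.
  by have := e0 i; rewrite mem_index_enum => /(_ isT)/eqP/eqP; rewrite eq_maxl.
split; first by split=> // i; have := hi (Some i); rewrite subr0.
by have := hi None; rewrite subr_le0.
Qed.

Let measurable_viol c x : measurable_fun setT c -> Y x ->
  measurable_fun setT (viol c x).
Proof.
move=> mc Yx; apply: measurable_sum => i.
apply: measurable_maxr; first exact: measurable_cst.
apply: measurable_funB; first exact: measurable_Fhat.
by case: i => [i|].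
Qed.

Let continuous_viol c w : {within Y, continuous (viol c ^~ w)}.
Proof.
apply: (@continuous_big R (option I) +%R 0 xpredT _ (subspace Y)) => [|i _].
  by move=> z; exact: (@pseudometric_normed_Zmodule.add_continuous R R z).
by apply: within_continuous_max0 => z; exact: continuous_Fhat.
Qed.

(** The SAA value is attained, so it is at most c exactly when [viol (cst c)] is nonpositive at some
    point of Y. *)
Lemma measurable_saa_opt : measurable_fun setT vh.
Proof.
apply: measurable_fun_sublevel => c.
rewrite (_ : [set w | _] = [set w | exists x, [/\ Y x, viol (cst c) x w <= 0 & 0 < (1 : R)]]).
  apply: measurable_exists_le0_gt.
  - by move=> x Yx; apply: measurable_viol => //; exact: measurable_cst.
  - by move=> w; exact: continuous_viol.
  - exact: (lscq_closed_dom slater).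
  - by move=> x; exact: cvg_cst.
apply/seteqP; split=> w /=.
  move=> vc; have [x xf xE] := saa_opt_attained solvable w.
  by exists x; split=> //; [case: xf|apply/viol_le0; [case: xf|rewrite xE]].
move=> [x [Yx /viol_le0 h _]]; have [xf xc] := h Yx.
exact: le_trans (saa_opt_le solvable xf) xc.
Qed.

Lemma measurable_saa_near_opt_le0 eps0 (H : 'rV[R]_d -> R) :
  {within Y, continuous H} ->
  measurable [set w | forall x, saa_near_opt xi Y F eps0 w x -> H x <= 0].
Proof.
move=> cH; pose c w := vh w + eps0.
have mc : measurable_fun setT c.
  by apply: measurable_funD; [exact: measurable_saa_opt|exact: measurable_cst].
rewrite (_ : [set w | _] = ~` [set w | exists x, [/\ Y x, viol c x w <= 0 & 0 < H x]]).
  apply: measurableC; apply: measurable_exists_le0_gt => //.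
  - by move=> x Yx; exact: measurable_viol.
  - exact: (lscq_closed_dom slater).
apply/seteqP; split=> w /=.
  move=> h [x [Yx /viol_le0 hx Hx]]; have [xf xc] := hx Yx.
  by have := h x (conj xf xc); rewrite leNgt Hx.
move=> h x [xf xc]; rewrite leNgt; apply/negP => Hx; apply: h; exists x.
by split=> //; [case: xf|apply/viol_le0; [case: xf|]].
Qed.

Lemma dist_to_lipschitz A x y : A !=set0 ->
  dist_to nrm x A <= dist_to nrm y A + ndist nrm x y.
Proof.
move=> [a Aa]; rewrite -lerBlDr; apply: lb_le_inf; first by exists (ndist nrm y a), a.
move=> _ [z Az <-]; rewrite lerBlDr.
apply: le_trans (dist_to_le nrmP x Az) _.
by rewrite addrC; exact: ndist_triangle.
Qed.

Lemma dist_to_continuous A : A !=set0 -> {within Y, continuous (dist_to nrm ^~ A)}.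
Proof.
move=> A0; apply/subspace_continuousP => x Yx; apply/cvgrPdist_lt => e e0.
pose r := e / (nrm_const nrm + 1).
have c0 := nrm_const_ge0 nrmP.
have c1 : 0 < nrm_const nrm + 1 by lra.
have r0 : 0 < r by rewrite divr_gt0.
have nb : nbhs x (ball_ Num.norm x r).
  by have := @nbhsx_ballx R 'rV[R]_d x r r0; rewrite mx_norm_ball.
apply: filterS nb => y /= xy _.
have h : ndist nrm x y < e.
  apply: le_lt_trans (nrm_le_norm nrmP _) _.
  apply: (@le_lt_trans _ _ ((nrm_const nrm + 1) * `|x - y|)).
    by rewrite ler_wpM2r// lerDl.
  by rewrite mulrC -ltr_pdivlMr.
have h1 := dist_to_lipschitz x y A0; have h2 := dist_to_lipschitz y x A0.
rewrite (ndistC nrmP) in h2.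
by rewrite ltr_norml; apply/andP; split; lra.
Qed.

(** Clauses (a) and (c) both say that a continuous function, [excess] or the distance minus its
    bound, is nonpositive at all SAA near-optimal points. *)
Lemma measurable_good_event sigma_s2 alpha sig2 t eps0 :
  feasible P Y F 0 !=set0 ->
  measurable (good_event nrm P xi Y F sigma_s2 alpha sig2 eta th t eps0).
Proof.
move=> X0; set dl := check_delta_lim nrm P N Y F sigma_s2 alpha sig2 eta th t eps0.
set r := check_r nrm P N Y F sigma_s2 alpha sig2 eta th t eps0.
set B := base_error (I := I) N sigma_s2 t + r / 2 + Num.max r (gap P Y F dl).
set D := Num.min (diam nrm (near_opt P Y F 0 th) * dl / eta) (2 * diam nrm (near_opt P Y F 0 r)).
rewrite (_ : good_event _ _ _ _ _ _ _ _ _ _ _ _ =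
  [set w | forall x, saa_near_opt xi Y F eps0 w x -> excess P Y F dl r x <= 0] `&`
  [set w | `|vh w - fopt P Y F 0| <= B] `&`
  [set w | forall x, saa_near_opt xi Y F eps0 w x ->
     dist_to nrm x (feasible P Y F 0) - D <= 0]).
  apply: measurableI; first apply: measurableI.
  - by apply: measurable_saa_near_opt_le0; exact: (excess_continuous slater).
  - apply: measurable_le_set; last exact: measurable_cst.
    apply: measurableT_comp => //; apply: measurable_funB; first exact: measurable_saa_opt.
    exact: measurable_cst.
  - apply: measurable_saa_near_opt_le0 => x.
    by apply: (@cvgB _ R^o); [exact: (dist_to_continuous X0)|exact: cvg_cst].
apply/seteqP; split=> w /=.
  move=> [h1 h2 h3]; split; first split=> //.
    by move=> x xo; apply/excess_le0; [case: xo => -[]|exact: h1].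
  by move=> x xo; rewrite subr_le0; exact: h3.
move=> [[h1 h2] h3]; split=> //.
  by move=> x xo; apply/excess_le0; [case: xo => -[]|exact: h1].
by move=> x xo; rewrite -subr_le0; exact: h3.
Qed.

End good_event_measurable.

(** * Probability of the good event *)

Section uniform_deviation.
Context {R : realType} {d : nat} {dX dO : measure_display} {I : finType}.
Context {Xi : measurableType dX} {Omega : measurableType dO}.
Variables (P : probability Xi R) (Pr : probability Omega R).
Variables (N : nat) (xi : 'I_N -> {RV Pr >-> Xi}).
Variables (Y : set 'rV[R]_d) (F : option I -> 'rV[R]_d -> Xi -> R).
Variables (nrm : 'rV[R]_d -> R) (xstar : 'rV[R]_d) (eta th t : R).
Variables (sigma_s2 alpha rho : R) (sig2 : R * R -> R).
Hypothesis nrmP : is_norm nrm.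
Hypothesis N_gt0 : (0 < N)%N.
Hypothesis iid : iid_with_law P xi.
Hypothesis caraF : caratheodory_integrable P Y F.
Hypothesis xstarP : minimizer P Y F xstar.
Hypothesis slater : LSCQ P Y F eta th.
Hypothesis t_ge0 : 0 <= t.

Local Notation f := (fmean P F).
Local Notation Fh := (Fhat xi F).
Local Notation near := (near_opt P Y F).
Local Notation v := (fopt P Y F).
Local Notation gp a := (gap P Y F (- a)).
Local Notation L := (@log_factor R I t).
Local Notation b := (@base_error R I N sigma_s2 t).
Local Notation wh := (what nrm P N Y F alpha sig2 t).

Lemma log_factor_ge : 8 / 5 <= L.
Proof.
rewrite /log_factor; have h := @ln2_ge R.
have : ln 2 <= ln (2 * #|I| + 2)%:R :> R.
  by rewrite ler_ln ?posrE ?ltr0n ?ler_nat ?addn2//.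
by move: t_ge0; lra.
Qed.

(* For each of the |I|+1 functions, 2 e^-L bounds the failure probability at
   xstar and 13/4 e^-L that of the chaining; 2 + 13/4 <= 2 e. *)
Lemma expR_log_factor : (#|I|%:R + 1) * ((2 + 13 / 4) * expR (- L)) <= expR (- t).
Proof.
have k0 : 0 < (2 * #|I| + 2)%:R :> R by rewrite ltr0n addn_gt0 orbT.
have -> : expR (- L) = (expR 1)^-1 * (2 * #|I| + 2)%:R^-1 * expR (- t).
  by rewrite /log_factor !opprD !expRD !expRN lnK ?posrE.
have e1 := @ge_expR1 R.
have e0 : 0 < expR 1 :> R by exact: expR_gt0.
have kE : (2 * #|I| + 2)%:R = 2 * (#|I|%:R + 1) :> R by rewrite natrD natrM; ring.
have k1 : 0 < #|I|%:R + 1 :> R by rewrite ltr_wpDl.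
rewrite !mulrA ler_piMl ?expR_ge0// kE.
rewrite (_ : _ * _ = (21 / 8) / expR 1); last by field; rewrite !gt_eqF.
by rewrite ler_pdivrMr//; lra.
Qed.

Lemma base_deviation i : 0 < sigma_s2 ->
  good P xi rho sigma_s2 (fun z => (F i xstar z - f i xstar) ^+ 2) ->
  exists2 Bad, pr_le Pr Bad (rho + 2 * expR (- L))
    & forall w, ~ Bad w -> `|Fh i xstar w - f i xstar| <= b.
Proof.
move=> s0 [_ mU iU pU]; have Ys : Y xstar by case: xstarP => -[].
pose U z := F i xstar z - f i xstar.
have mF := cara_measurable caraF i Ys; have iF := cara_integrable caraF i Ys.
have mU1 : measurable_fun setT U by apply: measurable_funB => //; exact: measurable_cst.
have ic : P.-integrable setT (EFin \o cst (f i xstar)) by exact: finite_measure_integrable_cst.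
have iU1 : P.-integrable setT (EFin \o U) by exact: (integrableB measurableT iF ic).
have L0 : 0 <= L by have := log_factor_ge; lra.
(* [U] serves as its own modulus, with a = 1. *)
have UL z : `|U z| <= `|U z| * 1 by rewrite mulr1.
have tail := empirical_tail iid N_gt0 mU1 iU1 mU iU s0 L0 ler01 UL.
exists ([set w | 2 * sigma_s2 < emp_mean xi (fun z => U z ^+ 2) w] `|`
  [set w | emp_mean xi (fun z => U z ^+ 2) w <= 2 * sigma_s2 /\
   Num.sqrt sigma_s2 * 1 * Num.sqrt (6 * L / N%:R) < `|emp_mean xi U w - \int[P]_z U z|]).
  have mE : measurable_fun setT (emp_mean xi (fun z => U z ^+ 2)) by exact: measurable_emp_mean.
  apply: pr_leU; split=> //; first by apply: measurable_lt_set => //; exact: measurable_cst.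
  apply: measurableI; first by apply: measurable_le_set => //; exact: measurable_cst.
  apply: measurable_lt_set; first exact: measurable_cst.
  apply: measurableT_comp => //; apply: measurable_funB; last exact: measurable_cst.
  exact: measurable_emp_mean.
move=> w nB; have iU0 : \int[P]_z U z = 0.
  by rewrite /U RintegralB// Rintegral_prob_cst /fmean subrr.
have UE : emp_mean xi U w = Fh i xstar w - f i xstar.
  by rewrite /U /Fhat (emp_meanD xi (F i xstar) (cst (- f i xstar))) emp_mean_cst.
have h1 : emp_mean xi (fun z => U z ^+ 2) w <= 2 * sigma_s2.
  by rewrite leNgt; apply/negP => h; apply: nB; left.
rewrite leNgt; apply/negP => h2; apply: nB; right; split=> //.
by rewrite iU0 subr0 UE mulr1.
Qed.

Lemma chaining_deviation i del ep w' : 0 <= del <= eta -> 0 < ep ->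
  gp del <= ep -> ep + gp del <= th -> 0 < sig2 (ep + gp del, del) ->
  0 < alpha <= 1 ->
  (exists2 Lip : Xi -> R,
    good P xi rho (sig2 (ep + gp del, del)) (fun z => Lip z ^+ 2)
    & forall x x' z, near del (ep + gp del) x -> near del (ep + gp del) x' ->
        `|F i x z - F i x' z| <= Lip z * powR (nrm (x - x')) alpha) ->
  wh del ep < w' ->
  exists2 Bad, pr_le Pr Bad (rho + 13 / 4 * expR (- L))
    & forall w, ~ Bad w -> forall x, near del ep x ->
      `|(Fh i x w - f i x) - (Fh i xstar w - f i xstar)| <= w'.
Proof.
move=> de ep0 gep epth s20 /andP[al0 al1] [Lip [_ mL iL pL] FL] ww'.
have /andP[d0 d1] := de.
have g0 : 0 <= gp del by exact: normr_ge0.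
set r := ep + gp del in epth s20 iL pL FL ww' *.
have r0 : 0 <= r by rewrite addr_ge0// ltW.
(* Averaging with a minimizer y over feasible (- del) maps near_opt del ep into
   near_opt 0 r and halves distances: hence the factors 4 and 6 in [what] where
   [chaining] has 2 and 3. *)
have [y yf yv] := fopt_attained xstarP slater de.
pose T := near del ep; pose M := near 0 r; pose phi z := comb 2^-1 z y.
have ny : near (- del) (gp del) y.
  by split=> //; rewrite yv (gap_opp xstarP slater de); lra.
have h01 : 0 <= (2^-1 : R) <= 1 by lra.
have phiM z : T z -> M (phi z).
  move=> Tz; apply: (near_opt_comb slater h01 Tz ny); first lra.
  by rewrite /r; lra.
have bM : bounded_set M by exact: (bounded_near_opt slater).
have M0 : M !=set0 by exists xstar; exact: (near_opt_xstar xstarP).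
have phi_dist x z : ndist nrm x z = 2 * ndist nrm (phi x) (phi z).
  have -> : 2 * ndist nrm (phi x) (phi z) = `|2| * nrm (phi x - phi z) by rewrite ger0_norm.
  rewrite -(norm_homogeneous nrmP) /ndist; congr nrm; apply/rowP => k.
  by rewrite /phi /comb !mxE; lra.
have pow2 D : 0 <= D -> powR (2 * D) alpha <= 2 * powR D alpha.
  move=> D0; rewrite powRM// ler_wpM2r ?powR_ge0//.
  by rewrite -[leRHS]powRr1// ler_powR// ler1n.
have powM D D' : 0 <= D -> D <= D' -> powR D alpha <= powR D' alpha.
  move=> D0 DD; apply: ge0_ler_powR => //; rewrite ?nnegrE ?(ltW al0)//.
  exact: le_trans D0 DD.
pose s2 := sig2 (r, del); pose sN := Num.sqrt N%:R : R.
have sN0 : 0 < sN by rewrite sqrtr_gt0 ltr0n.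
pose k0 := Num.sqrt s2 * (4 * Num.sqrt 3) / sN.
have k00 : 0 <= k0 by rewrite divr_ge0 ?mulr_ge0 ?sqrtr_ge0.
(* the infimum defining gamma2 need not be attained *)
pose kap := (w' - wh del ep) / (k0 + 1).
have k01 : 0 < k0 + 1 by lra.
have kap0 : 0 < kap by rewrite divr_gt0// subr_gt0.
have kapw : k0 * kap <= w' - wh del ep.
  rewrite -[leRHS](divfK (lt0r_neq0 k01)) -/kap mulrC ler_wpM2l ?(ltW kap0)//; lra.
pose c := fine (gamma2 (ndist nrm) alpha M) + kap.
have gc : (gamma2 (ndist nrm) alpha M < c%:E)%E.
  rewrite -[ltLHS](fineK (gamma2_fin_num nrmP al0 M0 bM)) lte_fin /c; lra.
have nge0 := ndist_ge0 nrmP.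
have [g [D [[_ g_lt] D0 gD sD]]] := gamma2_indexing al0 nge0 M0 gc.
have Txs : T xstar by apply: (near_opt_xstar xstarP) => //; exact: ltW.
have TY x : T x -> Y x by move=> [[]].
have Tsub : T `<=` near del r.
  by apply: near_optS => //; rewrite /r; lra.
(* With the power alpha as distance, the Hoelder bound is the Lipschitz bound expected by
   [chaining]; as alpha <= 1, doubling a norm at most doubles its power. *)
pose dst x z := powR (nrm (x - z)) alpha.
have mF x : T x -> measurable_fun setT (F i x).
  by move=> /TY; exact: (cara_measurable caraF).
have iF x : T x -> P.-integrable setT (EFin \o F i x).
  by move=> /TY; exact: (cara_integrable caraF).
have FL' x z u : T x -> T z -> `|F i x u - F i z u| <= Lip u * dst x z.
  by move=> /Tsub Tx /Tsub Tz; exact: FL.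
have dst0 x z : 0 <= dst x z by exact: powR_ge0.
have glt j x : T x -> (g j (phi x) < 2 ^ (2 ^ j))%N.
  by move=> /phiM; exact: g_lt.
have gdst j x z : T x -> T z -> g j (phi x) = g j (phi z) ->
    dst x z <= 2 * powR (D j) alpha.
  move=> Tx Tz gxz; rewrite /dst -/(ndist nrm x z) phi_dist.
  apply: le_trans (pow2 _ (nge0 _ _)) _; rewrite ler_wpM2l//.
  by apply: powM (nge0 _ _) _; apply: gD gxz; exact: phiM.
have dstA x z : T x -> T z -> dst x z <= 2 * powR (diam nrm M) alpha.
  move=> Tx Tz; rewrite /dst -/(ndist nrm x z) phi_dist.
  apply: le_trans (pow2 _ (nge0 _ _)) _; rewrite ler_wpM2l//.
  by apply: powM (nge0 _ _) _; apply: (le_diam nrmP bM); exact: phiM.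
have sumc n : \sum_(0 <= j < n) powR 2 (j%:R / 2) * (2 * powR (D j) alpha) <= 2 * c.
  rewrite (eq_bigr (fun j => 2 * (powR 2 (j%:R / 2) * powR (D j) alpha))); last first.
    by move=> j _; rewrite mulrCA.
  by rewrite -mulr_sumr ler_wpM2l.
have [Bad pB hB] := chaining (g := fun j x => g j (phi x)) iid N_gt0 Txs mF iF
  mL iL s20 FL' dst0 glt gdst dstA sumc log_factor_ge.
exists ([set w | 2 * s2 < emp_mean xi (fun z => Lip z ^+ 2) w] `|` Bad).
  apply: pr_leU => //; split=> //; apply: measurable_lt_set; first exact: measurable_cst.
  exact: measurable_emp_mean.
move=> w nB x Tx.
have h1 : emp_mean xi (fun z => Lip z ^+ 2) w <= 2 * s2.
  by rewrite leNgt; apply/negP => h; apply: nB; left.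
have h2 : ~ Bad w by move=> h; apply: nB; right.
apply: le_trans (hB w h1 h2 x Tx) _.
have whE : wh del ep = Num.sqrt s2 * (4 * Num.sqrt 3 * (fine (gamma2 (ndist nrm) alpha M) / sN)
   + 6 * Num.sqrt 3 * (powR (diam nrm M) alpha * Num.sqrt L / sN)) by [].
apply: (@le_trans _ _ (wh del ep + k0 * kap)); last by lra.
rewrite le_eqVlt; apply/orP; left; apply/eqP.
rewrite whE /k0 /c -/s2 -/sN; field; exact: lt0r_neq0.
Qed.

Lemma uniform_deviation del ep w' : 0 <= del <= eta -> 0 < ep ->
  gp del <= ep -> ep + gp del <= th ->
  goodness_over nrm P xi Y F xstar sigma_s2 (sig2 (ep + gp del, del)) alpha rho
    (near del (ep + gp del)) ->
  wh del ep < w' ->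
  exists2 Bad, pr_le Pr Bad (expR (- t) + 2 * (#|I|%:R + 1) * rho)
    & forall w, ~ Bad w -> (forall i, `|Fh i xstar w - f i xstar| <= b) /\
      forall i x, near del ep x ->
      `|(Fh i x w - f i x) - (Fh i xstar w - f i xstar)| <= w'.
Proof.
move=> de ep0 gep epth [rho0 reg] ww'.
have h1 i := base_deviation (reg_sigma_s2_gt0 reg) (reg_variance reg i).
have h2 i := chaining_deviation de ep0 gep epth (reg_s2_gt0 reg) (reg_alpha reg) (reg_hoelder reg i) ww'.
pose B1 i := sval (cid2 (h1 i)); pose B2 i := sval (cid2 (h2 i)).
exists [set w | exists i, (B1 i `|` B2 i) w].
  apply: (@pr_leW _ _ _ _ _ (\sum_(i : option I) (rho + 2 * expR (- L) + (rho + 13 / 4 * expR (- L))))).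
    rewrite sumr_const card_option -[_ *+ _]mulr_natl -[#|I|.+1]addn1 natrD.
    by have := expR_log_factor; lra.
  apply: pr_le_fin => i; apply: pr_leU; first by rewrite /B1; case: cid2.
  by rewrite /B2; case: cid2.
move=> w nB; split=> i.
  have : ~ B1 i w by move=> h; apply: nB; exists i; left.
  by rewrite /B1; case: cid2 => B /= _; apply.
have : ~ B2 i w by move=> h; apply: nB; exists i; right.
by rewrite /B2; case: cid2 => B /= _; apply.
Qed.

End uniform_deviation.

(** The limit inferior is the increasing union of the tail intersections, each contained in a single
    [B m], so the bound does not accumulate over the index. *)
Lemma pr_le_eventually {R : realType} {dO : measure_display}
    {Omega : measurableType dO} (Pr : probability Omega R)
    (B : nat -> set Omega) (b : R) : (forall n, pr_le Pr (B n) b) ->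
  pr_le Pr [set w | exists m, forall n, (m <= n)%N -> B n w] b.
Proof.
move=> hB; pose E m := \bigcap_(n in [set n | (m <= n)%N]) B n.
have mE m : measurable (E m) by apply: bigcap_measurable => [|n _]; [exists m => /=|exact: (hB n).1].
have UE : [set w | exists m, forall n, (m <= n)%N -> B n w] = \bigcup_m E m.
  by apply/seteqP; split=> [w [m h]|w [m _ h]]; exists m.
have mU : measurable (\bigcup_m E m) by exact: bigcupT_measurable.
rewrite UE; split=> //.
have cv : Pr (E m) @[m --> \oo] --> Pr (\bigcup_m E m).
  apply: nondecreasing_cvg_mu => //.
  move=> m n mn; apply/subsetPset => w h k /= nk; apply: h => /=.
  exact: leq_trans mn nk.
rewrite -(cvg_lim _ cv)//; apply: lime_le; first by apply/cvg_ex; exists (Pr (\bigcup_m E m)).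
apply: nearW => m.
apply: le_trans (hB m).2; apply: le_measure; rewrite ?inE//; first exact: (hB m).1.
by move=> w; apply => /=.
Qed.

(** * Passage to the limit tolerances *)

Section good_event_limit.
Context {R : realType} {d : nat} {dX dO : measure_display} {I : finType}.
Context {Xi : measurableType dX} {Omega : measurableType dO}.
Variables (P : probability Xi R) (Pr : probability Omega R).
Variables (N : nat) (xi : 'I_N -> {RV Pr >-> Xi}).
Variables (Y : set 'rV[R]_d) (F : option I -> 'rV[R]_d -> Xi -> R).
Variables (nrm : 'rV[R]_d -> R) (xstar : 'rV[R]_d) (eta th : R).
Hypothesis nrmP : is_norm nrm.
Hypothesis xstarP : minimizer P Y F xstar.
Hypothesis slater : LSCQ P Y F eta th.
Hypothesis solvable : forall w, saa_solvable xi Y F w.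

Local Notation f := (fmean P F).
Local Notation Fh := (Fhat xi F).
Local Notation feas := (feasible P Y F).
Local Notation near := (near_opt P Y F).
Local Notation v := (fopt P Y F).
Local Notation vh := (saa_opt xi Y F).

(** For a fixed point, inclusions and upper bounds pass to the limit in h. The strictly feasible
    point varies with h instead, so its limit comes from [near_opt_limit]. *)
Lemma good_bounds_limit (eps0 b dl r : R) (w : Omega) :
  0 <= eps0 -> 0 <= r -> r <= th -> 0 <= dl ->
  (forall h : R, 0 < h -> exists del ep,
    [/\ 0 <= del <= dl + h /\ dl - h <= del, ep <= r + h,
        saa_near_opt xi Y F eps0 w `<=` near del ep, vh w - v 0 <= b + ep
      & (forall x, near del ep x -> f None x <= Fh None x w + b + ep / 2) /\
        exists2 y, near 0 th y & near (- del) ep y]) ->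
  [/\ saa_near_opt xi Y F eps0 w `<=` near dl r,
      `|vh w - v 0| <= b + r / 2 + Num.max r (gap P Y F dl)
    & forall x, saa_near_opt xi Y F eps0 w x ->
        dist_to nrm x (feas 0) <=
        Num.min (diam nrm (near 0 th) * dl / eta) (2 * diam nrm (near 0 r))].
Proof.
move=> e0 r0 rth dl0 app.
have Ha : saa_near_opt xi Y F eps0 w `<=` near dl r.
  move=> x nx; split; last first.
    apply/ler_addgt0Pr => h h0; have [del [ep [_ epr sub _ _]]] := app h h0.
    by have [_ hx] := sub x nx; apply: le_trans hx _; rewrite -addrA lerD2l.
  split; first by case: nx => -[].
  move=> i; apply/ler_addgt0Pr => h h0; have [del [ep [[/andP[_ ddl] _] _ sub _ _]]] := app h h0.
  by have [[_ hx] _] := sub x nx; exact: le_trans (hx i) ddl.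
split=> //.
- have up : vh w - v 0 <= b + r.
    apply/ler_addgt0Pr => h h0; have [del [ep [_ epr _ hup _]]] := app h h0.
    by apply: le_trans hup _; rewrite -addrA lerD2l.
  (* Lower side of (b): an SAA minimizer lies in [near dl r], so its value is at least v dl, and v 0
     - v dl is at most the gap. *)
  have [x xf xE] := saa_opt_attained solvable w.
  have nx : saa_near_opt xi Y F eps0 w x by split=> //; rewrite xE lerDl.
  have low : f None x <= vh w + b + r / 2.
    apply/ler_addgt0Pr => h h0; have [del [ep [_ epr sub _ [hf _]]]] := app h h0.
    by have := hf x (sub x nx); rewrite xE; lra.
  have vx := fopt_le xstarP slater (Ha x nx).1.
  have g1 : v 0 - v dl <= gap P Y F dl by rewrite /gap -normrN opprB ler_norm.
  have m1 : r <= Num.max r (gap P Y F dl) by rewrite le_max lexx.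
  have m2 : gap P Y F dl <= Num.max r (gap P Y F dl) by rewrite le_max lexx orbT.
  by rewrite ler_norml; apply/andP; split; lra.
- move=> x nx; have nx' := Ha x nx.
  rewrite le_min; apply/andP; split.
    exact: (dist_feasible_slater nrmP slater dl0 rth nx').
  have [y ny] : exists y, near (- dl) r y.
    apply: (near_opt_limit slater) => // h h0.
    have [del [ep [[_ dld] epr _ _ [_ [y ny0 ny]]]]] := app h h0.
    exists y; split=> //; apply: near_optS ny => //; lra.
  exact: (dist_feasible_mid nrmP slater r0 rth dl0 nx' ny).
Qed.

End good_event_limit.

Section good_event_probability.
Context {R : realType} {d : nat} {dX dO : measure_display} {I : finType}.
Context {Xi : measurableType dX} {Omega : measurableType dO}.
Variables (P : probability Xi R) (Pr : probability Omega R).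
Variables (N : nat) (xi : 'I_N -> {RV Pr >-> Xi}).
Variables (Y : set 'rV[R]_d) (F : option I -> 'rV[R]_d -> Xi -> R).
Variables (nrm : 'rV[R]_d -> R) (xstar : 'rV[R]_d) (eta th t eps0 : R).
Variables (sigma_s2 alpha rho : R) (sig2 : R * R -> R).
Let rect := [set q : R * R | 0 <= q.1 <= th /\ 0 <= q.2 <= eta].
Hypothesis nrmP : is_norm nrm.
Hypothesis N_gt0 : (0 < N)%N.
Hypothesis iid : iid_with_law P xi.
Hypothesis caraF : caratheodory_integrable P Y F.
Hypothesis xstarP : minimizer P Y F xstar.
Hypothesis solvable : forall w, saa_solvable xi Y F w.
Hypothesis slater : LSCQ P Y F eta th.
Hypothesis convexF : forall i z, @convex_function R 'rV[R]_d Y (F i ^~ z).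
Hypothesis cont_sig2 : {within rect, continuous sig2}.
Hypothesis t_ge0 : 0 <= t.
Hypothesis eps0_itv : 0 <= eps0 < th.
Hypothesis goodF : forall u v, rect (u, v) ->
  goodness_over nrm P xi Y F xstar sigma_s2 (sig2 (u, v)) alpha rho
    (near_opt P Y F v u).

Local Notation f := (fmean P F).
Local Notation Fh := (Fhat xi F).
Local Notation feas := (feasible P Y F).
Local Notation near := (near_opt P Y F).
Local Notation v := (fopt P Y F).
Local Notation vh := (saa_opt xi Y F).
Local Notation b := (@base_error R I N sigma_s2 t).
Local Notation wh := (what nrm P N Y F alpha sig2 t).
Local Notation Rset := (R_set nrm P N Y F sigma_s2 alpha sig2 eta th t eps0).
Local Notation cdelta := (check_delta nrm P N Y F sigma_s2 alpha sig2 eta th t).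
Local Notation cr := (check_r nrm P N Y F sigma_s2 alpha sig2 eta th t eps0).
Local Notation cdlim := (check_delta_lim nrm P N Y F sigma_s2 alpha sig2 eta th t eps0).

Let gp a := gap P Y F (- a).
Let K u := 4 * Num.sqrt 3 * (fine (gamma2 (ndist nrm) alpha (near 0 u)) / Num.sqrt N%:R)
   + 6 * Num.sqrt 3 *
     (powR (diam nrm (near 0 u)) alpha * Num.sqrt (@log_factor R I t) / Num.sqrt N%:R).
Let sgm u a := Num.sqrt (sig2 (u, a)).

Let eta_gt0 : 0 < eta := lscq_eta_gt0 slater.
Let eps0_ge0 : 0 <= eps0. Proof. by case/andP: eps0_itv. Qed.
Let th_gt0 : 0 < th. Proof. by case/andP: eps0_itv => /le_lt_trans; apply. Qed.
Let th_ge0 : 0 <= th := ltW th_gt0.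
Let good0 : goodness_over nrm P xi Y F xstar sigma_s2 (sig2 (0, 0)) alpha rho (near 0 0).
Proof. by apply: goodF; split=> /=; rewrite lexx ltW. Qed.
Let alpha_itv : 0 < alpha <= 1 := reg_alpha good0.2.
Let alpha_gt0 : 0 < alpha. Proof. by case/andP: alpha_itv. Qed.
Let b_gt0 : 0 < b.
Proof.
have Lge := @log_factor_ge R I t t_ge0.
rewrite mulr_gt0// sqrtr_gt0; first exact: reg_sigma_s2_gt0 good0.2.
by rewrite divr_gt0 ?ltr0n// mulr_gt0//; lra.
Qed.

Let near0 u : 0 <= u -> near 0 u !=set0.
Proof. by move=> u0; exists xstar; exact: (near_opt_xstar xstarP). Qed.

Let bnear u : u <= th -> bounded_set (near 0 u).
Proof. by move=> uth; exact: (bounded_near_opt slater). Qed.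

Let K_ge0 u : 0 < u -> u <= th -> 0 <= K u.
Proof.
move=> u0 uth; rewrite addr_ge0// !mulr_ge0 ?invr_ge0 ?sqrtr_ge0 ?powR_ge0//.
by rewrite fine_ge0// gamma2_ge0.
Qed.

Let K_mono u u' : 0 < u -> u <= u' -> u' <= th -> K u <= K u'.
Proof.
move=> u0 uu' u'th.
have nn : near 0 u `<=` near 0 u' by exact: near_optS.
have nu := near0 (ltW u0); have nu' := near0 (le_trans (ltW u0) uu').
have bu' := bnear u'th; have bu := bnear (le_trans uu' u'th).
have nge0 := ndist_ge0 nrmP.
rewrite lerD// ler_wpM2l ?mulr_ge0 ?sqrtr_ge0//.
  rewrite ler_wpM2r ?invr_ge0 ?sqrtr_ge0// fine_le ?(gamma2_fin_num nrmP)//.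
  exact: gamma2S.
rewrite ler_wpM2r ?invr_ge0 ?sqrtr_ge0// ler_wpM2r ?sqrtr_ge0//.
apply: ge0_ler_powR; rewrite ?nnegrE ?(diam_ge0 nrmP)// ?(ltW alpha_gt0)//.
exact: (diamS nrmP).
Qed.

Let sgm_ge0 u a : 0 <= sgm u a. Proof. exact: sqrtr_ge0. Qed.

Let sgm_cont (u a : R) : 0 <= u -> u <= th -> 0 <= a -> a <= eta ->
  forall e : R, 0 < e -> exists2 r : R, 0 < r & forall u' a' : R,
    0 <= u' -> u' <= th -> 0 <= a' -> a' <= eta ->
    `|u' - u| < r -> `|a' - a| < r -> `|sgm u' a' - sgm u a| < e.
Proof.
move=> u0 uth a0 aeta e e0.
have ua : rect (u, a) by split; apply/andP.
have cs : {within rect, continuous (fun q => Num.sqrt (sig2 q))}.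
  move=> q; apply: (@continuous_comp (subspace rect) R R sig2 Num.sqrt).
    exact: cont_sig2.
  exact: sqrt_continuous.
move/subspace_continuousP: cs => cs; have /cvgrPdist_lt/(_ e e0) := cs (u, a) ua.
move=> /nbhs_ballP[r /= r0 h]; exists r => // u' a' u'0 u'th a'0 a'eta ur ar.
rewrite distrC; apply: h; last by split; apply/andP.
by split; rewrite /= /ball/= distrC.
Qed.

Let gp0 : gp 0 = 0. Proof. exact: gap0. Qed.

Let gp_lip (x y : R) : 0 <= x -> x <= y -> y < eta ->
  gp x <= gp y /\ gp y - gp x <= (y - x) / (eta - x) * th.
Proof. by move=> *; exact: (gap_lipschitz xstarP slater). Qed.

Let R_setE : Rset = R_of eta th b eps0 gp K sgm (#|I| == 0%N).
Proof.
apply/seteqP; split=> ep [h1 [h2 h3] h4]; split=> //; split=> //.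
  by case: h3 => [->|]; [left|right].
by case: h3 => [/eqP|]; [left|right].
Qed.

Hypothesis R_set0 : Rset !=set0.
Hypothesis cvg_delta : cvg (cdelta @ check_r_filter nrm P N Y F sigma_s2 alpha sig2 eta th t eps0).

Let R_lb : has_lbound Rset.
Proof. by exists eps0 => ep [/andP[/ltW]]. Qed.

Let cr_bounds : eps0 <= cr /\ cr <= th.
Proof.
split; first by apply: lb_le_inf => // ep [/andP[/ltW]].
by have [ep Rep] := R_set0; apply: le_trans (ge_inf R_lb Rep) _; case: Rep => /andP[].
Qed.

(** By [R_of_left], [R_set] has no least element, so its elements tend to [check_r] strictly from
    the right, as the filter defining [check_delta_lim] requires. *)
Let R_gt_inf ep : Rset ep -> cr < ep.
Proof.
rewrite {1}R_setE => /(R_of_left eta_gt0 eps0_ge0 gp0 gp_lip K_ge0 K_mono sgm_ge0 sgm_cont b_gt0).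
by rewrite -R_setE => -[ep' Rep' h]; apply: le_lt_trans h; exact: ge_inf.
Qed.

Let approximants (h : R) : 0 < h -> exists del ep w',
  [/\ 0 <= del < eta /\ `|del - cdlim| < h, 0 < ep <= cr + h /\ ep + gp del <= th,
      wh del ep < w', #|I| != 0%N -> w' + b < del & eps0 + gp del + 2 * w' < ep].
Proof.
move=> h0; have h20 : 0 < h / 2 by lra.
have /cvgrPdist_lt/(_ (h / 2) h20) := cvg_delta.
move=> /nbhs_ballP[r0 /= r00 hr0].
have mh : 0 < Num.min h r0 by rewrite lt_min h0.
have [ep Rep epr] := inf_adherent mh (conj R_set0 R_lb).
have rep := R_gt_inf Rep.
have cd : `|cdlim - cdelta ep| < h / 2.
  apply: hr0 => //; last by case: Rep.
  rewrite /ball/= distrC ger0_norm ?subr_ge0 ?(ltW rep)//.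
  by rewrite ltrBlDl (lt_le_trans epr)// lerD2l ge_min lexx orbT.
have := Rep; rewrite R_setE => Rep'.
have [del [de dth wI w0 ddel]] := R_of_slack eta_gt0 gp0 gp_lip K_ge0 K_mono sgm_ge0 sgm_cont b_gt0 Rep' h20.
have [/andP[ep0 epth] _ _] := Rep.
have slack : exists2 w', wh del ep < w' & (#|I| != 0%N -> w' + b < del) /\ eps0 + gp del + 2 * w' < ep.
  (* A quarter of the slack in the inequality where w' counts twice, and half of the other; without
     constraints the 1 is a placeholder. *)
  pose k := Num.min ((ep - eps0 - gp del - 2 * wh del ep) / 4)
                    (if #|I| == 0%N then 1 else (del - wh del ep - b) / 2).
  have k1 : k <= (ep - eps0 - gp del - 2 * wh del ep) / 4 by rewrite ge_min lexx.
  have k2 : k <= if #|I| == 0%N then 1 else (del - wh del ep - b) / 2.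
    by rewrite ge_min lexx orbT.
  have w0' : 0 < ep - eps0 - gp del - 2 * wh del ep.
    by move: w0; rewrite -/(wh del ep); lra.
  have k0 : 0 < k.
    rewrite lt_min; apply/andP; split; first by lra.
    by case: ifPn wI => // nI /(_ isT); rewrite -/(wh del ep); lra.
  exists (wh del ep + k); first by rewrite ltrDl.
  split; last by lra.
  by move=> nI; move: k2 (wI nI); rewrite (negPf nI) -/(wh del ep); lra.
have [w' ww' [w'I w'e]] := slack.
exists del, ep, w'; split=> //; split=> //.
  rewrite (_ : del - cdlim = (del - cdelta ep) + - (cdlim - cdelta ep)); last by ring.
  apply: le_lt_trans (ler_normD _ _) _; rewrite normrN.
  by rewrite [ltRHS](splitr h) ltrD.
by rewrite (le_lt_trans eps0_ge0 ep0)/= (le_trans (ltW epr))// lerD2l ge_min lexx.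
Qed.

Let bad_events (h : R) : 0 < h ->
  exists2 Bad, pr_le Pr Bad (expR (- t) + 2 * (#|I|%:R + 1) * rho)
   & forall w, ~ Bad w -> exists del ep,
    [/\ 0 <= del <= cdlim + h /\ cdlim - h <= del, ep <= cr + h,
        saa_near_opt xi Y F eps0 w `<=` near del ep, vh w - v 0 <= b + ep
      & (forall x, near del ep x -> f None x <= Fh None x w + b + ep / 2) /\
        exists2 y, near 0 th y & near (- del) ep y].
Proof.
move=> h0; have [del [ep [w' [[/andP[d0 deta] dh] [/andP[ep0 epr] epth] ww' wI we]]]] := approximants h0.
have g0 : 0 <= gp del by exact: normr_ge0.
have de : 0 <= del <= eta by rewrite d0 ltW.
have epg0 : 0 < ep + gp del by rewrite ltr_wpDr.
have wh0 : 0 <= wh del ep by rewrite mulr_ge0// K_ge0.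
have w'0 : 0 <= w' by rewrite (le_trans wh0)// ltW.
have gep : gp del <= ep by move: eps0_ge0; lra.
have Gd : goodness_over nrm P xi Y F xstar sigma_s2 (sig2 (ep + gp del, del)) alpha rho
    (near del (ep + gp del)).
  by apply: goodF; split=> /=; rewrite ?epth ?(ltW epg0).
have [Bad pB hB] := uniform_deviation nrmP N_gt0 iid caraF xstarP slater t_ge0 de ep0 gep epth Gd ww'.
exists Bad => // w nB; have [hb hw] := hB w nB.
have [y yf yv] := fopt_attained xstarP slater de.
have [_ sub up low] := saa_localization xstarP slater solvable convexF eps0_ge0 w'0 de yf yv hb hw wI we.
exists del, ep; split=> //.
- move: dh; rewrite ltr_distl => /andP[? ?].
  by rewrite d0 ltW// ltW.
- by move: up; rewrite -/(gp del); move: eps0_ge0; lra.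
split; first by move=> x nx; have := low x nx; move: eps0_ge0; lra.
have gE := gap_opp xstarP slater de.
have ny : near (- del) ep y by split=> //; rewrite yv; move: gep; rewrite /gp gE; lra.
exists y => //; apply: near_optS ny; first by rewrite oppr_le0.
by move: epth; lra.
Qed.

Lemma good_event_probability :
  measurable (good_event nrm P xi Y F sigma_s2 alpha sig2 eta th t eps0) /\
  ((1 - expR (- t) - 2 * (#|I|%:R + 1) * rho)%:E <=
   Pr (good_event nrm P xi Y F sigma_s2 alpha sig2 eta th t eps0))%E.
Proof.
set Good := good_event _ _ _ _ _ _ _ _ _ _ _ _.
have mG : measurable Good.
  by apply: (measurable_good_event nrmP caraF slater solvable); exists xstar; case: xstarP.
split=> //.
have hn n : 0 < n.+1%:R^-1 :> R by rewrite invr_gt0.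
pose B n := sval (cid2 (bad_events (hn n))).
have pB n : pr_le Pr (B n) (expR (- t) + 2 * (#|I|%:R + 1) * rho) by rewrite /B; case: cid2.
have [mE pE] := pr_le_eventually pB.
(* If [B n] fails for arbitrarily large n, approximants exist for all h and [good_bounds_limit]
   gives the good event. *)
have sub : ~` Good `<=` [set w | exists m, forall n, (m <= n)%N -> B n w].
  move=> w nG; apply: contrapT => /forallNP nB; apply: nG.
  have dl0 : 0 <= cdlim.
    apply/ler_addgt0Pr => h h0.
    have [del [_ [_ [[/andP[d0 _] dh] _ _ _ _]]]] := approximants h0.
    by move: dh; rewrite ltr_distl => /andP[_]; lra.
  apply: (good_bounds_limit nrmP xstarP slater solvable) => //.
  - exact: le_trans cr_bounds.1.
  - exact: cr_bounds.2.
  move=> h h0; pose m := Num.truncn h^-1.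
  have /existsNP[n /not_implyP[mn nBn]] := nB m.
  have nh : n.+1%:R^-1 <= h.
    rewrite ltW// invf_plt ?posrE// (lt_le_trans (truncnS_gt _))// ler_nat ltnS.
    exact: mn.
  have [del [ep [[/andP[d0 d1] d2] e1 s1 s2 s3]]] : exists del ep,
    [/\ 0 <= del <= cdlim + n.+1%:R^-1 /\ cdlim - n.+1%:R^-1 <= del, ep <= cr + n.+1%:R^-1,
        saa_near_opt xi Y F eps0 w `<=` near del ep, vh w - v 0 <= b + ep
      & (forall x, near del ep x -> f None x <= Fh None x w + b + ep / 2) /\
        exists2 y, near 0 th y & near (- del) ep y].
    by move: nBn; rewrite /B; case: cid2 => Bn /= _; apply.
  exists del, ep; split=> //; last by apply: le_trans e1 _; rewrite lerD2l.
  rewrite d0 (le_trans d1) ?lerD2l//; split=> //.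
  by apply: le_trans d2; rewrite lerD2l lerN2.
have h1 : (Pr (~` Good) <= (expR (- t) + 2 * (#|I|%:R + 1) * rho)%:E)%E.
  by apply: le_trans pE; apply: le_measure; rewrite ?inE//; exact: measurableC.
rewrite probability_setC// in h1; move: h1.
rewrite -(fineK (fin_num_measure Pr _ mG)) -EFinB !lee_fin; lra.
Qed.

End good_event_probability.

Theorem theorem3 (R : realType) :
  exists c_bdg : R, 0 < c_bdg /\
  forall (d : nat) (nrm : 'rV[R]_d -> R) (I : finType)
    (dX dO : measure_display)
    (Xi : measurableType dX) (P : probability Xi R)
    (Omega : measurableType dO) (Pr : probability Omega R)
    (N : nat) (xi : 'I_N -> {RV Pr >-> Xi})
    (Y : set 'rV[R]_d) (F : option I -> 'rV[R]_d -> Xi -> R)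
    (xstar : 'rV[R]_d)
    (eta_s theta_s sigma_s2 alpha : R) (sig2 : R * R -> R) (t eps0 : R),
  let rect := [set q : R * R | 0 <= q.1 <= theta_s /\ 0 <= q.2 <= eta_s] in
  let Good := good_event nrm P xi Y F sigma_s2 alpha sig2
                eta_s theta_s t eps0 in
  is_norm nrm ->
  (0 < N)%N ->
  iid_with_law P xi ->
  caratheodory_integrable P Y F ->
  minimizer P Y F xstar ->
  (forall w, saa_solvable xi Y F w) ->
  LSCQ P Y F eta_s theta_s ->
  (forall i z, @convex_function R 'rV[R]_d Y (F i ^~ z)) ->
  {within rect, continuous sig2} ->
  0 <= t ->
  0 <= eps0 < theta_s ->
  R_set nrm P N Y F sigma_s2 alpha sig2 eta_s theta_s t eps0 !=set0 ->
  cvg (check_delta nrm P N Y F sigma_s2 alpha sig2 eta_s theta_s t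
         @ check_r_filter nrm P N Y F sigma_s2 alpha sig2
             eta_s theta_s t eps0) ->
  (forall rho : R,
     (forall theta delta, rect (theta, delta) ->
        goodness_over nrm P xi Y F xstar sigma_s2 (sig2 (theta, delta))
          alpha rho (near_opt P Y F delta theta)) ->
     measurable Good /\
     ((1 - expR (- t) - 2 * (#|I|%:R + 1) * rho)%:E <= Pr Good)%E) /\
  (forall p kappa : R,
     (forall theta delta, rect (theta, delta) ->
        greatness_over nrm P Y F xstar sigma_s2 (sig2 (theta, delta))
          alpha p kappa (near_opt P Y F delta theta)) ->
     let rho := powR (c_bdg * kappa * Num.sqrt (p / N%:R)) p in
     measurable Good /\
     ((1 - expR (- t) - 2 * (#|I|%:R + 1) * rho)%:E <= Pr Good)%E).
Proof.
(* The constant of [great_good]: exp 4 from the tilted bound, 2 from joining its two exceptional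
   events. *)
exists (2 * expR 4); split; first by rewrite mulr_gt0// expR_gt0.
move=> d nrm I dX dO Xi P Omega Pr N xi Y F xstar eta th s_s2 alpha sig2 t eps0.
move=> rect Good nrmP N0 iid cara xsP solv sl cvxF csig t0 e0 R0 cvgd.
split=> [rho goodF|p kappa greatF rho].
  exact: (good_event_probability nrmP N0 iid cara xsP solv sl cvxF csig t0 e0 goodF R0 cvgd).
apply: (good_event_probability nrmP N0 iid cara xsP solv sl cvxF csig t0 e0 _ R0 cvgd).
move=> u v uv; have [p2 k1 [s1 s2 al fc Fc hv hH]] := greatF _ _ uv.
have gg s h : 0 < s -> great P p kappa s h -> good P xi rho s h.
  by move=> s0; exact: great_good.
split.
  rewrite powR_gt0// !mulr_gt0 ?expR_gt0 ?sqrtr_gt0 ?divr_gt0 ?ltr0n//.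
  - exact: lt_le_trans k1.
  - exact: lt_le_trans p2.
split=> // i; first exact: gg.
by have [L hL FL] := hH i; exists L => //; exact: gg.
Qed.
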